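(* Let $(R,\mathfrak m)$ be a commutative Noetherian local ring with $\dim(R)=n$, let $M\neq 0$ be a finitely generated $R$-module, and let $S=R\ltimes M$ be the idealization of $M$ over $R$, regarded as an $R$-module via $a\mapsto(a,0)$. Then: (a) $S$ is a Cohen-Macaulay ring if and only if $S$ is a Cohen-Macaulay $R$-module, if and only if both $R$ and $M$ are Cohen-Macaulay of dimension $n$. (b) $S$ is a generalized Cohen-Macaulay ring if and only if $S$ is a generalized Cohen-Macaulay $R$-module, if and only if $R$ is generalized Cohen-Macaulay and either $\dim_R(M)\le 0$ or $M$ is generalized Cohen-Macaulay of dimension $n$. (c) $S$ is a $1$-Cohen-Macaulay ring if and only if $S$ is a $1$-Cohen-Macaulay $R$-module, if and only if $R$ is $1$-Cohen-Macaulay and either $\dim_R(M)\le 1$ or $M$ is $1$-Cohen-Macaulay of dimension $n$.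
   Context: The idealization $R\ltimes M$ is the additive group $R\oplus M$ with multiplication $(a,x)(b,y)=(ab,ay+bx)$; it is a Noetherian local ring with maximal ideal $\mathfrak m\oplus M$ and dimension $\dim(R)$. Let $M$ be a finitely generated module of dimension $d$ over a Noetherian local ring $(R,\mathfrak m)$. For an Artinian $R$-module $A$ put $\dim_R(A)=\dim(R/\operatorname{Ann}_RA)$; the dimension of the zero module (and of the zero ring) is $-1$. Put $\mathfrak a_i(M)=\operatorname{Ann}_RH^i_{\mathfrak m}(M)$ and $\mathfrak a(M)=\mathfrak a_0(M)\cdots\mathfrak a_{d-1}(M)$ (the empty product is $R$). Then $M$ is Cohen-Macaulay (resp. generalized Cohen-Macaulay, $1$-Cohen-Macaulay) if $\dim(R/\mathfrak a(M))=-1$ (resp. $\le 0$, $\le 1$); equivalently, for all $i<d$, $H^i_{\mathfrak m}(M)=0$ (resp. $\dim_R H^i_{\mathfrak m}(M)\le 0$, $\dim_R H^i_{\mathfrak m}(M)\le 1$). A local ring has one of these properties if it has it as a module over itself. *)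

(* Defs.v *)
From HB Require Import structures.
From mathcomp Require Import all_boot all_order all_algebra boolp.

Set Implicit Arguments.
Unset Strict Implicit.
Unset Printing Implicit Defensive.

Import Order.TTheory GRing.Theory Num.Theory.
Local Open Scope ring_scope.

(* Sets of ring or module elements are boolean predicates, as in the ideals   *)
(* of ring_quotient.v; undecidable ones are made boolean by `[< _ >].         *)

Section Ideals.
Variable R : comNzRingType.
Implicit Types (I J m : {pred R}) (k : int).

Definition ideal I : Prop := submod_closed (I : {pred R^o}).

(* The library's idealr_closed already requires 1 \notin P. *)
Definition prime_ideal (P : {pred R}) : Prop :=
  idealr_closed P /\ prime_idealr_closed P.

Definition maximal_ideal m : Prop :=
  idealr_closed m /\
  forall J, idealr_closed J -> {subset m <= J} -> {subset J <= m}.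

Definition local_ring m : Prop :=
  maximal_ideal m /\ forall m', maximal_ideal m' -> m' =i m.

Definition in_span (M : lmodType R) (s : seq M) (x : M) : Prop :=
  exists c : 'I_(size s) -> R, x = \sum_(i < size s) c i *: s`_i.

Definition finitely_generated (M : lmodType R) : Prop :=
  exists s : seq M, forall x : M, in_span s x.

Definition noetherian : Prop :=
  forall I, ideal I -> exists s : seq R^o, forall x, x \in I <-> in_span s x.

Definition ideal_mul I J : {pred R} :=
  [pred x | `[< exists n (a b : 'I_n -> R),
      (forall i, a i \in I /\ b i \in J) /\ x = \sum_(i < n) a i * b i >]].

Definition ideal_exp I (t : nat) : {pred R} := iter t (ideal_mul I) predT.

(* P 0, ..., P (c - 1) are c primes containing I, strictly increasing; such a *)
(* chain has length c - 1 and is the same thing as a chain of primes of R/I.  *)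
Definition prime_chain I (c : nat) (P : nat -> {pred R}) : Prop :=
  (forall i, (i < c)%N -> prime_ideal (P i) /\ {subset I <= P i}) /\
  (forall i, (i.+1 < c)%N ->
     {subset P i <= P i.+1} /\ ~ {subset P i.+1 <= P i}).

(* dim (R/I) <= k and dim (R/I) = k; the empty chain c = 0 gives dimension -1 *)
(* to the zero ring.                                                          *)
Definition quo_dim_le I k : Prop :=
  forall c P, prime_chain I c P -> c%:Z - 1 <= k.

Definition quo_dim I k : Prop :=
  quo_dim_le I k /\ exists c P, prime_chain I c P /\ c%:Z - 1 = k.

Definition ring_dim k : Prop := quo_dim (pred1 0) k.

Definition ann (M : lmodType R) : {pred R} :=
  [pred r | `[< forall x : M, r *: x = 0 >]].

Definition mod_dim_le (M : lmodType R) k : Prop := quo_dim_le (ann M) k.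
Definition mod_dim (M : lmodType R) k : Prop := quo_dim (ann M) k.

End Ideals.

Section LocalCohomology.
Variable R : comNzRingType.

Definition injective_module (E : lmodType R) : Prop :=
  forall (A B : lmodType R) (f : {linear A -> B}) (g : {linear A -> E}),
    injective f -> exists h : {linear B -> E}, forall a, h (f a) = g a.

Record injective_resolution (M : lmodType R) := InjectiveResolution {
  res_mod :> nat -> lmodType R;
  res_aug : {linear M -> res_mod 0%N};
  res_diff : forall i, {linear res_mod i -> res_mod i.+1};
  res_inj : forall i, injective_module (res_mod i);
  res_aug_inj : injective res_aug;
  res_exact0 : forall x : res_mod 0%N,
    res_diff 0%N x = 0 <-> exists y, x = res_aug y;
  res_exactS : forall i (x : res_mod i.+1),
    res_diff i.+1 x = 0 <-> exists y, x = res_diff i y }.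

Definition torsion (m : {pred R}) (N : lmodType R) : {pred N} :=
  [pred x | `[< exists t : nat, forall a, a \in ideal_exp m t -> a *: x = 0 >]].

Arguments torsion m N : clear implicits.

Definition lc_cocycle (m : {pred R}) (M : lmodType R)
    (E : injective_resolution M) (i : nat) (x : E i) : Prop :=
  x \in torsion m (E i) /\ res_diff E i x = 0.

Definition lc_coboundary (m : {pred R}) (M : lmodType R)
    (E : injective_resolution M) (i : nat) : E i -> Prop :=
  match i return E i -> Prop with
  | 0 => fun x => x = 0
  | j.+1 => fun x => exists2 y, y \in torsion m (E j) & x = res_diff E j y
  end.

(* The annihilator of the i-th right derived functor of m-torsion at M:       *)
(* H^i_m(M) is cocycles modulo coboundaries of the m-torsion of an injective  *)
(* resolution E of M. Resolutions exist and the quotient does not depend on E *)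
(* up to isomorphism, so that "for all E" and "for some E" agree.             *)
Definition ann_lc (m : {pred R}) (M : lmodType R) (i : nat) : {pred R} :=
  [pred r | `[< forall (E : injective_resolution M) (x : E i),
      lc_cocycle m x -> lc_coboundary m (r *: x) >]].

Definition ann_lc_prod (m : {pred R}) (M : lmodType R) (d : nat) : {pred R} :=
  \big[@ideal_mul R / (predT : {pred R})]_(i < d) ann_lc m M i.

(* k = -1, 0, 1: Cohen-Macaulay, generalized Cohen-Macaulay,                  *)
(* 1-Cohen-Macaulay. The zero module has d = -1 and the empty product.        *)
Definition CM_module (k : int) (m : {pred R}) (M : lmodType R) : Prop :=
  exists2 d : int, mod_dim M d &
    quo_dim_le (ann_lc_prod m M (absz (Num.max 0 d))) k.

Definition CM_ring (k : int) : Prop :=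
  exists2 m : {pred R}, local_ring m & CM_module k m R^o.

End LocalCohomology.

Arguments ring_dim : clear implicits.
Arguments noetherian : clear implicits.
Arguments CM_ring : clear implicits.

Definition idealization (R : comNzRingType) (M : lmodType R) : Type :=
  (R * M)%type.

Section Idealization.
Variables (R : comNzRingType) (M : lmodType R).
Local Notation S := (idealization M).

HB.instance Definition _ := GRing.Zmodule.copy S (R * M)%type.

Definition idl_one : S := (1, 0).
Definition idl_mul (s t : S) : S := (s.1 * t.1, s.1 *: t.2 + t.1 *: s.2).

Fact idl_mulA : associative idl_mul.
Proof.
move=> [a x] [b y] [c z]; rewrite /idl_mul /= mulrA !scalerDr !scalerA addrA.
by rewrite [c * a]mulrC [c * b]mulrC.
Qed.

Fact idl_mulC : commutative idl_mul.
Proof. by move=> [a x] [b y]; rewrite /idl_mul /= mulrC addrC. Qed.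

Fact idl_mul1 : left_id idl_one idl_mul.
Proof. by move=> [a x]; rewrite /idl_mul /= mul1r scale1r scaler0 addr0. Qed.

Fact idl_mulDl : left_distributive idl_mul +%R.
Proof.
move=> [a x] [b y] [c z]; rewrite /idl_mul /= mulrDl scalerDl scalerDr.
by congr pair; rewrite /= addrACA.
Qed.

Fact idl_one_neq0 : idl_one != 0.
Proof. by apply/eqP => -[/eqP]; rewrite oner_eq0. Qed.

HB.instance Definition _ := GRing.Zmodule_isComNzRing.Build S
  idl_mulA idl_mulC idl_mul1 idl_mulDl idl_one_neq0.

Definition idl_inj (a : R) : S := (a, 0).
Definition idl_scale (a : R) (s : S) : S := idl_inj a * s.

Fact idl_injM a b : idl_inj a * idl_inj b = idl_inj (a * b).
Proof. by congr pair; rewrite /= !scaler0 addr0. Qed.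

Fact idl_scaleA a b s : idl_scale a (idl_scale b s) = idl_scale (a * b) s.
Proof. by rewrite /idl_scale mulrA idl_injM. Qed.

Fact idl_scale1 : left_id 1 idl_scale.
Proof. by move=> s; rewrite /idl_scale mul1r. Qed.

Fact idl_scaleDr : right_distributive idl_scale +%R.
Proof. by move=> a s t; rewrite /idl_scale mulrDr. Qed.

Fact idl_scaleDl s : {morph idl_scale^~ s : a b / a + b}.
Proof.
move=> a b; rewrite /idl_scale -mulrDl; congr (_ * _).
by congr pair; rewrite /= addr0.
Qed.

HB.instance Definition _ := GRing.Zmodule_isLmodule.Build R S
  idl_scaleA idl_scale1 idl_scaleDr idl_scaleDl.

End Idealization.

(* Main.v *)
(* Local cohomology is computed by the Cech complex of generators of m: over a Noetherian ring
   injective modules are acyclic for it, so that dimension shifting along an injective resolution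
   identifies the two. Since this applies to injective modules over S = R \ltimes M as well,
   H^i(S) over S and over R have the same annihilator in R, and primes of S are the P \oplus M;
   this compares the ring S and the R-module S, which is R \oplus M. It remains to see that
   dim R/Ann H^d(M) >= d for d = dim M. For a prime p over Ann M with dim R/p = d there is a
   nonzero map M -> R/p, which is onto on H^d by Grothendieck's vanishing theorem; and any r not
   in p acts surjectively on H^d(R/p), for the same reason. So Ann H^d(M) is contained in p
   as soon as H^d(R/p) is not zero, which follows by comparing dual Krull dimensions (of chains of
   submodules): it is at most i for H^i of any finitely generated module, and at least d for
   H^d(R/p). *)

From HB Require Import structures.
Require Import Defs.
From mathcomp Require Import all_boot all_order all_algebra boolp.
From mathcomp Require Import all_field classical_sets functions ring zify.

Set Implicit Arguments.
Unset Strict Implicit.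
Unset Printing Implicit Defensive.

Import Order.TTheory GRing.Theory Num.Theory.
Local Open Scope ring_scope.
Local Open Scope quotient_scope.

(** * Submodules and quotient modules *)

Section LinearMaps.
Variables (R : comNzRingType).

(** Membership in [ann_lc] quantifies over all injective resolutions, so it yields information only
    once a resolution is known to exist; one is built from characters with values in a divisible
    group. Cohomology modules are never formed as quotients: a class is a cocycle in [Hz] modulo
    [Hb], and connecting maps and subquotients are additive relations. Nonvanishing of [H^d(R/p)]
    alone does not lend itself to induction: with [Q = R/(p + yR)], a nonzero [H^(d-1)(Q)] may come
    entirely from [H^(d-1)(R/p)]. The lower bound on the dual dimension is the stronger statement
    that goes through, because the upper bound makes that contribution too small to matter. The
    alternative in (b) and (c) has this origin: [S] has dimension [n], so its condition involves
    [H^i(M)] for all [i < n]. If [d = dim M < n], then [i = d] is among them, and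
    [dim R/Ann H^d(M) >= d] forces [d <= k]. The three parts are the cases [k = -1, 0, 1] of one
    argument; for [k = -1] the alternative is void as [M] is nonzero. *)

Definition mklin (A B : lmodType R) (f : A -> B) (fL : linear f) : {linear A -> B} :=
  HB.pack f (GRing.isLinear.Build R A B *:%R f fL).

Lemma linZ (A B : lmodType R) (f : {linear A -> B}) a x : f (a *: x) = a *: f x.
Proof. exact: linearZ. Qed.
Lemma linP (A B : lmodType R) (f : {linear A -> B}) a x y :
  f (a *: x + y) = a *: f x + f y.
Proof. exact: linearP. Qed.

Lemma mklinE (A B : lmodType R) (f : A -> B) (fL : linear f) x : mklin fL x = f x.
Proof. by []. Qed.
End LinearMaps.

Section Submodules.
Variables (R : comNzRingType) (N : lmodType R).

(** Predicates in [Prop], so that kernels, images, colons and unions of chains are submodules as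
    they stand; [sm_bool] goes back to boolean predicates, from which [subm] gets its module
    structure. *)
Record submod := Submod {
  sm_pred :> N -> Prop;
  sm0 : sm_pred 0;
  smZD : forall a u v, sm_pred u -> sm_pred v -> sm_pred (a *: u + v) }.

Variable P : submod.

Lemma smZ a u : P u -> P (a *: u).
Proof. by move=> Pu; rewrite -[_ *: _]addr0; apply: smZD => //; apply: sm0. Qed.
Lemma smD u v : P u -> P v -> P (u + v).
Proof. by move=> Pu Pv; rewrite -[u]scale1r; apply: smZD. Qed.
Lemma smN u : P u -> P (- u).
Proof. by move=> Pu; rewrite -scaleN1r; apply: smZ. Qed.
Lemma smB u v : P u -> P v -> P (u - v).
Proof. by move=> Pu /smN; apply: smD. Qed.
Lemma sm_sum n (F : 'I_n -> N) : (forall i, P (F i)) -> P (\sum_(i < n) F i).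
Proof.
by move=> PF; elim/big_ind: _ => //; [apply: sm0|apply: smD].
Qed.

Definition sm_bool : {pred N} := fun x => `[< P x >].

Fact sm_bool_closed : submod_closed sm_bool.
Proof.
split; first by apply/asboolP/sm0.
by move=> a u v /asboolP Pu /asboolP Pv; apply/asboolP/smZD.
Qed.

HB.instance Definition _ := GRing.isSubmodClosed.Build R N sm_bool
  (GRing.submod_closed_semi sm_bool_closed).

Definition subm := {x : N | sm_bool x}.
HB.instance Definition _ := [isSub of subm for @sval _ _].
HB.instance Definition _ := [Choice of subm by <:].
HB.instance Definition _ := [SubChoice_isSubLmodule of subm by <:].

Definition inj_subm : subm -> N := val.
Fact inj_subm_linear : linear inj_subm.
Proof. by move=> a u v; rewrite /inj_subm linearP. Qed.
HB.instance Definition _ := GRing.isLinear.Build R subm N *:%R inj_subm inj_subm_linear.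

Lemma inj_subm_inj : injective inj_subm. Proof. exact: val_inj. Qed.
Lemma inj_submP (u : subm) : P (inj_subm u).
Proof. by apply/asboolP/(valP u). Qed.
Lemma inj_subm_ex x : P x -> exists u : subm, inj_subm u = x.
Proof. by move=> Px; have /asboolP Px' := Px; exists (exist _ x Px'). Qed.

Definition quot_eq (x y : N) : bool := `[< P (x - y) >].
Fact quot_eq_equiv : equiv_class_of quot_eq.
Proof.
split=> [x|x y|y x z].
- by apply/asboolP; rewrite subrr; apply: sm0.
- by apply/asboolP/asboolP => /smN; rewrite opprB.
- move=> /asboolP xy /asboolP yz; apply/asboolP.
  by have := smD xy yz; rewrite addrA subrK.
Qed.
Canonical quot_equiv := EquivRelPack quot_eq_equiv.

Definition quot := {eq_quot quot_equiv}.
HB.instance Definition _ := Choice.on quot.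
HB.instance Definition _ := EqQuotient.on quot.

Lemma quot_piP x y : \pi_quot x = \pi_quot y <-> P (x - y).
Proof. by split=> [/eqmodP/asboolP //|H]; apply/eqmodP/asboolP. Qed.

Lemma quot_reprP x : P (repr (\pi_quot x) - x).
Proof. by apply/quot_piP; rewrite reprK. Qed.

Definition quot_add (u v : quot) : quot := \pi_quot (repr u + repr v).
Definition quot_opp (u : quot) : quot := \pi_quot (- repr u).
Definition quot_scale (a : R) (u : quot) : quot := \pi_quot (a *: repr u).

Fact quot_addE x y : quot_add (\pi_quot x) (\pi_quot y) = \pi_quot (x + y).
Proof.
apply/quot_piP; rewrite opprD addrACA; apply: smD; exact: quot_reprP.
Qed.
Fact quot_oppE x : quot_opp (\pi_quot x) = \pi_quot (- x).
Proof. by apply/quot_piP; rewrite -opprD; apply: smN; apply: quot_reprP. Qed.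
Fact quot_scaleE a x : quot_scale a (\pi_quot x) = \pi_quot (a *: x).
Proof. by apply/quot_piP; rewrite -scalerBr; apply: smZ; apply: quot_reprP. Qed.

Lemma quot_ind (K : quot -> Prop) : (forall x, K (\pi_quot x)) -> forall u, K u.
Proof. by move=> Kpi u; rewrite -[u]reprK; apply: Kpi. Qed.

Fact quot_addA : associative quot_add.
Proof.
elim/quot_ind=> x; elim/quot_ind=> y; elim/quot_ind=> z.
by rewrite !quot_addE addrA.
Qed.
Fact quot_addC : commutative quot_add.
Proof. by move=> u v; rewrite /quot_add addrC. Qed.
Fact quot_add0 : left_id (\pi_quot 0) quot_add.
Proof. by elim/quot_ind=> x; rewrite quot_addE add0r. Qed.
Fact quot_addN : left_inverse (\pi_quot 0) quot_opp quot_add.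
Proof. by elim/quot_ind=> x; rewrite quot_oppE quot_addE addNr. Qed.

HB.instance Definition _ := GRing.isZmodule.Build quot
  quot_addA quot_addC quot_add0 quot_addN.

Fact quot_scaleA a b u : quot_scale a (quot_scale b u) = quot_scale (a * b) u.
Proof. by elim/quot_ind: u => x; rewrite !quot_scaleE scalerA. Qed.
Fact quot_scale1 : left_id 1 quot_scale.
Proof. by elim/quot_ind=> x; rewrite quot_scaleE scale1r. Qed.
Fact quot_scaleDr : right_distributive quot_scale +%R.
Proof.
move=> a; elim/quot_ind=> x; elim/quot_ind=> y.
by rewrite [_ + _]quot_addE !quot_scaleE [RHS]quot_addE scalerDr.
Qed.
Fact quot_scaleDl u : {morph quot_scale^~ u : a b / a + b}.
Proof.
by move=> a b; elim/quot_ind: u => x; rewrite !quot_scaleE [RHS]quot_addE scalerDl.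
Qed.
HB.instance Definition _ := GRing.Zmodule_isLmodule.Build R quot
  quot_scaleA quot_scale1 quot_scaleDr quot_scaleDl.

Definition proj_quot (x : N) : quot := \pi_quot x.
Fact proj_quot_linear : linear proj_quot.
Proof.
move=> a u v; rewrite /proj_quot.
by rewrite -[a *: \pi_quot u]/(quot_scale a _) quot_scaleE [RHS]quot_addE.
Qed.
HB.instance Definition _ := GRing.isLinear.Build R N quot *:%R proj_quot proj_quot_linear.

Lemma proj_quot_surj (u : quot) : exists x, proj_quot x = u.
Proof. by exists (repr u); apply: reprK. Qed.
Lemma proj_quot_eq0 x : proj_quot x = 0 <-> P x.
Proof.
by rewrite -(linear0 proj_quot) /proj_quot quot_piP subr0.
Qed.
End Submodules.

Arguments submod [R] N.
Arguments inj_subm {R N} P _.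
Arguments proj_quot {R N} P _.

(** * Noetherian modules *)

Section ExactSequences.
Variable R : comNzRingType.

Definition short_exact (A B C : lmodType R) (f : {linear A -> B}) (g : {linear B -> C}) :=
  [/\ injective f, forall c, exists b, g b = c & forall b, g b = 0 <-> exists a, b = f a].

Section Lift.
Variables (A B : lmodType R) (P : submod A) (h : {linear A -> B}).
Hypothesis hP : forall x, P x -> h x = 0.

Definition quot_lift_fun (u : quot P) : B := h (repr u).
Lemma quot_lift_funE x : quot_lift_fun (proj_quot P x) = h x.
Proof.
by apply/eqP; rewrite -subr_eq0 -linearB hP //; apply: quot_reprP.
Qed.
Fact quot_lift_linear : linear quot_lift_fun.
Proof.
move=> a u v; case: (proj_quot_surj u) => x <-; case: (proj_quot_surj v) => y <-.
by rewrite -linearP !quot_lift_funE linearP.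
Qed.
Definition quot_lift := mklin quot_lift_linear.
Lemma quot_liftE x : quot_lift (proj_quot P x) = h x.
Proof. exact: quot_lift_funE. Qed.
End Lift.

Definition ker_sm (A B : lmodType R) (f : {linear A -> B}) : submod A.
Proof.
exists (fun x => f x = 0); first exact: linear0.
by move=> a u v fu fv; rewrite linearP fu fv scaler0 addr0.
Defined.

Definition im_sm (A B : lmodType R) (f : {linear A -> B}) : submod B.
Proof.
exists (fun y => exists x, y = f x); first by exists 0; rewrite linear0.
by move=> a _ _ [u ->] [v ->]; exists (a *: u + v); rewrite linearP.
Defined.

Definition full_sm (A : lmodType R) : submod A.
Proof. by exists (fun=> True). Defined.

Lemma short_exact_ker (A B : lmodType R) (f : {linear A -> B}) :
  (forall y, exists x, f x = y) -> short_exact (inj_subm (ker_sm f)) f.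
Proof.
move=> fs; split=> [|//|b]; first exact: inj_subm_inj.
split=> [fb|[a ->]]; last exact: inj_submP a.
by have [u <-] := inj_subm_ex (fb : ker_sm f b); exists u.
Qed.

Lemma short_exact_coker (A B : lmodType R) (f : {linear A -> B}) :
  injective f -> short_exact f (proj_quot (im_sm f)).
Proof.
by move=> fi; split=> // [c|b]; [exact: proj_quot_surj|exact: proj_quot_eq0].
Qed.

Lemma short_exact_sub (A : lmodType R) (P : submod A) :
  short_exact (inj_subm P) (proj_quot P).
Proof.
split=> [|c|b]; [exact: inj_subm_inj|exact: proj_quot_surj|].
rewrite proj_quot_eq0; split=> [/inj_subm_ex[u <-]|[a ->]]; first by exists u.
exact: inj_submP.
Qed.

Fact scalel_linear (N : lmodType R) (a : R) : linear (fun x : N => a *: x).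
Proof. by move=> b u v; rewrite scalerDr !scalerA mulrC. Qed.
Definition smul (N : lmodType R) a := mklin (@scalel_linear N a).

Fact scaler_linear (N : lmodType R) (e : N) : linear (fun r : R^o => r *: e).
Proof. by move=> b u v; rewrite scalerDl scalerA. Qed.
Definition rmul (N : lmodType R) e := mklin (@scaler_linear N e).

Fact id_linear (N : lmodType R) : linear (fun x : N => x).
Proof. by []. Qed.
Definition idlin (N : lmodType R) : {linear N -> N} := mklin (@id_linear N).

Fact comp_linear (A B C : lmodType R) (g : {linear B -> C}) (f : {linear A -> B}) :
  linear (fun x => g (f x)).
Proof. by move=> a u v; rewrite !linearP. Qed.
Definition complin A B C g f := mklin (@comp_linear A B C g f).
End ExactSequences.

Section Noetherian.
Variable R : comNzRingType.
Implicit Types N A B C : lmodType R.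

Definition fg_sm N (P : submod N) := exists s : seq N, forall x, P x <-> in_span s x.
Definition noeth_mod N := forall P : submod N, fg_sm P.

Lemma in_span_nil N (x : N) : in_span [::] x <-> x = 0.
Proof.
split=> [[c ->]|->]; first by rewrite big_ord0.
by exists (fun=> 0); rewrite big_ord0.
Qed.

Lemma in_span_cons N (e : N) s x :
  in_span (e :: s) x <-> exists a y, in_span s y /\ x = a *: e + y.
Proof.
split=> [[c ->]|[a [y [[c ->] ->]]]].
  rewrite big_ord_recl /=; exists (c ord0).
  by eexists; split; last reflexivity; exists (fun i => c (lift ord0 i)).
exists (fun i => if unlift ord0 i is Some j then c j else a).
rewrite big_ord_recl /= unlift_none; congr (_ + _).
by apply: eq_bigr => i _; rewrite liftK.
Qed.

Lemma in_span_zmod N (s : seq N) : exists P : submod N, forall x, P x <-> in_span s x.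
Proof.
elim: s => [|e s [P IH]].
  exists (@Submod _ _ (fun x : N => x = 0) erefl
    (fun a u v Hu Hv => etrans (congr2 (fun x y => a *: x + y) Hu Hv)
      (etrans (addr0 _) (scaler0 _ a)))) => x.
  by rewrite in_span_nil.
have P0 : exists a y, P y /\ 0 = a *: e + y :> N.
  by exists 0, 0; rewrite scale0r addr0; split=> //; apply: sm0.
have PZD a u v : (exists b y, P y /\ u = b *: e + y) ->
    (exists b y, P y /\ v = b *: e + y) -> exists b y, P y /\ a *: u + v = b *: e + y.
  move=> [b [y [Py ->]]] [c [z [Pz ->]]]; exists (a * b + c), (a *: y + z).
  split; first exact: smZD.
  by rewrite scalerDr scalerA scalerDl addrACA.
exists (@Submod _ _ (fun x => exists a y, P y /\ x = a *: e + y) P0 PZD) => x /=.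
rewrite in_span_cons; split=> -[a [y [Hy ->]]]; exists a, y; split=> //; exact/IH.
Qed.

Definition span_sm N (s : seq N) : submod N := projT1 (cid (in_span_zmod s)).
Lemma span_smE N (s : seq N) x : span_sm s x <-> in_span s x.
Proof. exact: (projT2 (cid (in_span_zmod s))). Qed.

Lemma span_sub N (s : seq N) (P : submod N) :
  (forall x, x \in s -> P x) -> forall x, in_span s x -> P x.
Proof.
elim: s => [|e s IH] Ps x; first by move=> /in_span_nil ->; apply: sm0.
move=> /in_span_cons[a [y [ys ->]]]; apply: smZD; first exact/Ps/mem_head.
by apply: IH ys => z zs; apply: Ps; rewrite inE zs orbT.
Qed.

Lemma mem_span N (s : seq N) x : x \in s -> in_span s x.
Proof.
elim: s => [|e s IH] //; rewrite inE => /predU1P[->|/IH xs]; apply/in_span_cons.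
  by exists 1, 0; rewrite scale1r addr0; split=> //; apply/span_smE/sm0.
by exists 0, x; rewrite scale0r add0r.
Qed.

Lemma in_span_map N (N' : lmodType R) (f : {linear N -> N'}) s y :
  in_span (map f s) y <-> exists2 x, in_span s x & y = f x.
Proof.
elim: s y => [|e s IH] y /=.
  rewrite in_span_nil; split=> [->|[x /in_span_nil -> ->]]; last by rewrite linear0.
  by exists 0; [exact/in_span_nil|rewrite linear0].
rewrite in_span_cons; split=> [[a [z [/IH[x xs ->] ->]]]|[x /in_span_cons[a [z [zs ->]]] ->]].
  by exists (a *: e + x); [apply/in_span_cons; exists a, x|rewrite linearP].
exists a, (f z); rewrite linearP; split=> //; apply/IH; by exists z.
Qed.

Lemma in_span_cat N (s t : seq N) x :
  in_span (s ++ t) x <-> exists y z, [/\ in_span s y, in_span t z & x = y + z].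
Proof.
elim: s x => [|e s IH] x /=.
  split=> [xt|[y [z [/in_span_nil -> zt ->]]]]; last by rewrite add0r.
  by exists 0, x; rewrite add0r; split=> //; apply/in_span_nil.
rewrite in_span_cons; split=> [[a [w [/IH[y [z [ys zt ->]] ->]]]]|].
  exists (a *: e + y), z; rewrite addrA; split=> //; apply/in_span_cons.
  by exists a, y.
move=> [_ [z [/in_span_cons[a [y [ys ->]]] zt ->]]].
exists a, (y + z); rewrite addrA; split=> //; apply/IH.
by exists y, z.
Qed.

(** A submodule [P] of [B] is generated by the images of generators of its preimage in [A] together
    with lifts, chosen inside [P], of generators of its image in [C]. *)
Lemma noeth_ext (A B C : lmodType R) (f : {linear A -> B}) (g : {linear B -> C}) :
  (forall b, g b = 0 -> exists a, b = f a) ->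
  noeth_mod A -> noeth_mod C -> noeth_mod B.
Proof.
move=> ex nA nC P.
have PA0 : P (f 0) by rewrite linear0; apply: sm0.
have PAZ a u v : P (f u) -> P (f v) -> P (f (a *: u + v)).
  by move=> ? ?; rewrite linearP; apply: smZD.
have PC0 : exists2 b, P b & 0 = g b by exists 0; [exact: sm0|rewrite linear0].
have PCZ a u v : (exists2 b, P b & u = g b) -> (exists2 b, P b & v = g b) ->
    exists2 b, P b & a *: u + v = g b.
  move=> [b Pb ->] [b' Pb' ->]; exists (a *: b + b'); last by rewrite linearP.
  exact: smZD.
have [s sP] := nA (@Submod _ _ (fun a => P (f a)) PA0 PAZ).
have [t tP] := nC (@Submod _ _ (fun c => exists2 b, P b & c = g b) PC0 PCZ).
have [t' [t'P tE]] : exists t', (forall b, b \in t' -> P b) /\ t = map g t'.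
  have : forall c, c \in t -> exists2 b, P b & c = g b.
    by move=> c /mem_span /tP.
  elim: (t) => [|c t0 IH] Ht; first by exists [::].
  have [|t' [H1 ->]] := IH; first by move=> d dt; apply: Ht; rewrite inE dt orbT.
  have [b Pb ->] := Ht c (mem_head _ _).
  exists (b :: t'); split=> // d; rewrite inE => /predU1P[->|/H1] //.
exists (map f s ++ t') => x; split=> [Px|]; last first.
  apply: span_sub => y; rewrite mem_cat => /orP[/mapP[a /mem_span /sP ? ->]|/t'P] //.
have /tP : exists2 b, P b & g x = g b by exists x.
rewrite tE => /in_span_map[z zt' gxz].
have [|a xza] := ex (x - z); first by rewrite linearB gxz subrr.
apply/in_span_cat; exists (f a), z; rewrite -xza subrK; split=> //.
rewrite xza; apply/in_span_map; exists a => //; apply/sP.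
by rewrite /= -xza; apply: smB => //; apply: span_sub zt'.
Qed.

Definition zero_mod := quot (full_sm R^o).
Lemma zero_modE (x : zero_mod) : x = 0.
Proof. by have [r <-] := proj_quot_surj x; apply/proj_quot_eq0. Qed.

Lemma noetherian_mod : noetherian R -> noeth_mod R^o.
Proof.
move=> nR P; have [s sP] := nR (sm_bool P) (@sm_bool_closed _ _ P).
by exists s => x; rewrite -sP; split=> [Px|/asboolP //]; apply/asboolP.
Qed.

Lemma mod_noetherian : noeth_mod R^o -> noetherian R.
Proof.
move=> nR I [I0 IZ].
have [s sP] := nR (@Submod _ R^o (fun x => x \in I) I0 IZ).
by exists s => x; apply: sP.
Qed.

Definition fg (N : lmodType R) := finitely_generated N.

Lemma fg_noeth N : noetherian R -> fg N -> noeth_mod N.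
Proof.
move=> nR [s]; move En: (size s) => n; elim: n N s En => [|n IH] N [//|e s] // => [_|[En]] sN.
  move=> P; exists [::] => x; have /in_span_nil -> := sN x.
  by rewrite in_span_nil; split=> // _; apply: sm0.
apply: (@noeth_ext R^o N (quot (im_sm (rmul e))) (rmul e) (proj_quot _)).
- by move=> b /proj_quot_eq0.
- exact: noetherian_mod.
apply: (IH _ (map (proj_quot _) s)) => [|u]; first by rewrite size_map.
have [x <-] := proj_quot_surj u; apply/in_span_map.
have /in_span_cons[a [y [ys ->]]] := sN x; exists y => //.
apply/eqP; rewrite -subr_eq0 -linearB addrK; apply/eqP/proj_quot_eq0.
by exists a.
Qed.

Lemma noeth_fg N : noeth_mod N -> fg N.
Proof. by move=> /(_ (full_sm N))[s sN]; exists s => x; apply/sN. Qed.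

Lemma fg_sub N (P : submod N) : noetherian R -> fg N -> fg (subm P).
Proof.
move=> nR fN; apply: noeth_fg.
apply: (@noeth_ext zero_mod _ N (mklin (f := fun=> 0) _) (inj_subm P)).
- by move=> a u v; rewrite scaler0 addr0.
- move=> zL b Pb; exists 0; apply: (@inj_subm_inj _ _ P).
  by rewrite Pb linear0.
- move=> Q; exists [::] => x; rewrite (zero_modE x).
  by split=> _; [apply/in_span_nil|apply: sm0].
- exact: fg_noeth.
Qed.

Lemma fg_surj N (N' : lmodType R) (f : {linear N -> N'}) :
  (forall y, exists x, f x = y) -> fg N -> fg N'.
Proof.
move=> fs [s sN]; exists (map f s) => y; have [x <-] := fs y.
by apply/in_span_map; exists x.
Qed.

Lemma fg_quot N (P : submod N) : fg N -> fg (quot P).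
Proof. by apply: (@fg_surj _ _ (proj_quot P)); apply: proj_quot_surj. Qed.

Lemma fg_ring : fg R^o.
Proof.
exists [:: 1 : R^o] => x; apply/in_span_cons; exists x, 0.
by split; [exact/in_span_nil|rewrite addr0 /GRing.scale /= mulr1].
Qed.

Lemma noeth_acc N (P : nat -> submod N) : noeth_mod N ->
  (forall i x, P i x -> P i.+1 x) -> exists n, forall k x, P k x -> P n x.
Proof.
move=> nN Pinc.
have Pmon i j x : (i <= j)%N -> P i x -> P j x.
  by move=> /subnK <-; elim: (j - i)%N => [//|k IH /IH]; apply: Pinc.
have U0 : exists i, P i 0 by exists 0%N; apply: sm0.
have UZ a u v : (exists i, P i u) -> (exists i, P i v) -> exists i, P i (a *: u + v).
  move=> [i Pi] [j Pj]; exists (maxn i j); apply: smZD.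
    exact: Pmon (leq_maxl _ _) Pi.
  exact: Pmon (leq_maxr _ _) Pj.
have [s sP] := nN (@Submod _ _ (fun x => exists i, P i x) U0 UZ).
suff [n Pn] : exists n, forall x, x \in s -> P n x.
  by exists n => k x Pk; apply: (span_sub Pn); apply/sP; exists k.
have : forall x, x \in s -> exists i, P i x by move=> x /mem_span /sP.
elim: (s) => [|e s0 IH] He; first by exists 0%N.
have [|n Pn] := IH; first by move=> x xs; apply: He; rewrite inE xs orbT.
have [i Pi] := He e (mem_head _ _); exists (maxn i n) => x.
rewrite inE => /predU1P[->|/Pn]; first exact: Pmon (leq_maxl _ _) Pi.
exact: Pmon (leq_maxr _ _).
Qed.

(** A counterexample would grow, by choice, into a strictly increasing sequence of counterexamples,
    against [noeth_acc]. *)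
Lemma noeth_ind N (K : submod N -> Prop) : noeth_mod N ->
  (forall P : submod N, (forall Q : submod N, (forall x, P x -> Q x) -> (exists2 x, Q x & ~ P x) -> K Q)
     -> K P) -> forall P, K P.
Proof.
move=> nN step P0; apply: contrapT => nK0.
have next (P : {P : submod N | ~ K P}) : {Q : {P : submod N | ~ K P} |
    (forall x, sval P x -> sval Q x) /\ exists2 x, sval Q x & ~ sval P x}.
  apply: cid; apply: contrapT => Hno; apply: (svalP P); apply: step => Q PQ sPQ.
  by apply: contrapT => nKQ; apply: Hno; exists (exist _ Q nKQ).
pose c := fix c n := if n is k.+1 then sval (next (c k)) else exist _ P0 nK0.
have [|n cn] := @noeth_acc N (fun n => sval (c n)) nN.
  by move=> i x; apply: (svalP (next (c i))).1.
have [x cx ncx] := (svalP (next (c n))).2.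
by apply: ncx; apply: (cn n.+1).
Qed.

Definition sprime (P : submod R^o) := ~ P 1 /\ forall a b : R, P (a * b) -> P a \/ P b.

Definition ann_sm N (e : N) : submod R^o := ker_sm (rmul e).

(** Written as the annihilator of the class of [a] in [R/I], so that [R/(I : a)] embeds into [R/I]
    via [quot_lift]. *)
Definition colon_sm (I : submod R^o) (a : R) : submod R^o :=
  ker_sm (rmul (proj_quot I (a : R^o))).

Lemma colon_smE I a r : colon_sm I a r <-> I (r * a).
Proof. by rewrite /= -linearZ; apply: proj_quot_eq0. Qed.

Definition add_sm N (P Q : submod N) : submod N.
Proof.
exists (fun x => exists y z, [/\ P y, Q z & x = y + z]).
  by exists 0, 0; rewrite addr0; split=> //; apply: sm0.
move=> a _ _ [y [z [Py Qz ->]]] [y' [z' [Py' Qz' ->]]].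
exists (a *: y + y'), (a *: z + z').
by rewrite scalerDr addrACA; split=> //; apply: smZD.
Defined.

(* A cyclic module R/I with ab in I but a, b not in I is an extension of R/(I + aR) by
   R/(I : a), so that Noetherian induction on I reduces cyclic modules to the R/P. *)
Lemma devissage (K : lmodType R -> Prop) : noetherian R ->
  (forall N, (forall x : N, x = 0) -> K N) ->
  (forall P : submod R^o, sprime P -> K (quot P)) ->
  (forall A B C (f : {linear A -> B}) (g : {linear B -> C}),
     short_exact f g -> K A -> K C -> K B) ->
  forall N, fg N -> K N.
Proof.
move=> nR K0 Kprime Kext.
have Kcyc (I : submod R^o) : K (quot I).
  move: I; apply: (noeth_ind (noetherian_mod nR)) => I IH.
  have [I1|nI1] := pselect (I 1).
    apply: K0 => u; have [x <-] := proj_quot_surj u; apply/proj_quot_eq0.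
    by rewrite -[x]mulr1; apply: smZ.
  have [pI|npI] := pselect (sprime I); first exact: Kprime.
  have [a [b [Iab nIa nIb]]] : exists a b : R, [/\ I (a * b), ~ I a & ~ I b].
    apply: contrapT => Hno; apply: npI; split=> // a b Iab.
    apply: contrapT => /not_orP[nIa nIb]; apply: Hno; by exists a, b.
  pose J := colon_sm I a; pose L := add_sm I (im_sm (rmul (a : R^o))).
  have fJ r : J r -> rmul (proj_quot I (a : R^o)) r = 0 by [].
  have gL r : I r -> proj_quot L r = 0.
    move=> Ir; apply/proj_quot_eq0; exists r, 0; rewrite addr0; split=> //.
    exact: sm0.
  apply: (Kext _ _ _ (quot_lift fJ) (quot_lift gL)).
  - split=> [u v|c|u].
    + have [x <-] := proj_quot_surj u; have [y <-] := proj_quot_surj v.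
      rewrite !quot_liftE => /eqP; rewrite -subr_eq0 -linearB => /eqP H.
      by apply/eqP; rewrite -subr_eq0 -linearB; apply/eqP/proj_quot_eq0.
    + by have [x <-] := proj_quot_surj c; exists (proj_quot I x); rewrite quot_liftE.
    + have [x <-] := proj_quot_surj u; rewrite quot_liftE proj_quot_eq0.
      split=> [[y [_ [Iy [r ->] ->]]]|[v]].
        exists (proj_quot J r); rewrite quot_liftE linearD /=.
        by have /proj_quot_eq0 -> := Iy; rewrite add0r linearZ.
      have [r <-] := proj_quot_surj v; rewrite quot_liftE /= -linearZ => E.
      exists (x - r *: (a : R^o)), (r *: (a : R^o)); rewrite subrK; split=> //.
        by apply/proj_quot_eq0; rewrite linearB /= E subrr.
      by exists r.
  - apply: IH => [x Ix|].
      by apply/colon_smE; rewrite mulrC; apply: smZ.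
    by exists b => //; apply/colon_smE; rewrite mulrC.
  - apply: IH => [x Ix|].
      by exists x, 0; rewrite addr0; split=> //; apply: sm0.
    exists a => //; exists 0, a; rewrite add0r; split=> //; first exact: sm0.
    by exists 1; rewrite /= scale1r.
move=> N [s]; move En: (size s) => n; elim: n N s En => [|n IH] N [//|e s] // => [_|[En]] sN.
  by apply: K0 => x; apply/in_span_nil/sN.
have he r : ann_sm e r -> rmul e r = 0 by [].
apply: (Kext _ _ _ (quot_lift he) (proj_quot (im_sm (rmul e)))); last 2 first.
- exact: Kcyc.
- apply: (IH _ (map (proj_quot _) s)) => [|u]; first by rewrite size_map.
  have [x <-] := proj_quot_surj u; apply/in_span_map.
  have /in_span_cons[a [y [ys ->]]] := sN x; exists y => //.
  apply/eqP; rewrite -subr_eq0 -linearB addrK; apply/eqP/proj_quot_eq0.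
  by exists a.
split=> [u v|c|b]; last 2 first.
- exact: proj_quot_surj.
- rewrite proj_quot_eq0; split=> [[r ->]|[u]].
    by exists (proj_quot _ r); rewrite quot_liftE.
  by have [r <-] := proj_quot_surj u; rewrite quot_liftE => ->; exists r.
have [x <-] := proj_quot_surj u; have [y <-] := proj_quot_surj v.
rewrite !quot_liftE => /eqP; rewrite -subr_eq0 -linearB => /eqP H.
by apply/eqP; rewrite -subr_eq0 -linearB; apply/eqP/proj_quot_eq0.
Qed.
End Noetherian.

(** * Localization and Cech complexes *)

Section Loc.
Variables (R : comNzRingType) (x : R).

Section LocType.
Variable (N : lmodType R).

Definition geom_sm : submod (nat -> N).
Proof.
exists (fun f => exists k0, forall k, (k0 <= k)%N -> f k.+1 = x *: f k).
  by exists 0%N => k _; rewrite scaler0.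
move=> a u v [i Hu] [j Hv]; exists (maxn i j) => k; rewrite geq_max => /andP[ik jk].
change (a *: u k.+1 + v k.+1 = x *: (a *: u k + v k)).
by rewrite Hu // Hv // scalerDr !scalerA mulrC.
Defined.

Definition evz_sm : submod (subm geom_sm).
Proof.
exists (fun u => exists k0, forall k, (k0 <= k)%N -> inj_subm geom_sm u k = 0).
  by exists 0%N => k _; rewrite linear0.
move=> a u v [i Hu] [j Hv]; exists (maxn i j) => k; rewrite geq_max => /andP[ik jk].
rewrite linearP; change (a *: inj_subm geom_sm u k + inj_subm geom_sm v k = 0).
by rewrite Hu // Hv // scaler0 addr0.
Defined.

(* The fraction n / x^k is the class, up to eventual equality, of the sequence
   j |-> x^(j-k) n, which is eventually geometric of ratio x. *)
Definition loc : lmodType R := quot evz_sm.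

Lemma loc_class (f : nat -> N) : geom_sm f -> exists u, inj_subm geom_sm u = f.
Proof. exact: inj_subm_ex. Qed.

Lemma geom_pow n : geom_sm (fun k => x ^+ k *: n).
Proof. by exists 0%N => k _; rewrite exprS scalerA. Qed.

Definition loc_inc_fun (n : N) : loc :=
  proj_quot evz_sm (projT1 (cid (loc_class (geom_pow n)))).
Lemma loc_inc_funE n u : (inj_subm geom_sm u = fun k => x ^+ k *: n) ->
  loc_inc_fun n = proj_quot evz_sm u.
Proof.
move=> uE; congr (proj_quot _ _); apply: (@inj_subm_inj _ _ geom_sm).
by rewrite uE; apply: (projT2 (cid (loc_class (geom_pow n)))).
Qed.

Fact loc_inc_linear : linear loc_inc_fun.
Proof.
move=> a m n.
have [u uE] := loc_class (geom_pow m); have [v vE] := loc_class (geom_pow n).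
rewrite (loc_inc_funE uE) (loc_inc_funE vE) -linearP; apply: loc_inc_funE.
rewrite linearP /= uE vE; apply: funext => k.
change (a *: (x ^+ k *: m) + x ^+ k *: n = x ^+ k *: (a *: m + n)).
by rewrite scalerDr !scalerA mulrC.
Qed.
Definition loc_inc : {linear N -> loc} := mklin loc_inc_linear.

Lemma loc_inc_eq0 n : loc_inc n = 0 <-> exists k, x ^+ k *: n = 0.
Proof.
have [u uE] := loc_class (geom_pow n).
rewrite /= (loc_inc_funE uE) proj_quot_eq0 /= uE; split=> [[k0 H]|[k0 H]].
  by exists k0; apply: H.
by exists k0 => k /subnK <-; rewrite exprD -scalerA H scaler0.
Qed.

Lemma loc_num (u : loc) : exists k n, x ^+ k *: u = loc_inc n.
Proof.
have [v <-] := proj_quot_surj u; have [k0 Hv] := inj_submP v.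
exists k0, (inj_subm geom_sm v k0).
have [w wE] := loc_class (geom_pow (inj_subm geom_sm v k0)).
rewrite /= (loc_inc_funE wE); apply/eqP; rewrite -subr_eq0; apply/eqP.
rewrite -linearZ -linearB proj_quot_eq0; exists k0 => k /subnK <-.
rewrite linearB linearZ /= wE.
change (x ^+ k0 *: inj_subm geom_sm v (k - k0 + k0)%N
  - x ^+ (k - k0 + k0) *: inj_subm geom_sm v k0 = 0).
have -> j : inj_subm geom_sm v (j + k0)%N = x ^+ j *: inj_subm geom_sm v k0.
  elim: j => [|j IH]; first by rewrite scale1r.
  by rewrite addSn Hv ?leq_addl // IH scalerA exprS.
by rewrite scalerA -exprD addnC subrr.
Qed.

Lemma loc_inj (u : loc) : x *: u = 0 -> u = 0.
Proof.
have [v <-] := proj_quot_surj u; have [k0 Hv] := inj_submP v.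
rewrite -linearZ !proj_quot_eq0 => -[k1 H]; exists (maxn k0 k1).+1 => -[//|k].
rewrite ltnS geq_max => /andP[? ?]; rewrite Hv //.
by have := H k; rewrite linearZ; apply.
Qed.

Lemma loc_surj (u : loc) : exists v, x *: v = u.
Proof.
have [v <-] := proj_quot_surj u; have [k0 Hv] := inj_submP v.
have [|w wE] := @loc_class (fun k => inj_subm geom_sm v k.-1).
  exists k0.+1 => -[//|k] /=; exact: Hv.
exists (proj_quot _ w); apply/eqP; rewrite -subr_eq0; apply/eqP.
rewrite -linearZ -linearB proj_quot_eq0; exists k0.+1 => -[//|k] kk.
rewrite linearB linearZ /= wE /=.
change (x *: inj_subm geom_sm v k - inj_subm geom_sm v k.+1 = 0).
by rewrite Hv // subrr.
Qed.

Lemma loc_injX k (u : loc) : x ^+ k *: u = 0 -> u = 0.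
Proof.
elim: k => [|k IH]; first by rewrite scale1r.
by rewrite exprS -scalerA => /loc_inj/IH.
Qed.
Lemma loc_surjX k (u : loc) : exists v, x ^+ k *: v = u.
Proof.
elim: k => [|k [v <-]]; first by exists u; rewrite scale1r.
by have [w <-] := loc_surj v; exists w; rewrite exprSr scalerA.
Qed.
Lemma loc_cancel k (u v : loc) : x ^+ k *: u = x ^+ k *: v -> u = v.
Proof.
move/eqP; rewrite -subr_eq0 -scalerBr => /eqP/loc_injX/eqP.
by rewrite subr_eq0 => /eqP.
Qed.
End LocType.

Section LocMap.
Variables (A B : lmodType R) (f : {linear A -> B}).

(** The value is pinned down by clearing denominators. Quantifying over all numerators [n] and
    exponents [k] makes it independent of the fraction chosen, so that linearity and functoriality
    can be checked after multiplication by a power of [x]. *)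
Fact loc_map_ex (u : loc A) : exists v : loc B,
  forall k n, x ^+ k *: u = loc_inc A n -> x ^+ k *: v = loc_inc B (f n).
Proof.
have [k [n kn]] := loc_num u; have [v vE] := loc_surjX k (loc_inc B (f n)).
exists v => l m lm.
have /loc_inc_eq0[j] : loc_inc A (x ^+ l *: n - x ^+ k *: m) = 0.
  by rewrite linearB !(linZ (loc_inc _)) -kn -lm !scalerA mulrC subrr.
move=> /(congr1 f); rewrite linear0 linZ linearB !(linZ f) => H.
have : loc_inc B (x ^+ l *: f n - x ^+ k *: f m) = 0 by apply/loc_inc_eq0; exists j.
rewrite linearB !(linZ (loc_inc _)) -vE => /eqP; rewrite subr_eq0 => /eqP H2.
by apply: (@loc_cancel _ k); rewrite -H2 !scalerA mulrC.
Qed.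

Definition loc_map_fun u := projT1 (cid (loc_map_ex u)).
Lemma loc_map_funE u k n :
  x ^+ k *: u = loc_inc A n -> x ^+ k *: loc_map_fun u = loc_inc B (f n).
Proof. exact: (projT2 (cid (loc_map_ex u))). Qed.

Fact loc_map_linear : linear loc_map_fun.
Proof.
move=> a u v; have [k [m Hu]] := loc_num u; have [l [n Hv]] := loc_num v.
apply: (@loc_cancel _ (k + l)).
have E : x ^+ (k + l) *: (a *: u + v) = loc_inc A (a *: (x ^+ l *: m) + x ^+ k *: n).
  rewrite linP !(linZ (loc_inc A)) -Hu -Hv scalerDr !scalerA exprD.
  by congr (_ *: _ + _ *: _); ring.
rewrite (loc_map_funE E) linP linP !(linZ f) !(linZ (loc_inc B)).
rewrite -(loc_map_funE Hu) -(loc_map_funE Hv) scalerDr !scalerA exprD.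
by congr (_ *: _ + _ *: _); ring.
Qed.
Definition loc_map : {linear loc A -> loc B} := mklin loc_map_linear.

Lemma loc_mapE u k n : x ^+ k *: u = loc_inc A n -> x ^+ k *: loc_map u = loc_inc B (f n).
Proof. exact: loc_map_funE. Qed.

Lemma loc_map_inc n : loc_map (loc_inc A n) = loc_inc B (f n).
Proof. by have := @loc_mapE (loc_inc A n) 0%N n; rewrite !scale1r; apply. Qed.
End LocMap.

Lemma loc_map_comp (A B C : lmodType R) (f : {linear A -> B}) (g : {linear B -> C})
  (h : {linear A -> C}) : (forall a, h a = g (f a)) ->
  forall u, loc_map h u = loc_map g (loc_map f u).
Proof.
move=> hE u; have [k [n Hu]] := loc_num u; apply: (@loc_cancel _ k).
by rewrite (loc_mapE _ Hu) hE -!loc_map_inc -Hu !linZ.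
Qed.

Lemma loc_map_id (A : lmodType R) (f : {linear A -> A}) :
  (forall a, f a = a) -> forall u, loc_map f u = u.
Proof.
move=> fE u; have [k [n Hu]] := loc_num u; apply: (@loc_cancel _ k).
by rewrite (loc_mapE _ Hu) fE.
Qed.

Lemma loc_map_exact (A B C : lmodType R) (f : {linear A -> B}) (g : {linear B -> C}) :
  short_exact f g -> short_exact (loc_map f) (loc_map g).
Proof.
move=> [fi gs ex]; split.
- suff H u : loc_map f u = 0 -> u = 0.
    move=> u v /eqP; rewrite -subr_eq0 -linearB => /eqP/H/eqP.
    by rewrite subr_eq0 => /eqP.
  have [k [n Hu]] := loc_num u => fu0; apply: (@loc_injX _ k); rewrite Hu.
  have := loc_mapE f Hu; rewrite fu0 scaler0 => /esym/loc_inc_eq0[j].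
  rewrite -linZ => H; apply/loc_inc_eq0; exists j; apply: fi.
  by rewrite H linear0.
- move=> c; have [k [n Hc]] := loc_num c; have [b gb] := gs n.
  have [u Hu] := loc_surjX k (loc_inc B b); exists u.
  by apply: (@loc_cancel _ k); rewrite (loc_mapE _ Hu) gb Hc.
- move=> u; split=> [|[v ->]]; last first.
    have [k [n Hv]] := loc_num v; apply: (@loc_injX _ k).
    rewrite -!linZ Hv !loc_map_inc.
    have -> : g (f n) = 0 by apply/ex; exists n.
    by rewrite linear0.
  have [k [n Hu]] := loc_num u => gu0; have := loc_mapE g Hu.
  rewrite gu0 scaler0 => /esym/loc_inc_eq0[j]; rewrite -linZ => /ex[a ja].
  have [v Hv] := loc_surjX (j + k) (loc_inc A a); exists v.
  apply: (@loc_cancel _ (j + k)); rewrite (loc_mapE _ Hv) -ja linZ -Hu.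
  by rewrite scalerA exprD.
Qed.

(** The maps whose cokernel and kernel are [x]-power torsion, that is, which become bijective when
    [x] is inverted. This property of [N -> N_x] is the one that passes termwise to Cech
    complexes. *)
Definition loclike (A B : lmodType R) (f : {linear A -> B}) :=
  (forall b, exists k a, x ^+ k *: b = f a) /\
  (forall a, f a = 0 -> exists k, x ^+ k *: a = 0).

Lemma loc_inc_loclike N : loclike (loc_inc N).
Proof. by split=> [u|n /loc_inc_eq0]; first exact: loc_num. Qed.
End Loc.

Lemma loc_map_loclike (R : comNzRingType) (x y : R) (A B : lmodType R) (f : {linear A -> B}) :
  loclike x f -> loclike x (loc_map y f).
Proof.
move=> [fs fi]; split=> [u|u].
  have [l [b Hu]] := loc_num u; have [k [a Ha]] := fs b.
  have [v Hv] := loc_surjX l (loc_inc y A a); exists k, v.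
  apply: (@loc_cancel _ _ _ l); rewrite (loc_mapE _ Hv) -Ha (linZ (loc_inc _ _)) -Hu.
  by rewrite !scalerA mulrC.
have [l [a Hu]] := loc_num u => fu0; have := loc_mapE f Hu.
rewrite fu0 scaler0 => /esym/loc_inc_eq0[j]; rewrite -linZ => /fi[k Hk].
exists k; apply: (@loc_injX _ y _ l).
rewrite scalerA mulrC -scalerA Hu -(linZ (loc_inc _ _)); apply/loc_inc_eq0; exists j.
by rewrite scalerA mulrC -scalerA.
Qed.

(** * Cech complexes as exact functors *)

Section CechFunctors.
Variable R : comNzRingType.

(** An exact functor from modules to complexes with the module itself in degree 0: exactly what long
    exact sequences and dimension shifting use. Functoriality is stated for maps that agree
    pointwise, which spares equalities between bundled linear maps. *)
Record cfunctor := CFunctor {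
  cob :> lmodType R -> nat -> lmodType R;
  cd : forall N i, {linear cob N i -> cob N i.+1};
  cdd : forall N i a, cd N i.+1 (cd N i a) = 0;
  cmap : forall A B : lmodType R, {linear A -> B} -> forall i, {linear cob A i -> cob B i};
  cmap_d : forall (A B : lmodType R) (f : {linear A -> B}) i a, cmap f i.+1 (cd A i a) = cd B i (cmap f i a);
  cmap_comp : forall (A B C : lmodType R) (f : {linear A -> B}) (g : {linear B -> C}) (h : {linear A -> C}) i,
    (forall a, h a = g (f a)) -> forall a, cmap h i a = cmap g i (cmap f i a);
  cmap_id : forall (A : lmodType R) (f : {linear A -> A}) i, (forall a, f a = a) -> forall a, cmap f i a = a;
  cmap_exact : forall (A B C : lmodType R) (f : {linear A -> B}) (g : {linear B -> C}) i,
    short_exact f g -> short_exact (cmap f i) (cmap g i);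
  caug : forall N : lmodType R, {linear N -> cob N 0%N};
  caug_inj : forall N n, caug N n = 0 -> n = 0;
  caug_surj : forall N a, exists n, caug N n = a;
  caug_map : forall (A B : lmodType R) (f : {linear A -> B}) a, cmap f 0%N (caug A a) = caug B (f a) }.

Definition zeroC (A B : lmodType R) : {linear A -> B}.
Proof. by refine (mklin (f := fun=> 0) _) => a u v; rewrite scaler0 addr0. Defined.

Definition shift (C : nat -> lmodType R) (i : nat) : lmodType R :=
  if i is j.+1 then C j else zero_mod R.

Definition shift_d (C : nat -> lmodType R) (d : forall i, {linear C i -> C i.+1}) i :
  {linear shift C i -> shift C i.+1} :=
  match i with 0 => zeroC _ _ | j.+1 => d j end.

Definition shift_map (C D : nat -> lmodType R) (f : forall i, {linear C i -> D i}) i :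
  {linear shift C i -> shift D i} :=
  match i with 0 => zeroC _ _ | j.+1 => f j end.

(* The cone of C -> D, shifted so that C^0 sits in degree 0. *)
Definition cyl (C D : nat -> lmodType R) i : lmodType R := (C i * shift D i)%type.

Section Cyl.
Variables (C D : nat -> lmodType R) (dC : forall i, {linear C i -> C i.+1})
  (dD : forall i, {linear D i -> D i.+1}) (f : forall i, {linear C i -> D i}).
Definition cyl_d_fun i (u : cyl C D i) : cyl C D i.+1 :=
  (dC i u.1, f i u.1 - shift_d dD i u.2).
Fact cyl_d_linear i : linear (@cyl_d_fun i).
Proof.
move=> a [u1 u2] [v1 v2]; congr pair => /=; first by rewrite linP.
by rewrite [f i _]linP [shift_d _ _ _]linP opprD addrACA scalerBr.
Qed.
Definition cyl_d i : {linear cyl C D i -> cyl C D i.+1} := mklin (@cyl_d_linear i).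
End Cyl.

Section CylMap.
Variables (C D C' D' : nat -> lmodType R) (f : forall i, {linear C i -> C' i})
  (g : forall i, {linear D i -> D' i}).
Definition cyl_map_fun i (u : cyl C D i) : cyl C' D' i := (f i u.1, shift_map g i u.2).
Fact cyl_map_linear i : linear (@cyl_map_fun i).
Proof.
by move=> a [u1 u2] [v1 v2]; congr pair => /=; rewrite linP.
Qed.
Definition cyl_map i : {linear cyl C D i -> cyl C' D' i} := mklin (@cyl_map_linear i).
End CylMap.

Definition cech_nil : cfunctor.
Proof.
pose ob (N : lmodType R) (i : nat) : lmodType R := if i is j.+1 then zero_mod R else N.
pose d (N : lmodType R) i : {linear ob N i -> ob N i.+1} := zeroC _ _.
pose mp (A B : lmodType R) (f : {linear A -> B}) i : {linear ob A i -> ob B i} :=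
  match i with 0 => f | j.+1 => zeroC _ _ end.
refine (@CFunctor ob d _ mp _ _ _ _ (fun N => idlin N) _ _ _).
- by [].
- by move=> A B f i a; rewrite [RHS]zero_modE; apply: zero_modE.
- by move=> A B C f g h [|i] hE a; [apply: hE|].
- by move=> A f [|i] fE a; [apply: fE|apply/esym/zero_modE].
- move=> A B C f g [|i] // [fi gs ex]; split.
  + by move=> u v _; rewrite [u]zero_modE [v]zero_modE.
  + by move=> c; exists 0; rewrite [RHS]zero_modE linear0.
  + by move=> b; split=> // _; exists 0; rewrite [b]zero_modE linear0.
- by [].
- by move=> N a; exists a.
- by [].
Defined.

Section CechCons.
Variables (x : R) (F : cfunctor).

Fact cech_cons_aug_linear (N : lmodType R) :
  linear (fun n : N => (caug F N n, 0) : cyl (F N) (F (loc x N)) 0%N).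
Proof. by move=> a u v; congr pair; rewrite /= ?linP // scaler0 addr0. Qed.

Lemma cmap_loc (A B : lmodType R) (f : {linear A -> B}) i a :
  cmap F (loc_map x f) i (cmap F (loc_inc x A) i a)
  = cmap F (loc_inc x B) i (cmap F f i a).
Proof.
transitivity (cmap F (complin (loc_inc x B) f) i a); last exact: cmap_comp.
by apply: esym; apply: cmap_comp => b; rewrite loc_map_inc.
Qed.

Definition cech_cons : cfunctor.
Proof.
pose ob (N : lmodType R) i : lmodType R := cyl (F N) (F (loc x N)) i.
pose d (N : lmodType R) i : {linear ob N i -> ob N i.+1} :=
  cyl_d (cd F N) (cd F (loc x N)) (fun j => cmap F (loc_inc x N) j) i.
pose mp (A B : lmodType R) (f : {linear A -> B}) i : {linear ob A i -> ob B i} :=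
  cyl_map (fun j => cmap F f j) (fun j => cmap F (loc_map x f) j) i.
refine (@CFunctor ob d _ mp _ _ _ _ (fun N => mklin (@cech_cons_aug_linear N)) _ _ _).
- move=> N i [a b]; congr pair; first exact: cdd.
  rewrite /= cmap_d.
  have -> : cd F (loc x N) i (cmap F (loc_inc x N) i a
      - shift_d (cd F (loc x N)) i b) = cd F (loc x N) i (cmap F (loc_inc x N) i a).
    rewrite linearB; case: i a b => [|i] a b /=; first by rewrite linear0 subr0.
    by rewrite cdd subr0.
  by rewrite subrr.
- move=> A B f i [a b]; congr pair; first exact: cmap_d.
  rewrite /= linearB cmap_loc; congr (_ - _); case: i a b => [|i] a b /=.
    by rewrite linear0.
  exact: cmap_d.
- move=> A B C f g h i hE [a b]; congr pair; first exact: cmap_comp.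
  case: i a b => [|i] a b //=; apply: cmap_comp; exact: loc_map_comp.
- move=> A f i fE [a b]; congr pair; first exact: cmap_id.
  case: i a b => [|i] a b /=; first exact/esym/zero_modE.
  by apply: cmap_id; apply: loc_map_id.
- move=> A B C f g i fg.
  have [f1 g1 ex1] := cmap_exact F i fg.
  have [f2 g2 ex2] : short_exact (shift_map (fun j => cmap F (loc_map x f) j) i)
      (shift_map (fun j => cmap F (loc_map x g) j) i).
    case: i {f1 g1 ex1} => [|i] /=; last exact/cmap_exact/loc_map_exact.
    split=> [u v _|c|b]; first by rewrite [u]zero_modE [v]zero_modE.
      by exists 0; rewrite [RHS]zero_modE.
    by split=> // _; exists 0; rewrite [b]zero_modE.
  split.
  + by move=> [a b] [a' b'] [/f1 -> /f2 ->].
  + move=> [c c']; have [b <-] := g1 c; have [b' <-] := g2 c'.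
    by exists (b, b').
  + move=> [b b']; split=> [[/ex1[a ->] /ex2[a' ->]]|[[a a'] [-> ->]]].
      by exists (a, a').
    by congr pair; [apply/ex1; exists a|apply/ex2; exists a'].
- by move=> N n [/caug_inj].
- move=> N [a b]; have [n <-] := caug_surj a; exists n; congr pair.
  exact/esym/zero_modE.
- by move=> A B f a; congr pair; exact: caug_map.
Defined.

End CechCons.

(** The tensor product of the complexes [R -> R_x], applied to [N] and built one factor at a time as
    a shifted cone of the map induced by [N -> N_x]; degree 0 stays [N], so [H^0] is the torsion. *)
Fixpoint cech (xs : seq R) : cfunctor :=
  if xs is x :: xs' then cech_cons x (cech xs') else cech_nil.
End CechFunctors.

(** * Cech cohomology *)

Section Cohomology.
Variables (R : comNzRingType) (F : cfunctor R).

Definition Hz (N : lmodType R) i : submod (F N i) := ker_sm (cd F N i).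
Definition Hb (N : lmodType R) i : submod (F N i) :=
  match i return submod (F N i) with
  | 0 => im_sm (zeroC (zero_mod R) (F N 0%N))
  | j.+1 => im_sm (cd F N j)
  end.

Lemma Hb0 N (z : F N 0%N) : Hb N 0 z <-> z = 0.
Proof. by split=> [[? ->]|->]; [|exact: sm0]. Qed.

Lemma Hb_Hz N i z : Hb N i z -> Hz N i z.
Proof.
case: i z => [|i] z /=; first by move=> [? ->]; rewrite linear0.
by move=> [y ->]; apply: cdd.
Qed.

Lemma map_Hz (A B : lmodType R) (f : {linear A -> B}) i z : Hz A i z -> Hz B i (cmap F f i z).
Proof. by rewrite /= -cmap_d => ->; rewrite linear0. Qed.
Lemma map_Hb (A B : lmodType R) (f : {linear A -> B}) i z : Hb A i z -> Hb B i (cmap F f i z).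
Proof.
case: i z => [|i] z; first by move=> /Hb0 ->; rewrite linear0; apply: sm0.
by move=> [y ->]; exists (cmap F f i y); rewrite cmap_d.
Qed.

Section LES.
Variables (A B C : lmodType R) (f : {linear A -> B}) (g : {linear B -> C}).
Hypothesis fg : short_exact f g.

Lemma Hb_lift i b : Hb C i (cmap F g i b) ->
  exists2 w, Hb B i w & cmap F g i (b - w) = 0.
Proof.
case: i b => [|i] b.
  by move=> /Hb0 gb; exists 0; [exact: sm0|rewrite subr0].
move=> [c gb]; have [_ gs _] := cmap_exact F i fg; have [b' gb'] := gs c.
exists (cd F B i b'); first by exists b'.
by rewrite linearB cmap_d gb gb' subrr.
Qed.

Lemma les_mid i z : Hz B i z -> Hb C i (cmap F g i z) ->
  exists2 a, Hz A i a & Hb B i (z - cmap F f i a).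
Proof.
move=> zZ /Hb_lift[w wB]; have [_ _ ex] := cmap_exact F i fg.
move=> /ex[a fa]; exists a.
  have [fi' _ _] := cmap_exact F i.+1 fg; apply: fi'.
  by rewrite linear0 cmap_d -fa linearB (Hb_Hz wB : cd _ _ _ _ = _) (zZ : cd _ _ _ _ = _) subrr.
by rewrite -fa opprB addrC subrK.
Qed.

(** The connecting homomorphism as a relation on elements: [b] lifts [c], and [a] is what [d b]
    comes from. As a relation it is linear without any choice of lifts; [delta_Hb] says that it is
    well defined on classes. *)
Definition delta i (c : F C i) (a : F A i.+1) :=
  exists2 b, cmap F g i b = c & cmap F f i.+1 a = cd F B i b.

Lemma delta_ex i c : Hz C i c -> exists a, delta c a.
Proof.
move=> cZ; have [_ gs _] := cmap_exact F i fg; have [b gb] := gs c.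
have [_ _ ex] := cmap_exact F i.+1 fg.
have /ex[a fa] : cmap F g i.+1 (cd F B i b) = 0 by rewrite cmap_d gb.
by exists a, b.
Qed.

Lemma delta_Hz i (c : F C i) a : delta c a -> Hz A i.+1 a.
Proof.
move=> [b _ fa]; have [fi _ _] := cmap_exact F i.+2 fg; apply: fi.
by rewrite linear0 cmap_d fa cdd.
Qed.

Lemma delta_ZD i r (c c' : F C i) a a' : delta c a -> delta c' a' ->
  delta (r *: c + c') (r *: a + a').
Proof.
by move=> [b gb fa] [b' gb' fa']; exists (r *: b + b'); rewrite !linP ?gb ?gb' ?fa ?fa'.
Qed.

Lemma delta_Z i r (c : F C i) a : delta c a -> delta (r *: c) (r *: a).
Proof. by move=> [b gb fa]; exists (r *: b); rewrite !linZ ?gb ?fa. Qed.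

Lemma delta_B i (c c' : F C i) a a' : delta c a -> delta c' a' ->
  delta (c - c') (a - a').
Proof. by move=> [b <- fa] [b' <- fa']; exists (b - b'); rewrite !linearB ?fa ?fa'. Qed.

Lemma delta_Hb i (c : F C i) a : delta c a -> Hb C i c -> Hb A i.+1 a.
Proof.
move=> [b gb fa] cB; have [_ _ ex] := cmap_exact F i fg.
have [w wB gw] : exists2 w, Hb B i w & cmap F g i (b - w) = 0.
  by apply: Hb_lift; rewrite gb.
move/ex: gw => [a' fa']; exists a'; have [fi _ _] := cmap_exact F i.+1 fg; apply: fi.
by rewrite fa cmap_d -fa' linearB (Hb_Hz wB : cd _ _ _ _ = _) subr0.
Qed.

Lemma delta_ker i (c : F C i) a : delta c a -> Hb A i.+1 a ->
  exists2 b, Hz B i b & cmap F g i b = c.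
Proof.
move=> [b gb fa] [a' aE]; exists (b - cmap F f i a').
  by rewrite /= linearB -fa -cmap_d aE subrr.
rewrite linearB gb.
suff -> : cmap F g i (cmap F f i a') = 0 by rewrite subr0.
by have [_ _ ex] := cmap_exact F i fg; apply/ex; exists a'.
Qed.

Lemma delta_map i b a : Hz B i b -> delta (cmap F g i b) a -> Hb A i.+1 a.
Proof.
move=> bZ dba.
have d0 : delta (cmap F g i b) 0 by exists b; rewrite // linear0.
have := delta_Hb (delta_B dba d0); rewrite subrr subr0; apply; exact: sm0.
Qed.

Lemma les_A i a : Hz A i.+1 a -> Hb B i.+1 (cmap F f i.+1 a) ->
  exists2 c, Hz C i c & delta c a.
Proof.
move=> aZ [b fa]; exists (cmap F g i b); last by exists b.
rewrite /= -cmap_d -fa.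
by have [_ _ ex] := cmap_exact F i.+1 fg; apply/ex; exists a.
Qed.
End LES.

Definition acyclic_at (N : lmodType R) i := forall z, Hz N i z -> Hb N i z.
End Cohomology.

Section Cech.
Variable R : comNzRingType.
Implicit Types (xs : seq R) (N : lmodType R).

Lemma cech_cons_ind xs y N i (K : cech (y :: xs) N i -> Prop) :
  (forall (a : cech xs N i) (b : shift (cech xs (loc y N)) i), K (a, b)) -> forall u, K u.
Proof. exact: (fun H (u : cyl (cech xs N) (cech xs (loc y N)) i) => let: (a, b) := u in H a b). Qed.

Lemma cech_loclike xs x (A B : lmodType R) (f : {linear A -> B}) i :
  loclike x f -> loclike x (cmap (cech xs) f i).
Proof.
elim: xs A B f i => [|y xs IH] A B f i fl.
  case: i => [|i] //=; split=> [b|a _]; last by exists 0%N; apply: zero_modE.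
  by exists 0%N, 0; rewrite [LHS]zero_modE.
have [s1 i1] := IH _ _ f i fl.
have [s2 i2] : loclike x (shift_map (fun j => cmap (cech xs) (loc_map y f) j) i).
  case: i {s1 i1} => [|i] /=; last exact/IH/loc_map_loclike.
  split=> [b|a _]; last by exists 0%N; apply: zero_modE.
  by exists 0%N, 0; rewrite [LHS]zero_modE.
split; elim/cech_cons_ind; [move=> b b'|move=> a a' E].
  have [k [a ka]] := s1 b; have [l [a' la]] := s2 b'.
  exists (k + l)%N, (x ^+ l *: a, x ^+ k *: a'); congr pair.
    by rewrite /= linZ -ka scalerA -exprD addnC.
  by rewrite /= linZ -la scalerA -exprD.
have /i1[k ka] := congr1 fst E; have /i2[l la] := congr1 snd E.
exists (k + l)%N; congr pair => /=.
  by rewrite addnC exprD -scalerA ka scaler0.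
by rewrite exprD -scalerA la scaler0.
Qed.

Lemma cech_Hz0 xs N n :
  Hz (cech xs) N 0 (caug (cech xs) N n) <-> forall x, x \in xs -> exists k, x ^+ k *: n = 0.
Proof.
elim: xs => [|x xs IH]; first by split=> // _.
have -> : Hz (cech (x :: xs)) N 0 (caug (cech (x :: xs)) N n) <->
    Hz (cech xs) N 0 (caug (cech xs) N n) /\ loc_inc x N n = 0.
  split=> [E|[H1 H2]].
    have H1 := congr1 fst E; have H2 := congr1 snd E.
    split=> //; apply: (@caug_inj _ (cech xs)); rewrite -caug_map.
    by move: H2; rewrite /= subr0.
  by congr pair; [exact: H1|rewrite /= subr0 caug_map H2 linear0].
rewrite IH loc_inc_eq0; split=> [[H1 H2] y|H].
  by rewrite inE => /predU1P[->|/H1].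
by split=> [y ys|]; apply: H; rewrite inE ?ys ?eqxx ?orbT.
Qed.

(** For the head [y], the complex is the cone of a map that is bijective up to powers of [y]. For
    [x] in the tail, both outer terms of the exact sequence of the cone are [x]-power torsion by
    induction, and the two exponents add up. *)
Lemma cech_torsion xs N i z : Hz (cech xs) N i z ->
  forall x, x \in xs -> exists k, Hb (cech xs) N i (x ^+ k *: z).
Proof.
elim: xs N i z => [//|y xs IH] N i; elim/cech_cons_ind=> a b zZ x.
case: i a b zZ => [|i] a b zZ.
  have [n nE] := caug_surj ((a, b) : cech (y :: xs) N 0%N).
  move: zZ; rewrite -nE => /cech_Hz0 H /H[k Hk]; exists k.
  by apply/Hb0; rewrite -linZ Hk linear0.
have da : cd (cech xs) N i.+1 a = 0 := congr1 fst zZ.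
have /eqP := congr1 snd zZ; rewrite /= subr_eq0 => /eqP dab.
rewrite inE => /predU1P[->|xxs].
  have [s _] := cech_loclike xs i (loc_inc_loclike y N).
  have [_ inj] := cech_loclike xs i.+1 (loc_inc_loclike y N).
  have [k [b0 kb]] := s b.
  have [|l Hl] := inj (y ^+ k *: a - cd (cech xs) N i b0).
    rewrite linearB (linZ (cmap _ _ _)) dab cmap_d -kb (linZ (cd _ _ _)).
    by rewrite subrr.
  exists (l + k)%N, (y ^+ l *: b0, 0); congr pair => /=.
    move: Hl; rewrite scalerBr => /eqP; rewrite subr_eq0 => /eqP.
    by rewrite scalerA -exprD linZ.
  by rewrite linear0 subr0 linZ -kb scalerA -exprD.
have [k [a' ka]] := IH _ _ a da x xxs.
pose b' := x ^+ k *: b - cmap (cech xs) (loc_inc y N) i a'.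
have b'Z : Hz (cech xs) _ i b'.
  by rewrite /= linearB linZ -dab -cmap_d -ka linZ subrr.
have [l b'B] := IH _ _ b' b'Z x xxs.
clear zZ; rewrite {}/b' in b'Z b'B.
case: i a b da dab a' ka b'Z b'B => [|i] a b da dab a' ka b'Z.
  move=> /Hb0 b'0; exists (l + k)%N, (x ^+ l *: a', 0); congr pair => /=.
    by rewrite exprD -scalerA ka linZ.
  rewrite subr0 linZ exprD -scalerA; apply/eqP; rewrite -subr_eq0 -scalerBr.
  exact/eqP.
move=> [b'' b''E]; exists (l + k)%N, (x ^+ l *: a', - b''); congr pair => /=.
  by rewrite exprD -scalerA ka linZ.
rewrite (linearN (cd _ _ _)) opprK linZ -b''E exprD -scalerA -scalerDr.
by rewrite addrC subrK.
Qed.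

Lemma cech_smul xs N a i z : cmap (cech xs) (smul N a) i z = a *: z.
Proof.
suff H (f : {linear N -> N}) : (forall n, f n = a *: n) ->
    forall z, cmap (cech xs) f i z = a *: z by apply: H.
elim: xs N i f {z} => [|x xs IH] N i f fE z.
  by case: i z => [|i] z //=; apply: esym; apply: zero_modE.
elim/cech_cons_ind: z => z1 z2; congr pair; rewrite /= ?IH //.
case: i z1 z2 => [|i] z1 z2 /=; first exact/esym/zero_modE.
rewrite IH // => u; have [k [n kn]] := loc_num u; apply: (@loc_cancel _ x _ k).
by rewrite (loc_mapE _ kn) fE linZ -kn !scalerA mulrC.
Qed.

Definition tors_sm (x : R) N : submod N.
Proof.
exists (fun n => exists k, x ^+ k *: n = 0); first by exists 0%N; rewrite scaler0.
move=> a u v [k ku] [l lv]; exists (k + l)%N; rewrite scalerDr scalerA.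
have -> : x ^+ (k + l) * a = (a * x ^+ l) * x ^+ k by rewrite exprD; ring.
by rewrite -scalerA ku scaler0 add0r exprD -scalerA lv scaler0.
Defined.

(* Both N -> N_x is onto and the x-torsion of N is again flasque; then
   0 -> Gamma_x N -> N -> N_x -> 0 computes the Cech complex of N by that of Gamma_x N. *)
Fixpoint flasque xs N : Prop :=
  if xs is x :: xs' then
    (forall (n : N) k, exists (n' : N) c, x ^+ (c + k) *: n' = x ^+ c *: n) /\
    flasque xs' (subm (tors_sm x N))
  else True.

Lemma flasque_acyclic xs N i : flasque xs N -> acyclic_at (cech xs) N i.+1.
Proof.
elim: xs N i => [|x xs IH] N i; first by move=> _ z _; exists 0; apply: zero_modE.
move=> [div flT]; elim/cech_cons_ind=> a b zZ.
have da : cd (cech xs) N i.+1 a = 0 := congr1 fst zZ.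
have /eqP := congr1 snd zZ; rewrite /= subr_eq0 => /eqP dab.
have ses : short_exact (inj_subm (tors_sm x N)) (loc_inc x N).
  split=> [|u|n]; first exact: inj_subm_inj.
    have [k [n kn]] := loc_num u; have [n' [c cn]] := div n k.
    exists n'; apply: (@loc_cancel _ x _ (c + k)).
    by rewrite -(linZ (loc_inc x N)) cn (linZ (loc_inc x N)) -kn scalerA exprD.
  rewrite loc_inc_eq0; split=> [H|[t ->]]; last exact: (inj_submP t).
  by have [t tE] := inj_subm_ex (H : tors_sm x N n); exists t.
have [_ gs _] := cmap_exact (cech xs) i ses.
have [_ _ ex] := cmap_exact (cech xs) i.+1 ses.
have [inj2 _ _] := cmap_exact (cech xs) i.+2 ses.
have [b' b'E] := gs b.
have /ex[t tE] : cmap (cech xs) (loc_inc x N) i.+1 (a - cd (cech xs) N i b') = 0.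
  by rewrite linearB cmap_d b'E dab subrr.
have [|t' t'E] := IH _ i flT t.
  by apply: inj2; rewrite linear0 cmap_d -tE linearB da cdd subrr.
exists (b' + cmap (cech xs) (inj_subm (tors_sm x N)) i t', 0); congr pair => /=.
  by rewrite linearD -cmap_d -t'E -tE addrC subrK.
rewrite linear0 subr0 linearD b'E.
have [_ _ ex'] := cmap_exact (cech xs) i ses.
suff -> : cmap (cech xs) (loc_inc x N) i
  (cmap (cech xs) (inj_subm (tors_sm x N)) i t') = 0 by rewrite addr0.
by apply/ex'; exists t'.
Qed.

Lemma torsion_flasque xs N :
  (forall x, x \in xs -> forall n : N, exists k, x ^+ k *: n = 0) -> flasque xs N.
Proof.
elim: xs N => [//|x xs IH] N H; split.
  move=> n k; exists 0; have [c cn] := H x (mem_head _ _) n.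
  by exists c; rewrite cn scaler0.
apply: IH => y yxs u; have [|k ku] := H y _ (inj_subm _ u).
  by rewrite inE yxs orbT.
by exists k; apply: (@inj_subm_inj _ _ (tors_sm x N)); rewrite linZ ku linear0.
Qed.
End Cech.

(** * Cech cohomology and injective resolutions *)

Section Torsion.
Variables (R : comNzRingType) (N : lmodType R).

(** All products of [t] elements of [xs] kill [n]; peeling off one factor at a time follows the
    recursion of [ideal_exp]. *)
Fixpoint words_kill (xs : seq R) (t : nat) (n : N) : Prop :=
  if t is t'.+1 then forall x, x \in xs -> words_kill xs t' (x *: n) else n = 0.

Lemma words_kill0 xs t : words_kill xs t 0.
Proof. by elim: t => [//|t IH] x _; rewrite scaler0. Qed.

Lemma words_killZD xs t a (u v : N) :
  words_kill xs t u -> words_kill xs t v -> words_kill xs t (a *: u + v).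
Proof.
elim: t u v => [u v -> ->|t IH u v uK vK x xxs]; first by rewrite scaler0 addr0.
by rewrite scalerDr scalerA mulrC -scalerA; apply: IH; [apply: uK|apply: vK].
Qed.

Lemma words_killZ xs t a (u : N) : words_kill xs t u -> words_kill xs t (a *: u).
Proof. by move=> uK; rewrite -[_ *: u]addr0; apply: words_killZD (words_kill0 _ _). Qed.

(** A pigeonhole: a word of length [k + t] contains [k] letters [x] or [t] letters from [xs]. *)
Lemma words_kill_cons x xs k t n : x ^+ k *: n = 0 -> words_kill xs t n ->
  words_kill (x :: xs) (k + t) n.
Proof.
move: {2}(k + t)%N (erefl (k + t)%N) => s; elim: s k t n => [|s IH] k t n.
  by case: k t => [|k] [|t] //= _; rewrite scale1r.
move=> ks kn tn; rewrite ks => y; change (y \in x :: xs -> words_kill (x :: xs) s (y *: n)).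
case: k ks kn => [|k] ks kn.
  by move: kn; rewrite scale1r => -> _; rewrite scaler0; apply: words_kill0.
rewrite inE => /predU1P[->|yxs].
  have -> : s = (k + t)%N by move: ks; rewrite addSn => -[].
  apply: IH; first by move: ks; rewrite addSn => -[].
    by rewrite scalerA -exprSr.
  exact: words_killZ.
case: t ks tn => [|t] ks.
  by move=> /= ->; rewrite scaler0; apply: words_kill0.
have -> : s = (k.+1 + t)%N by move: ks; rewrite addnS => -[].
move=> tn; apply: IH; first by move: ks; rewrite addnS => -[].
  by rewrite scalerA mulrC -scalerA kn scaler0.
exact: tn.
Qed.

Lemma words_kill_ex xs n : (forall x, x \in xs -> exists k, x ^+ k *: n = 0) ->
  exists t, words_kill xs t n.
Proof.
elim: xs => [|x xs IH] H; first by exists 1%N.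
have [|t tn] := IH; first by move=> y yxs; apply: H; rewrite inE yxs orbT.
have [k kn] := H x (mem_head _ _).
by exists (k + t)%N; apply: words_kill_cons.
Qed.

Lemma mem_torsion (m : {pred R}) (xs : seq R) (n : N) : (forall a : R, a \in m <-> in_span (xs : seq R^o) a) ->
  n \in @torsion R m N <-> forall x, x \in xs -> exists k, x ^+ k *: n = 0.
Proof.
move=> mE; split.
  move=> /asboolP[t tn] x /(@mem_span R R^o xs) xs_x; exists t; apply: tn.
  elim: t => [//|t IH]; rewrite exprS; apply/asboolP.
  exists 1%N, (fun=> x), (fun=> x ^+ t); rewrite big_ord1; split=> // _.
  by split=> //; apply/mE.
move=> /words_kill_ex[t tn]; apply/asboolP; exists t.
elim: t n tn => [|t IH] n; first by move=> -> a _; rewrite scaler0.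
move=> tn a /asboolP[k [b [c [bc ->]]]]; rewrite scaler_suml big1 // => i _.
have [/mE bi ci] := bc i; rewrite mulrC -scalerA; apply: IH => //.
have K0 : words_kill xs t ((0 : R^o) *: n) by rewrite scale0r; apply: words_kill0.
have KZ (r u v : R^o) : words_kill xs t (u *: n) -> words_kill xs t (v *: n) ->
    words_kill xs t ((r *: u + v) *: n).
  by move=> ? ?; rewrite scalerDl -scalerA; apply: words_killZD.
exact: (@span_sub R R^o xs (@Submod _ R^o (fun r => words_kill xs t (r *: n)) K0 KZ) tn).
Qed.
End Torsion.

(** * Dimension shifting along acyclic resolutions *)

Section DimensionShift.
Variables (R : comNzRingType) (F : cfunctor R).

Definition kills (r : R) (N : lmodType R) i := forall z, Hz F N i z -> Hb F N i (r *: z).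

Section Shift.
Variables (A B C : lmodType R) (f : {linear A -> B}) (g : {linear B -> C}).
Hypothesis fg : short_exact f g.

(** Here [H^1(A)] is the cokernel of [H^0(B) -> H^0(C)]. Acyclicity of [B] in positive degrees says
    nothing about [H^0(B)], whence a form different from that of [kills_shift]. *)
Lemma kills_shift1 r : acyclic_at F B 1 ->
  kills r A 1 <-> forall c, Hz F C 0 c -> exists2 b, Hz F B 0 b & r *: c = cmap F g 0%N b.
Proof.
move=> acB; split=> [rA c cZ|rC a aZ].
  have [a ca] := delta_ex fg cZ; have aZ := delta_Hz fg ca.
  have [b bZ gb] := delta_ker fg (delta_Z r ca) (rA a aZ).
  by exists b.
have [c cZ ca] := les_A fg aZ (acB _ (map_Hz f aZ)).
have [b bZ rc] := rC c cZ; apply: (delta_map fg bZ).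
by rewrite -rc; apply: delta_Z.
Qed.

Lemma kills_shift r j : acyclic_at F B j.+1 -> acyclic_at F B j.+2 ->
  kills r A j.+2 <-> kills r C j.+1.
Proof.
move=> acB acB'; split=> [rA c cZ|rC a aZ].
  have [a ca] := delta_ex fg cZ; have aZ := delta_Hz fg ca.
  have [b bZ <-] := delta_ker fg (delta_Z r ca) (rA a aZ).
  exact/map_Hb/acB.
have [c cZ ca] := les_A fg aZ (acB' _ (map_Hz f aZ)).
exact: (delta_Hb fg (delta_Z r ca)) (rC c cZ).
Qed.
End Shift.

Definition sections (N : lmodType R) (n : N) : Prop := Hz F N 0 (caug F N n).

Lemma sections_map (A B : lmodType R) (f : {linear A -> B}) n :
  sections n -> sections (f n).
Proof. by rewrite /sections -caug_map; apply: map_Hz. Qed.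

Lemma sections_inj (A B : lmodType R) (f : {linear A -> B}) n : injective f ->
  sections (f n) -> sections n.
Proof.
move=> fi; rewrite /sections -caug_map /= -cmap_d => H.
have [i1 _ _] := cmap_exact F 1 (short_exact_coker fi).
by apply: i1; rewrite H linear0.
Qed.

Definition cplx_kills (C : nat -> lmodType R) (d : forall i, {linear C i -> C i.+1})
    (r : R) (i : nat) : Prop :=
  match i return Prop with
  | 0 => forall x, sections x -> d 0%N x = 0 -> r *: x = 0
  | j.+1 => forall x, sections x -> d j.+1 x = 0 -> exists2 y, sections y & r *: x = d j y
  end.

Lemma resolution_cut (N : lmodType R) (C : nat -> lmodType R)
    (aug : {linear N -> C 0%N}) (d : forall i, {linear C i -> C i.+1}) :
  injective aug ->
  (forall x, d 0%N x = 0 <-> exists y, x = aug y) ->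
  (forall i x, d i.+1 x = 0 <-> exists y, x = d i y) ->
  exists2 p : {linear C 0%N -> subm (ker_sm (d 1%N))},
    forall x, inj_subm (ker_sm (d 1%N)) (p x) = d 0%N x & short_exact aug p.
Proof.
move=> augi ex0 exS; set K := ker_sm _.
have dK x : K (d 0%N x) by apply/exS; exists x.
pose p0 x : subm K := projT1 (cid (inj_subm_ex (dK x))).
have p0E x : inj_subm K (p0 x) = d 0%N x.
  exact: (projT2 (cid (inj_subm_ex (dK x)))).
have p0L : linear p0.
  by move=> a u v; apply: (@inj_subm_inj _ _ K); rewrite linP /= !p0E linP.
exists (mklin p0L) => //; split=> // [c|b].
  have /exS[x xE] := inj_submP c; exists x; apply: (@inj_subm_inj _ _ K).
  by rewrite mklinE p0E xE.
rewrite -ex0 -p0E mklinE; split=> [->|H]; first by rewrite linear0.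
by apply: (@inj_subm_inj _ _ K); rewrite linear0.
Qed.

(** The terms are asked to be acyclic, not injective: the lemma is also applied to injective modules
    over the idealization, which need not stay injective when regarded over [R]. *)
Lemma resolution_kills (N : lmodType R) (C : nat -> lmodType R)
    (aug : {linear N -> C 0%N}) (d : forall i, {linear C i -> C i.+1}) r i :
  injective aug ->
  (forall x, d 0%N x = 0 <-> exists y, x = aug y) ->
  (forall i x, d i.+1 x = 0 <-> exists y, x = d i y) ->
  (forall i j, acyclic_at F (C i) j.+1) ->
  kills r N i <-> cplx_kills d r i.
Proof.
case: i => [|i] augi ex0 exS ac.
  split=> [rN x xS /ex0[n xE]|rC z].
    have nS : sections n by apply: (sections_inj augi); rewrite -xE.
    have := rN _ nS; rewrite -linZ => /Hb0/caug_inj H.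
    by rewrite xE -linZ H linear0.
  have [n <-] := caug_surj z => nS; apply/Hb0; rewrite -linZ.
  suff -> : r *: n = 0 by rewrite linear0.
  apply: augi; rewrite linear0 linZ; apply: rC; first exact: sections_map.
  by apply/ex0; exists n.
elim: i N C aug d augi ex0 exS ac => [|i IH] N C aug d augi ex0 exS ac.
all: have [p pE ses] := resolution_cut augi ex0 exS; pose K := ker_sm (d 1%N).
- rewrite (kills_shift1 ses r (ac 0%N 0%N)); split=> [H x xS dx|H z].
    have [u uE] := inj_subm_ex (dx : K x).
    have [|b] := H (caug F _ u).
      by apply: (sections_inj (@inj_subm_inj _ _ K)); rewrite /= uE.
    have [y <-] := caug_surj b => yS; rewrite caug_map -linZ => E; exists y => //.
    have {}E : r *: u = p y.
      by apply/eqP; rewrite -subr_eq0; apply/eqP/(@caug_inj _ F); rewrite linearB E subrr.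
    by rewrite -pE -E linZ /= uE.
  have [u <-] := caug_surj z => uS.
  have [||y yS E] := H (inj_subm K u); [exact: sections_map|exact: (inj_submP u)|].
  exists (caug F _ y); rewrite ?caug_map // -linZ; congr (caug F _ _).
  by apply: (@inj_subm_inj _ _ K); rewrite pE linZ.
- rewrite (kills_shift ses r (ac 0%N i) (ac 0%N i.+1)).
  rewrite (IH (subm K) (fun j => C j.+1) (inj_subm K) (fun j => d j.+1)) //.
  move=> x; split=> [dx|[u ->]]; last exact: (inj_submP u).
  by have [u uE] := inj_subm_ex (dx : K x); exists u.
Qed.
End DimensionShift.

Lemma cech_sections (R : comNzRingType) (m : {pred R}) (xs : seq R) (N : lmodType R) (n : N) :
  (forall a : R, a \in m <-> in_span (xs : seq R^o) a) ->
  sections (cech xs) n <-> n \in @torsion R m N.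
Proof. by move=> mE; rewrite (mem_torsion _ mE) /sections cech_Hz0. Qed.

(** * Injective modules over a Noetherian ring are flasque *)

Section InjectiveFlasque.
Variables (T : comNzRingType) (E : lmodType T).
Hypotheses (nT : noetherian T) (injE : injective_module E).

Lemma injective_div (e : E) (x : T) (k : nat) : exists (e' : E) c,
  (forall a : T, a *: e = 0 -> a *: e' = 0) /\ x ^+ (c + k) *: e' = x ^+ c *: e.
Proof.
pose J := ann_sm e.
have [|c cmax] := @noeth_acc _ _ (fun n => colon_sm J (x ^+ n)) (noetherian_mod nT).
  by move=> i r /colon_smE Jr; apply/colon_smE; rewrite exprS mulrCA; apply: smZ.
(* r |-> x^(c+k) r embeds R/(J : x^(c+k)) into R/J, and r |-> x^c r e is defined on the former
   because (J : x^n) is constant for n >= c; extend it to R/J and take the image of 1. *)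
pose L := colon_sm J (x ^+ (c + k)).
have LJ r : L r -> complin (proj_quot J) (smul T^o (x ^+ (c + k))) r = 0.
  by move=> /colon_smE Lr; apply/proj_quot_eq0; change (J (x ^+ (c + k) * r)); rewrite mulrC.
have Le r : L r -> complin (rmul e) (smul T^o (x ^+ c)) r = 0.
  by move=> /cmax/colon_smE Jr; change ((x ^+ c * r) *: e = 0); rewrite mulrC.
have inj : injective (quot_lift LJ).
  move=> u v; have [r <-] := proj_quot_surj u; have [s <-] := proj_quot_surj v.
  rewrite !quot_liftE => /eqP; rewrite -subr_eq0 -linearB => /eqP/proj_quot_eq0 H.
  apply/eqP; rewrite -subr_eq0 -linearB; apply/eqP/proj_quot_eq0/colon_smE.
  by rewrite mulrC.
have [h hE] := injE (quot_lift Le) inj.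
exists (h (proj_quot J (1 : T^o))), c; split=> [a ae|].
  suff H : proj_quot J (a *: (1 : T^o)) = 0.
    by rewrite -(linZ h) -(linZ (proj_quot J)) /= H linear0.
  by apply/proj_quot_eq0; change ((a * 1) *: e = 0); rewrite mulr1.
have H : h (proj_quot J (x ^+ (c + k) * 1 : T^o)) = (x ^+ c * 1) *: e.
  by have := hE (proj_quot L (1 : T^o)); rewrite !quot_liftE.
by rewrite -(linZ h) -(linZ (proj_quot J)); move: H; rewrite [x ^+ c * 1]mulr1.
Qed.

(** Two generalizations are built in. The list [ys] records the elements for which torsion has
    already been taken, since [flasque] recurses into torsion submodules, which are not assumed
    injective. The map [phi] lets [E] be injective over [T] while [N] is a module over [R]. *)
Lemma injective_flasque (R : comNzRingType) (phi : R -> T) (xs ys : seq R)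
    (N : lmodType R) (iota : N -> E) :
  (forall x k, phi (x ^+ k) = phi x ^+ k) -> injective iota ->
  (forall r n, iota (r *: n) = phi r *: iota n) ->
  (forall e, (exists n, iota n = e) <-> forall y, y \in ys -> exists k, phi y ^+ k *: e = 0) ->
  flasque xs N.
Proof.
move=> phiX; elim: xs ys N iota => [//|x xs IH] ys N iota iinj iZ iP.
have iota0 : iota 0 = 0.
  have [n0 n0E] : exists n, iota n = 0 by apply/iP => y _; exists 0%N; rewrite scaler0.
  have phi_0 := iZ 0 n0; rewrite n0E scaler0 in phi_0.
  by rewrite -phi_0 scale0r.
split=> [n k|].
  have [e' [c [ann_e' Hc]]] := injective_div (iota n) (phi x) k.
  (* As [e'] is killed by whatever kills [iota n], it stays in the torsion submodule that [N]
     represents. *)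
  have [n' n'E] : exists n', iota n' = e'.
    apply/iP => y yys; have [l ln] := (iP (iota n)).1 (ex_intro _ n erefl) y yys.
    by exists l; apply: ann_e'.
  by exists n', c; apply: iinj; rewrite !iZ !phiX n'E.
apply: (IH (x :: ys) _ (fun u => iota (inj_subm (tors_sm x N) u))).
- by move=> u v /iinj/inj_subm_inj.
- by move=> r u; rewrite linZ iZ.
- move=> e; split=> [[u <-] y|H].
    rewrite inE => /predU1P[->|yys].
      by have [k ku] := inj_submP u; exists k; rewrite -phiX -iZ ku.
    by apply: (iP _).1 yys; exists (inj_subm _ u).
  have [n nE] : exists n, iota n = e.
    by apply/iP => y yys; apply: H; rewrite inE yys orbT.
  have [k ke] := H x (mem_head _ _).
  have /inj_subm_ex[u uE] : tors_sm x N n.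
    by exists k; apply: iinj; rewrite iZ phiX nE ke iota0.
  by exists u; rewrite uE.
Qed.
End InjectiveFlasque.

Lemma lc_kills (R : comNzRingType) (m : {pred R}) (xs : seq R) (N : lmodType R) r i :
  noetherian R -> (forall a : R, a \in m <-> in_span (xs : seq R^o) a) ->
  forall E : injective_resolution N,
  (forall x : E i, lc_cocycle m x -> lc_coboundary m (r *: x)) <-> kills (cech xs) r N i.
Proof.
move=> nR mE E.
have secE := fun (A : lmodType R) (n : A) => @cech_sections R m xs A n mE.
rewrite (resolution_kills (F := cech xs) r i (@res_aug_inj _ _ E) (@res_exact0 _ _ E)
  (@res_exactS _ _ E)); last first.
  move=> k j; apply: flasque_acyclic.
  refine (@injective_flasque R (E k) nR (@res_inj _ _ E k) R id xs [::] (E k) id _ _ _ _) => //.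
  by move=> e; split=> // _; exists e.
case: i => [|i] /=; split=> H x.
- by move=> /secE xT dx; apply: H.
- by move=> [/secE xT dx]; apply: H.
- by move=> /secE xT dx; have [|y /secE] := H x; [split|exists y].
- by move=> [/secE xT dx]; have [y /secE] := H x xT dx; exists y.
Qed.

(** * Existence of injective resolutions *)

(** The nonzero algebraic numbers, their multiplication later written additively. Roots make this
    group divisible and roots of unity give it torsion of every order, so that it can serve in the
    role of [Q/Z]. *)
Definition cstar := {z : algC | z != 0}.
HB.instance Definition _ := [isSub of cstar for @sval _ _].
HB.instance Definition _ := [Choice of cstar by <:].

Definition mk_cstar (z : algC) (z0 : z != 0) : cstar := exist _ z z0.

Definition cstar_one : cstar := exist _ 1 (oner_neq0 _).
Definition cstar_mul (u v : cstar) : cstar := exist _ (sval u * sval v) (mulf_neq0 (svalP u) (svalP v)).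
Definition cstar_inv (u : cstar) : cstar := exist _ (sval u)^-1 (invr_neq0 (svalP u)).

Fact cstar_mulA : associative cstar_mul.
Proof. by move=> u v w; apply: val_inj; apply: mulrA. Qed.
Fact cstar_mulC : commutative cstar_mul.
Proof. by move=> u v; apply: val_inj; apply: mulrC. Qed.
Fact cstar_mul1 : left_id cstar_one cstar_mul.
Proof. by move=> u; apply: val_inj; apply: mul1r. Qed.
Fact cstar_mulV : left_inverse cstar_one cstar_inv cstar_mul.
Proof. by move=> u; apply: val_inj; apply: mulVf; apply: (svalP u). Qed.
HB.instance Definition _ := GRing.isZmodule.Build cstar
  cstar_mulA cstar_mulC cstar_mul1 cstar_mulV.

Lemma cstar_muln (u : cstar) n : sval (u *+ n) = sval u ^+ n.
Proof. by elim: n => [//|n IH]; rewrite mulrS exprS -IH. Qed.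

Lemma cstar_div (u : cstar) n : (0 < n)%N -> exists v, v *+ n = u.
Proof.
move=> n0; have vn0 : n.-root (sval u) != 0 by rewrite rootC_eq0 // (svalP u).
by exists (mk_cstar vn0); apply: val_inj; rewrite [LHS]cstar_muln /= rootCK.
Qed.

Lemma cstar_torsion n : (1 < n)%N -> exists2 v : cstar, v != 0 & v *+ n = 0.
Proof.
move=> n1; have [z zP] := C_prim_root_exists (ltnW n1).
have z0 : z != 0.
  apply/eqP => z0; have /eqP := prim_expr_order zP.
  by rewrite z0 expr0n (gtn_eqF (ltnW n1)) eq_sym oner_eq0.
exists (mk_cstar z0).
  apply/eqP => /(congr1 val) /= z1.
  by have := prim_order_dvd zP 1; rewrite expr1 z1 eqxx dvdn1 gtn_eqF.
by apply: val_inj; rewrite [LHS]cstar_muln /= prim_expr_order.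
Qed.

Section CharacterExtension.
Variable B : zmodType.
Implicit Types G : B -> cstar -> Prop.

(** The graph of a character defined on a subgroup of [B]: as a relation it carries its domain with
    it, and unions of chains are immediate. *)
Definition partial_char G := [/\ G 0 0,
  forall x y d e, G x d -> G y e -> G (x - y) (d - e) & forall d, G 0 d -> d = 0].

Lemma partial_charN G x d : partial_char G -> G x d -> G (- x) (- d).
Proof. by move=> [G0 GB _] Gx; rewrite -[- x]sub0r -[- d]sub0r; apply: GB. Qed.
Lemma partial_charD G x y d e : partial_char G -> G x d -> G y e -> G (x + y) (d + e).
Proof.
by move=> pG Gx Gy; rewrite -[y]opprK -[e]opprK; case: (pG) => _ + _; apply=> //; apply: partial_charN.
Qed.
Lemma partial_charM G x d (k : int) : partial_char G -> G x d -> G (x *~ k) (d *~ k).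
Proof.
move=> pG Gx; have H n : G (x *+ n) (d *+ n).
  elim: n => [|n IH]; first by case: pG.
  by rewrite !mulrS; apply: partial_charD.
by case: k => n; rewrite ?NegzE ?mulrNz; [|apply: partial_charN => //]; exact: H.
Qed.
Lemma partial_char_fun G x d e : partial_char G -> G x d -> G x e -> d = e.
Proof.
move=> [_ GB G1] Gd Ge; apply/eqP; rewrite -subr_eq0; apply/eqP/G1.
by rewrite -(subrr x); apply: GB.
Qed.

(** The multiples of [b] in the domain form a cyclic group. If it is generated by [n b] with
    [n > 0], the new value must be an [n]-th part of the value there, and divisibility provides one;
    if it is trivial, the value 0 will do. *)
Lemma partial_char_step G b : partial_char G -> exists G', [/\ partial_char G', forall x d, G x d -> G' x d &
  exists e, G' b e].
Proof.
move=> pG.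
have [e eP] : exists e, forall (k : int) d, G (b *~ k) d -> d = e *~ k.
  have dom_abs (k : int) d : G (b *~ k) d -> exists d', G (b *+ `|k|%N) d'.
    case: k => n; first by exists d.
    by rewrite NegzE mulrNz => /(partial_charN pG); rewrite opprK; exists (- d).
  have [Hex|Hno] := pselect (exists n, (0 < n)%N && `[< exists d, G (b *+ n) d >]).
    have [n /andP[n0 /asboolP[d0 Gd0]] nmin] := ex_minnP Hex.
    have [e ed] := cstar_div d0 n0; exists e => k d Gd.
    have Gq : G (b *~ ((k %/ n%:Z)%Z * n%:Z)) (e *~ ((k %/ n%:Z)%Z * n%:Z)).
      by rewrite mulrC !mulrzA -!pmulrn ed; apply: partial_charM.
    have nz : n%:Z != 0 by rewrite eqz_nat -lt0n.
    have := divz_eq k n%:Z; set q := (_ * _) in Gq * => kE.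
    have r0 : (k %% n%:Z)%Z = 0.
      have Gr : G (b *~ (k %% n%:Z)%Z) (d - e *~ q).
        have -> : (k %% n%:Z)%Z = k - q by rewrite {2}kE addrC addKr.
        by rewrite mulrzBr; case: pG => _ + _; apply.
      have [d' Gd'] := dom_abs _ _ Gr.
      apply/eqP; rewrite -absz_eq0 -leqn0 leqNgt; apply/negP => r0.
      have /nmin : (0 < `|(k %% n%:Z)%Z|)%N && `[< exists d, G (b *+ `|(k %% n%:Z)%Z|%N) d >].
        by rewrite r0; apply/asboolP; exists d'.
      have := ltz_mod k nz; have := modz_ge0 k nz.
      by case: (k %% n%:Z)%Z => // r _; rewrite !absz_nat ltz_nat => rn nr; have := leq_trans rn nr; rewrite ltnn.
    by move: kE; rewrite r0 addr0 => kq; rewrite kq; apply: (partial_char_fun pG _ Gq); rewrite -kq.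
  exists 0 => k d Gd; rewrite mul0rz; have [d' Gd'] := dom_abs _ _ Gd.
  case: (posnP `|k|%N) => [/eqP|k0]; last first.
    by case: Hno; exists `|k|%N; rewrite k0; apply/asboolP; exists d'.
  by rewrite absz_eq0 => /eqP k0; move: Gd; rewrite k0 mulr0z; case: pG => _ _; apply.
exists (fun y f => exists x d k, [/\ G x d, y = x + b *~ k & f = d + e *~ k]).
have G0 : G 0 0 by case: pG.
split; [split|by move=> x d Gx; exists x, d, 0; rewrite !mulr0z !addr0|].
- by exists 0, 0, 0; rewrite !mulr0z !addr0.
- move=> _ _ _ _ [x [d [k [Gx -> ->]]]] [x' [d' [k' [Gx' -> ->]]]].
  exists (x - x'), (d - d'), (k - k'); rewrite !mulrzBr !opprD !addrA.
  split; [by case: pG => _ + _; apply|by rewrite [_ - x']addrAC|by rewrite [_ - d']addrAC].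
- move=> f [x [d [k [Gx /esym/eqP]]]]; rewrite addr_eq0 -mulrNz => /eqP xE ->.
  by move: Gx; rewrite xE => /eP ->; rewrite mulrNz addNr.
by exists e, 0, 0, 1; rewrite !add0r.
Qed.

Lemma partial_char_extend G0 : partial_char G0 -> exists psi : B -> cstar,
  (forall x y, psi (x - y) = psi x - psi y) /\ forall x d, G0 x d -> psi x = d.
Proof.
move=> pG0.
(* Adjoining [G0] to every candidate makes the union of the empty chain admissible in Zorn's
   lemma. *)
pose U (A : set (B * cstar)) x d := G0 x d \/ A (x, d).
have [A [pA Amax]] : exists A, partial_char (U A) /\ forall A', (A `<` A')%classic -> ~ partial_char (U A').
  apply: (@Zorn_bigcup _ (fun A => partial_char (U A))) => F FP tot.
  have two x d y e : U (\bigcup_(X in F) X)%classic x d -> U (\bigcup_(X in F) X)%classic y e ->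
      (G0 x d /\ G0 y e) \/ exists X, [/\ F X, U X x d & U X y e].
    move=> [Gx|[X FX Xx]] [Gy|[Y FY Yy]]; first by left.
    - by right; exists Y; split=> //; [left|right].
    - by right; exists X; split=> //; [right|left].
    - right; have [XY|YX] := tot X Y FX FY.
        by exists Y; split=> //; right=> //; apply: XY.
      by exists X; split=> //; right=> //; apply: YX.
  have sub X x d : F X -> U X x d -> U (\bigcup_(X in F) X)%classic x d.
    by move=> FX [Gx|Xx]; [left|right; exists X].
  split; first by left; case: pG0.
  - move=> x y d e Ux Uy; have [[Gx Gy]|[X [FX Xx Xy]]] := two _ _ _ _ Ux Uy.
      by left; case: pG0 => _ + _; apply.
    by apply: (sub X) => //; case: (FP X FX) => _ + _; apply.
  - move=> d Ud; have [[Gx _]|[X [FX Xx _]]] := two _ _ _ _ Ud Ud.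
      by case: pG0 => _ _; apply.
    by case: (FP X FX) => _ _; apply.
have tot b : exists d, U A b d.
  apply: contrapT => nb; have [G' [pG' sub [e G'e]]] := partial_char_step b pA.
  pose A' : set (B * cstar) := [set p | G' p.1 p.2]%classic.
  have UE : U A' = G'.
    apply: funext => x; apply: funext => d; apply: propext; split=> [[Gx|]|] //; last by right.
    by apply: sub; left.
  apply: (Amax A'); last by rewrite UE.
  split; first by move=> [x d] Ax; apply: sub; right.
  by move=> /(_ (b, e) G'e) Ab; apply: nb; exists e; right.
exists (fun b => projT1 (cid (tot b))); have psiP b := projT2 (cid (tot b)).
split=> [x y|x d Gx]; apply: (partial_char_fun pA (psiP _)); last by left.
by case: (pA) => _ + _; apply; apply: psiP.
Qed.

(** On the cyclic group of [b], a nonzero value of order dividing that of [b] defines a character;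
    for [b] of infinite order any nonzero value does, here one of order 2. *)
Lemma partial_char_sep (b : B) : b != 0 -> exists psi : B -> cstar,
  (forall x y, psi (x - y) = psi x - psi y) /\ psi b != 0.
Proof.
move=> b0.
have [q q0 qP] : exists2 q : cstar, q != 0 & forall k : int, b *~ k = 0 -> q *~ k = 0.
  have abs0 (V : zmodType) (v : V) (k : int) : v *~ k = 0 <-> v *+ `|k|%N = 0.
    case: k => n //; rewrite NegzE mulrNz; split=> [/eqP|H]; first by rewrite oppr_eq0 => /eqP.
    by rewrite [_ *~ _]H oppr0.
  have [Hex|Hno] := pselect (exists n, (0 < n)%N && (b *+ n == 0)).
    have [n /andP[n0 /eqP bn] nmin] := ex_minnP Hex.
    have n1 : (1 < n)%N.
      by case: n n0 bn {nmin} => [|[|n]] // _; rewrite mulr1n => bz; rewrite bz eqxx in b0.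
    have [q q0 qn] := cstar_torsion n1; exists q => // k /abs0 bk; apply/abs0.
    suff /dvdnP[c ->] : (n %| `|k|)%N by rewrite mulnC mulrnA qn mul0rn.
    rewrite /dvdn; apply/negPn/negP; rewrite -lt0n => r0.
    have /nmin : (0 < `|k| %% n)%N && (b *+ (`|k| %% n) == 0).
      rewrite r0 /=; move: bk; rewrite {1}(divn_eq `|k| n) mulrnDr mulnC mulrnA bn mul0rn add0r.
      by move/eqP.
    by rewrite leqNgt ltn_mod n0.
  have [q q0 _] := cstar_torsion (isT : (1 < 2)%N); exists q => // k /abs0 bk.
  case: (posnP `|k|%N) => [/eqP|k0].
    by rewrite absz_eq0 => /eqP ->; rewrite mulr0z.
  by case: Hno; exists `|k|%N; rewrite k0 bk eqxx.
have pG : partial_char (fun x d => exists k : int, x = b *~ k /\ d = q *~ k).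
  split; first by exists 0; rewrite !mulr0z.
  - by move=> _ _ _ _ [k [-> ->]] [l [-> ->]]; exists (k - l); rewrite !mulrzBr.
  - by move=> d [k [/esym/qP <- ->]].
have [psi [psiB psiE]] := partial_char_extend pG; exists psi; split=> //.
by rewrite (psiE b q) //; exists 1.
Qed.
End CharacterExtension.

(** * Coinduced modules *)

Section Coinduced.
Variables (T : comNzRingType) (X : Type).

(** Additivity in the second argument: [coind] is the [X]-fold power of the group of characters of
    [T], on which [T] acts through the argument. *)
Definition coind_pred : {pred X -> T -> cstar} :=
  fun h => `[< forall x s s', h x (s - s') = h x s - h x s' >].
Fact coind_zmod : zmod_closed coind_pred.
Proof.
split; first by apply/asboolP => x s s'; rewrite subr0.
move=> h h' /asboolP H /asboolP H'; apply/asboolP => x s s'.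
change (h x (s - s') - h' x (s - s') = (h x s - h' x s) - (h x s' - h' x s')).
by rewrite H H' !opprB addrACA [RHS]addrACA; congr (_ + _); rewrite addrC.
Qed.
HB.instance Definition _ := GRing.isZmodClosed.Build (X -> T -> cstar) coind_pred coind_zmod.

Definition coind := {h : X -> T -> cstar | coind_pred h}.
HB.instance Definition _ := [isSub of coind for @sval _ _].
HB.instance Definition _ := [Choice of coind by <:].
HB.instance Definition _ := [SubChoice_isSubZmodule of coind by <:].

Definition mk_coind (h : X -> T -> cstar) (hP : coind_pred h) : coind :=
  @exist _ (fun h => coind_pred h) h hP.

Lemma coindP (h : coind) x s s' : val h x (s - s') = val h x s - val h x s'.
Proof. by have /asboolP := valP h; apply. Qed.
Lemma coindD (h : coind) x s s' : val h x (s + s') = val h x s + val h x s'.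
Proof.
have h0 : val h x 0 = 0 by rewrite -(subrr 0) coindP subrr.
by rewrite -{1}[s']opprK -[- s']sub0r !coindP h0 sub0r opprK.
Qed.

Fact coind_scale_proof (t : T) (h : coind) : coind_pred (fun x s => val h x (t * s)).
Proof. by apply/asboolP => x s s'; rewrite mulrBr coindP. Qed.
Definition coind_scale t h : coind := mk_coind (coind_scale_proof t h).

Fact coind_scaleA a b h : coind_scale a (coind_scale b h) = coind_scale (a * b) h.
Proof.
apply: val_inj; apply: funext => x; apply: funext => s /=.
by rewrite mulrA [b * a]mulrC.
Qed.
Fact coind_scale1 : left_id 1 coind_scale.
Proof.
by move=> h; apply: val_inj; apply: funext => x; apply: funext => s /=; rewrite mul1r.
Qed.
Fact coind_scaleDr : right_distributive coind_scale +%R.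
Proof. by move=> a u v; apply: val_inj. Qed.
Fact coind_scaleDl h : {morph coind_scale^~ h : a b / a + b}.
Proof.
move=> a b; apply: val_inj; apply: funext => x; apply: funext => s /=.
by rewrite mulrDl coindD.
Qed.
HB.instance Definition _ := GRing.Zmodule_isLmodule.Build T coind
  coind_scaleA coind_scale1 coind_scaleDr coind_scaleDl.

(** By adjunction, a linear map from [B] to the characters of [T] is a character of the group [B],
    read off by evaluation at 1. For each [x] the character [a |-> g a x 1] extends along [f] to
    [psi x], and [h b x s = psi x (s b)]. *)
Lemma coind_injective : injective_module coind.
Proof.
move=> A B f g fi.
have ext x : exists psi : B -> cstar,
    (forall u v, psi (u - v) = psi u - psi v) /\ forall a, psi (f a) = val (g a) x 1.
  have [|psi [psiB psiE]] := @partial_char_extend B (fun b d => exists2 a, b = f a & d = val (g a) x 1).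
    split; first by exists 0; rewrite linear0.
      by move=> _ _ _ _ [a -> ->] [a' -> ->]; exists (a - a'); rewrite linearB.
    move=> d [a fa0 ->]; have -> : a = 0 by apply: fi; rewrite -fa0 linear0.
    by rewrite linear0.
  by exists psi; split=> // a; apply: psiE; exists a.
pose psi x := projT1 (cid (ext x)).
have psiB x u v : psi x (u - v) = psi x u - psi x v by have [+ _] := projT2 (cid (ext x)); apply.
have psiE x a : psi x (f a) = val (g a) x 1 by have [_ +] := projT2 (cid (ext x)); apply.
have psi0 x : psi x 0 = 0 by rewrite -(subrr 0) psiB subrr.
have psiD x u v : psi x (u + v) = psi x u + psi x v.
  by rewrite -{1}[v]opprK -[- v]sub0r !psiB psi0 sub0r opprK.
have hP b : coind_pred (fun x s => psi x (s *: b)).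
  by apply/asboolP => x s s'; rewrite scalerBl psiB.
pose h0 b : coind := mk_coind (hP b).
have hL : linear h0.
  move=> a u v; apply: val_inj; apply: funext => x; apply: funext => s.
  change (psi x (s *: (a *: u + v)) = psi x ((a * s) *: u) + psi x (s *: v)).
  by rewrite scalerDr psiD scalerA mulrC.
exists (mklin hL) => a; apply: val_inj; apply: funext => x; apply: funext => s.
change (psi x (s *: f a) = val (g a) x s).
by rewrite -linZ psiE linZ; change (val (g a) x (s * 1) = val (g a) x s); rewrite mulr1.
Qed.
End Coinduced.

Section Resolutions.
Variable T : comNzRingType.

(** The index set is [N] itself, with one character for each element, chosen not to vanish on it if
    that element is nonzero. *)
Lemma injective_embedding (N : lmodType T) :
  exists f : {linear N -> coind T N}, injective f.
Proof.
have sep (n : N) : exists psi : N -> cstar,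
    (forall u v, psi (u - v) = psi u - psi v) /\ (n != 0 -> psi n != 0).
  have [->|/partial_char_sep[psi [psiB psin]]] := eqVneq n 0; last by exists psi.
  by exists (fun=> 0); split=> // u v; rewrite subr0.
pose psi n := projT1 (cid (sep n)).
have psiB n u v : psi n (u - v) = psi n u - psi n v by have [+ _] := projT2 (cid (sep n)); apply.
have psin n : n != 0 -> psi n n != 0 by have [_ +] := projT2 (cid (sep n)); apply.
have psi0 x : psi x 0 = 0 by rewrite -(subrr 0) psiB subrr.
have psiD x u v : psi x (u + v) = psi x u + psi x v.
  by rewrite -{1}[v]opprK -[- v]sub0r !psiB psi0 sub0r opprK.
have hP b : coind_pred (fun x s => psi x (s *: b)).
  by apply/asboolP => x s s'; rewrite scalerBl psiB.
pose h0 b : coind T N := mk_coind (hP b).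
have hL : linear h0.
  move=> a u v; apply: val_inj; apply: funext => x; apply: funext => s.
  change (psi x (s *: (a *: u + v)) = psi x ((a * s) *: u) + psi x (s *: v)).
  by rewrite scalerDr psiD scalerA mulrC.
exists (mklin hL) => u v uv; apply/eqP; rewrite -subr_eq0; apply/eqP.
apply: contrapT => /eqP/psin; rewrite psiB.
have := congr1 (fun h : coind T N => val h (u - v) 1) uv.
rewrite -[val _ _ _]/(psi (u - v) (1 *: u)) -[RHS]/(psi (u - v) (1 *: v)) !scale1r => ->.
by rewrite subrr eqxx.
Qed.

Definition iemb (N : lmodType T) := projT1 (cid (injective_embedding N)).
Lemma iemb_inj (N : lmodType T) : injective (iemb N).
Proof. exact: (projT2 (cid (injective_embedding N))). Qed.

(* [cosyz N i] is the [i]-th cosyzygy of [N]: it embeds into the [i]-th term of the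
   resolution, and the cokernel of this embedding is the next cosyzygy. *)
Fixpoint cosyz (N : lmodType T) (i : nat) : lmodType T :=
  if i is j.+1 then quot (im_sm (iemb (cosyz N j))) else N.

Lemma injective_resolution_ex (N : lmodType T) : exists E : injective_resolution N, True.
Proof.
unshelve eexists; last by [].
refine (@InjectiveResolution T N (fun i => coind T (cosyz N i)) (iemb N)
  (fun i => complin (iemb (cosyz N i.+1)) (proj_quot (im_sm (iemb (cosyz N i))))) _ _ _ _).
- by move=> i; apply: coind_injective.
- exact: iemb_inj.
- move=> x; split=> [H|[y ->]].
    by apply/(proj_quot_eq0 (im_sm (iemb N)) x); apply: iemb_inj; rewrite linear0.
  have H : proj_quot (im_sm (iemb N)) (iemb N y) = 0 by apply/proj_quot_eq0; exists y.
  by change (iemb (cosyz N 1) (proj_quot (im_sm (iemb N)) (iemb N y)) = 0); rewrite H linear0.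
- move=> i x; split=> [H|[y ->]].
    have /proj_quot_eq0[u ->] : proj_quot (im_sm (iemb (cosyz N i.+1))) x = 0.
      by apply: iemb_inj; rewrite linear0.
    by have [y <-] := proj_quot_surj u; exists y.
  set u := proj_quot (im_sm (iemb (cosyz N i))) y.
  have H : proj_quot (im_sm (iemb (cosyz N i.+1))) (iemb (cosyz N i.+1) u) = 0.
    by apply/proj_quot_eq0; exists u.
  change (iemb (cosyz N i.+2)
    (proj_quot (im_sm (iemb (cosyz N i.+1))) (iemb (cosyz N i.+1) u)) = 0).
  by rewrite H linear0.
Qed.
End Resolutions.

(** * Artinian modules and dual Krull dimension *)

Section Subquotients.
Variable R : comNzRingType.
Implicit Types H : lmodType R.

Definition sm_sub H (A B : submod H) := forall x, A x -> B x.

Definition artin H (A B : submod H) := forall P : nat -> submod H,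
  (forall i, sm_sub (P i.+1) (P i)) -> (forall i, sm_sub B (P i) /\ sm_sub (P i) A) ->
  exists n, forall k, (n <= k)%N -> sm_sub (P n) (P k).

(* The dual Krull dimension of A/B, shifted by one: [ndim 0] means A/B = 0 and
   [ndim 1] means that A/B is Noetherian. *)
Fixpoint ndim (k : nat) H (A B : submod H) : Prop :=
  if k is k'.+1 then
    forall P : nat -> submod H,
    (forall i, sm_sub (P i) (P i.+1)) -> (forall i, sm_sub B (P i) /\ sm_sub (P i) A) ->
    exists n, forall i, (n <= i)%N -> ndim k' (P i.+1) (P i)
  else sm_sub A B.

Lemma dec_chain H (P : nat -> submod H) : (forall i, sm_sub (P i.+1) (P i)) ->
  forall i j, (i <= j)%N -> sm_sub (P j) (P i).
Proof.
move=> Pd i j /subnK <-; elim: (j - i)%N => [//|k IH x].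
by rewrite addSn => /Pd/IH.
Qed.

Lemma artin_zero H (A B : submod H) : sm_sub A B -> artin A B.
Proof.
by move=> AB P _ PAB; exists 0%N => k _ x /(PAB _).2/AB/(PAB _).1.
Qed.

Lemma ndim_zero k H (A B : submod H) : sm_sub A B -> ndim k A B.
Proof.
elim: k A B => [//|k IH] A B AB P _ PAB; exists 0%N => i _; apply: IH.
by move=> x /(PAB _).2/AB/(PAB _).1.
Qed.

Definition linrel H (H' : lmodType R) (rho : H -> H' -> Prop) :=
  rho 0 0 /\ forall a u u' v v', rho u u' -> rho v v' -> rho (a *: u + v) (a *: u' + v').

(* A'/B' is a subquotient of A/B, as witnessed by the additive relation rho. *)
Definition subquo H (H' : lmodType R) (rho : H -> H' -> Prop) (A B : submod H) (A' B' : submod H') :=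
  [/\ linrel rho, forall a', A' a' -> exists2 a, A a & rho a a' &
  forall b a', B b -> A' a' -> rho b a' -> B' a'].

Section Pullback.
Variables (H H' : lmodType R) (rho : H -> H' -> Prop) (A B : submod H) (A' B' : submod H').
Hypotheses (BA : sm_sub B A) (sq : subquo rho A B A' B').

(** The preimage of [P] under [rho] inside [A], enlarged by [B]: chains between [B'] and [A'] become
    chains between [B] and [A], from which [pull_wd] recovers [P]. *)
Fact pull_proof (P : submod H') : exists Q : submod H, forall a, Q a <->
  A a /\ exists b p, [/\ B b, P p & rho (a - b) p].
Proof.
case: sq => -[rho0 rhoZD] _ _.
pose Q a := A a /\ exists b p, [/\ B b, P p & rho (a - b) p].
have Q0 : Q 0 by split; [exact: sm0|exists 0, 0; rewrite subr0; split=> //; exact: sm0].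
have QZD r u v : Q u -> Q v -> Q (r *: u + v).
  move=> [Au [b [p [Bb Pp up]]]] [Av [c [q [Bc Pq vq]]]]; split; first exact: smZD.
  exists (r *: b + c), (r *: p + q); split; [exact: smZD|exact: smZD|].
  by rewrite opprD addrACA -scalerBr; apply: rhoZD.
by exists (Submod Q0 QZD).
Qed.
Definition pull P := projT1 (cid (pull_proof P)).
Lemma pullP P a : pull P a <-> A a /\ exists b p, [/\ B b, P p & rho (a - b) p].
Proof. exact: (projT2 (cid (pull_proof P))). Qed.

Lemma pull_between P : sm_sub B (pull P) /\ sm_sub (pull P) A.
Proof.
split=> x; last by move=> /pullP[].
move=> Bx; apply/pullP; split; first exact: BA.
case: sq => -[rho0 _] _ _.
by exists x, 0; rewrite subrr; split=> //; apply: sm0.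
Qed.

Lemma pull_mono P Q : sm_sub P Q -> sm_sub (pull P) (pull Q).
Proof.
move=> PQ a /pullP[Aa [b [p [Bb Pp r]]]]; apply/pullP; split=> //.
by exists b, p; split=> //; apply: PQ.
Qed.

Lemma pull_wd P a p : sm_sub B' P -> pull P a -> A' p -> rho a p ->
  (forall q, P q -> A' q) -> P p.
Proof.
case: sq => -[rho0 rhoZD] _ wd B'P /pullP[_ [b [q [Bb Pq abq]]]] A'p ap PA'.
have rbpq : rho b (p - q).
  by have := rhoZD (-1) _ _ _ _ abq ap; rewrite !scaleN1r opprB subrK addrC.
rewrite -[p](subrK q) addrC; apply: smD => //; apply: B'P; apply: wd Bb _ rbpq.
by apply: smB => //; apply: PA'.
Qed.

Lemma pull_subq P Q : sm_sub P Q -> sm_sub B' P -> sm_sub Q A' ->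
  subquo rho (pull Q) (pull P) Q P.
Proof.
move=> PQ B'P QA'; case: (sq) => lin surj wd; split=> // [q Qq|b q Pb Qq bq].
  have [a Aa aq] := surj q (QA' _ Qq); exists a => //; apply/pullP; split=> //.
  by exists 0, q; rewrite subr0; split=> //; apply: sm0.
by apply: (pull_wd B'P Pb _ bq) => [|r /PQ]; exact: QA'.
Qed.
End Pullback.

Lemma artin_subq H (H' : lmodType R) (rho : H -> H' -> Prop) (A B : submod H) (A' B' : submod H') :
  sm_sub B A -> subquo rho A B A' B' -> artin A B -> artin A' B'.
Proof.
move=> BA sq art P Pd PAB.
have [|i|n nP] := art (fun i => pull sq (P i)).
- by move=> i; apply: pull_mono.
- exact: pull_between.
exists n => k nk p Pp; case: (sq) => lin surj wd.
have [a Aa ap] := surj p ((PAB n).2 _ Pp).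
have Pa : pull sq (P n) a.
  by apply/pullP; split=> //; exists 0, p; rewrite subr0; split=> //; apply: sm0.
apply: (pull_wd (PAB k).1 (nP k nk a Pa) _ ap) => [|r]; first exact: (PAB n).2.
exact: (PAB k).2.
Qed.

Lemma ndim_subq k H (H' : lmodType R) (rho : H -> H' -> Prop) (A B : submod H) (A' B' : submod H') :
  sm_sub B A -> subquo rho A B A' B' -> ndim k A B -> ndim k A' B'.
Proof.
elim: k A B A' B' => [|k IH] A B A' B' BA sq.
  by move=> AB a' A'a'; case: sq => _ surj wd; have [a /AB Ba] := surj a' A'a'; apply: wd.
move=> dimA P Pi PAB.
have [|i|n nP] := dimA (fun i => pull sq (P i)).
- by move=> i; apply: pull_mono.
- exact: pull_between.
exists n => i ni; apply: IH (nP i ni).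
  exact: pull_mono.
by apply: pull_subq; [exact: Pi|exact: (PAB i).1|exact: (PAB i.+1).2].
Qed.

Definition cap_sm H (A B : submod H) : submod H.
Proof.
exists (fun x => A x /\ B x); first by split; apply: sm0.
by move=> a u v [? ?] [? ?]; split; apply: smZD.
Defined.

Lemma add_smP H (A B : submod H) x : add_sm A B x <-> exists2 a, A a & B (x - a).
Proof.
split=> [[a [b [Aa Bb ->]]]|[a Aa Bb]]; first by exists a => //; rewrite addrAC subrr add0r.
by exists a, (x - a); rewrite [RHS]addrC subrK.
Qed.

Lemma linrel_sub H (P : submod H) : linrel (fun a a' => P (a' - a)).
Proof.
split=> [|a u u' v v' uu vv]; first by rewrite subrr; apply: sm0.
by rewrite opprD addrACA -scalerBr; apply: smZD.
Qed.

Lemma linrel_eq H : linrel (fun a a' : H => a = a').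
Proof. by split=> // a u _ v _ <- <-. Qed.

Lemma add_sm_mono H (A A' B : submod H) : sm_sub A A' -> sm_sub (add_sm A B) (add_sm A' B).
Proof. by move=> AA' x [a [b [Aa Bb ->]]]; exists a, b; split=> //; apply: AA'. Qed.

Lemma add_sm_lub H (A B C : submod H) : sm_sub A C -> sm_sub B C -> sm_sub (add_sm A B) C.
Proof. by move=> sAC BC x [a [b [Aa Bb ->]]]; apply: smD; [apply: sAC|apply: BC]. Qed.

Lemma add_sm_l H (A B : submod H) : sm_sub A (add_sm A B).
Proof. by move=> x Ax; exists x, 0; rewrite addr0; split=> //; apply: sm0. Qed.
Lemma add_sm_r H (A B : submod H) : sm_sub B (add_sm A B).
Proof. by move=> x Bx; exists 0, x; rewrite add0r; split=> //; apply: sm0. Qed.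

Lemma artin_ext H (A B C : submod H) : sm_sub B C -> sm_sub C A ->
  artin A C -> artin C B -> artin A B.
Proof.
move=> BC CA aAC aCB P Pd PAB.
have [|i|n nP] := aAC (fun i => add_sm (P i) C).
- by move=> i; apply/add_sm_mono/Pd.
- by split; [exact: add_sm_r|apply: add_sm_lub => //; exact: (PAB i).2].
have [|i|l lP] := aCB (fun i => cap_sm (P i) C).
- by move=> i x [/Pd Px Cx].
- split=> x; last by case.
  by move=> Bx; split; [exact: (PAB i).1|exact: BC].
have Pm := dec_chain Pd.
exists (maxn n l) => k; rewrite geq_max => /andP[nk lk] x Px.
have /add_smP[p Pp Cxp] : add_sm (P k) C x.
  by apply: (nP k nk); apply: add_sm_l; apply: Pm Px; rewrite leq_maxl.
rewrite -[x](subrK p); apply: smD => //.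
have [] // : cap_sm (P k) C (x - p).
apply: (lP k lk); split=> //; apply: smB.
  by apply: Pm Px; rewrite leq_maxr.
by apply: Pm Pp.
Qed.

Lemma ndim_ext k H (A B C : submod H) : sm_sub B C -> sm_sub C A ->
  ndim k A C -> ndim k C B -> ndim k A B.
Proof.
elim: k A B C => [|k IH] A B C BC CA; first by move=> sAC CB x /sAC/CB.
move=> dAC dCB P Pi PAB.
have [|i|n nP] := dAC (fun i => add_sm (P i) C).
- by move=> i; apply/add_sm_mono/Pi.
- by split; [exact: add_sm_r|apply: add_sm_lub => //; exact: (PAB i).2].
have [|i|l lP] := dCB (fun i => cap_sm (P i) C).
- by move=> i x [/Pi Px Cx].
- split=> x; last by case.
  by move=> Bx; split; [exact: (PAB i).1|exact: BC].
exists (maxn n l) => i; rewrite geq_max => /andP[ni li].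
(* Of the two layers of [P (i.+1) / P i], the upper one embeds into [(P (i.+1) + C) / (P i + C)] and
   the lower one is a quotient of [(P (i.+1) cap C) / (P i cap C)]. *)
apply: (IH _ _ (add_sm (P i) (cap_sm (P i.+1) C))).
- exact: add_sm_l.
- by apply: add_sm_lub => [|x []]; [exact: Pi|].
- apply: (ndim_subq _ _ (nP i ni)); first exact/add_sm_mono/Pi.
  split; [exact: linrel_eq|by move=> a Pa; exists a => //; apply: add_sm_l|].
  move=> b a' + Pa ba; rewrite ba => /add_smP[p Pp Cbp]; apply/add_smP; exists p => //.
  by split=> //; apply: smB => //; apply: Pi.
- apply: (ndim_subq (rho := fun a a' => P i (a' - a)) _ _ (lP i li)).
    by move=> x [/Pi Px Cx].
  split; first exact: linrel_sub.
    move=> a' /add_smP[p Pp Ca]; exists (a' - p) => //.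
    by rewrite opprB addrC subrK.
  by move=> b a' [Pb _] _ Pab; rewrite -[a'](subrK b); apply: smD.
Qed.

Definition img_sm H (H' : lmodType R) (f : {linear H -> H'}) (A : submod H) (B : submod H') :
  submod H'.
Proof.
exists (fun z => exists2 a, A a & B (z - f a)).
  by exists 0; [exact: sm0|rewrite linear0 subr0; exact: sm0].
move=> r u v [a Aa Ba] [b Ab Bb]; exists (r *: a + b); first exact: smZD.
by rewrite linP opprD addrACA -scalerBr; apply: smZD.
Defined.

(** * Modules that are torsion for one element *)

Section Torsion.
Variables (H : lmodType R) (x : R).

Definition kill_sm (Z B : submod H) (t : nat) : submod H.
Proof.
exists (fun z => Z z /\ B (x ^+ t *: z)); first by rewrite scaler0; split; apply: sm0.
move=> a u v [Zu Bu] [Zv Bv]; split; first exact: smZD.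
by rewrite scalerDr scalerA mulrC -scalerA; apply: smZD.
Defined.

Definition mul_sm (A B : submod H) (t : nat) : submod H := img_sm (smul H (x ^+ t)) A B.

Lemma mul_sm_dec (A B : submod H) t : sm_sub (mul_sm A B t.+1) (mul_sm A B t).
Proof.
by move=> z [a Aa Ba]; exists (x *: a); [exact: smZ|rewrite /= scalerA -exprSr].
Qed.

Lemma mul_sm_B (A B : submod H) t : sm_sub B (mul_sm A B t).
Proof. by move=> z Bz; exists 0; [exact: sm0|rewrite linear0 subr0]. Qed.

Lemma mul_sm_mono (A A' B : submod H) t : sm_sub A A' -> sm_sub (mul_sm A B t) (mul_sm A' B t).
Proof. by move=> AA' z [a Aa Ba]; exists a => //; apply: AA'. Qed.

Lemma mul_sm_sub (A B Z : submod H) t : sm_sub A Z -> sm_sub B Z -> sm_sub (mul_sm A B t) Z.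
Proof.
move=> AZ BZ z [a Aa Ba]; rewrite -[z](subrK (x ^+ t *: a)); apply: smD; first exact: BZ.
by apply: smZ; apply: AZ.
Qed.

Variables (Z B : submod H).
Hypotheses (BZ : sm_sub B Z) (xtors : forall z, Z z -> exists k, B (x ^+ k *: z)).

(* A submodule N of Z/B is determined by the decreasing sequence of the submodules
   x^t N \cap (0 : x) of the Artinian module (0 : x). *)
Lemma artin_torsion : artin (kill_sm Z B 1) B -> artin Z B.
Proof.
move=> art N Nd NZ; have Nm := dec_chain Nd.
pose K t j := cap_sm (mul_sm (N j) B t) (kill_sm Z B 1).
have KB t j : sm_sub B (K t j).
  move=> z Bz; split; first exact: mul_sm_B.
  by split; [exact: BZ|exact: smZ].
have Kt t t' j : (t <= t')%N -> sm_sub (K t' j) (K t j).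
  move=> tt' z [Mz Tz]; split=> //; move: tt' z Mz {Tz}.
  exact: (dec_chain (fun t => @mul_sm_dec (N j) B t)).
have Kj t j j' : (j <= j')%N -> sm_sub (K t j') (K t j).
  by move=> jj' z [Mz Tz]; split=> //; apply: mul_sm_mono Mz; apply: Nm.
(* As [K] decreases in both indices, a diagonal that is constant from [t0] on makes [K t j] constant
   for all [t, j >= t0]; the finitely many rows [t < t0] stabilize one by one. *)
have [||t0 diag] := art (fun t => K t t).
- by move=> t z /Kt-/(_ t (leqnSn t))/Kj; apply.
- by move=> t; split=> [|z []//]; exact: KB.
have rowstab t : exists n, forall k, (n <= k)%N -> sm_sub (K t n) (K t k).
  apply: (art (K t)) => j; first exact: Kj.
  by split=> [|z []//]; exact: KB.
have [J [J0 JP]] : exists J, (t0 <= J)%N /\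
    forall t, (t < t0)%N -> forall k, (J <= k)%N -> sm_sub (K t J) (K t k).
  elim: {2}t0 => [|s [J [J0 JP]]]; first by exists t0.
  have [n nP] := rowstab s; exists (maxn J n); rewrite (leq_trans J0) ?leq_maxl //.
  split=> // t; rewrite ltnS leq_eqVlt => /predU1P[->|ts] k; rewrite geq_max => /andP[Jk nk].
    by move=> z /(Kj s n)-/(_ (leq_maxr _ _))/nP; apply.
  by move=> z /(Kj t J)-/(_ (leq_maxl _ _))/JP; apply.
have Kstab t k : (J <= k)%N -> sm_sub (K t J) (K t k).
  move=> Jk; have [|t0t] := ltnP t t0; first by move=> /JP; apply.
  move=> z /(Kj _ t0)-/(_ J0)/(Kt t0)-/(_ t0t) z0.
  have /(diag _) := leq_trans t0t (leq_maxl t k).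
  move=> /(_ z z0) /(Kt t)-/(_ (leq_maxl _ _))/(Kj _ k); apply.
  exact: leq_maxr.
exists J => k Jk.
(* If [x^(s+1)] kills [n] modulo [B], then [x^s n] lies in [K s J], hence agrees modulo [B] with
   [x^s n'] for some [n'] in [N k], and [x^s] kills [n - n']. *)
suff Hs s n : N J n -> B (x ^+ s *: n) -> N k n.
  by move=> n Nn; have [s Bs] := xtors ((NZ J).2 _ Nn); apply: Hs Bs.
elim: s n => [|s IH] n Nn; first by rewrite scale1r => /(NZ k).1.
move=> Bn; have [] : K s k (x ^+ s *: n).
  apply: (Kstab _ _ Jk); split; first by exists n => //; rewrite subrr; apply: sm0.
  by split; [apply/smZ/(NZ J).2|rewrite scalerA -exprD].
move=> [n' Nn' Bnn'] _; rewrite -[n](subrK n'); apply: smD => //.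
by apply: IH; [apply: smB => //; apply: Nm Nn'|rewrite scalerBr].
Qed.

(** Multiplication by [x] embeds [(0 : x^(t+1)) / (0 : x)] into [(0 : x^t)]. *)
Lemma ndim_kill k t : ndim k (kill_sm Z B 1) B -> ndim k (kill_sm Z B t) B.
Proof.
move=> d1; elim: t => [|t IH]; first by apply: ndim_zero => z []; rewrite scale1r.
apply: (@ndim_ext _ _ _ _ (kill_sm Z B 1)) => //.
- by move=> z Bz; split; [exact: BZ|exact: smZ].
- by move=> z [Zz Bz]; split=> //; rewrite exprSr -scalerA; apply: smZ.
- apply: (ndim_subq (rho := fun a a' => a = x *: a') _ _ IH).
    by move=> z Bz; split; [exact: BZ|exact: smZ].
  split.
  + split=> [|a u u' v v' -> ->]; first by rewrite scaler0.
    by rewrite scalerDr !scalerA mulrC.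
  + move=> z [Zz Bz]; exists (x *: z) => //; split; first exact: smZ.
    by rewrite scalerA -exprSr.
  + by move=> b z Bb [Zz _] bE; split=> //; rewrite -bE.
Qed.

Lemma artin_mul : artin Z B -> forall A, sm_sub B A -> sm_sub A Z ->
  exists n, forall k, (n <= k)%N -> sm_sub (mul_sm A B n) (mul_sm A B k).
Proof.
move=> art A BA AZ; apply: (art (mul_sm A B)); first by move=> t; apply: mul_sm_dec.
move=> t; split; first exact: mul_sm_B.
exact: mul_sm_sub.
Qed.
End Torsion.

(* For an increasing chain A_j, let D_j be the largest x-divisible submodule of A_j. Then
   (0 : x) in D_(j+1)/D_j comes from (0 : x) in D_(j+1), which gives the induction, and
   A_(j+1)/D_(j+1) is a quotient of some (0 : x^l). *)
Lemma ndim_torsion k H x (Z B : submod H) : sm_sub B Z ->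
  (forall z, Z z -> exists k, B (x ^+ k *: z)) -> artin Z B ->
  ndim k (kill_sm x Z B 1) B -> ndim k.+1 Z B.
Proof.
elim: k Z B => [|k IH] Z B BZ xtors art dT.
  apply: ndim_zero => z Zz; have [s] := xtors z Zz; elim: s z Zz => [|s IHs] z Zz.
    by rewrite scale1r.
  rewrite exprSr -scalerA => Bz; apply: dT; split=> //; apply: IHs => //.
  exact: smZ.
move=> A Ai AZB.
have D_proof j : exists D : submod H, forall z, D z <-> forall t, mul_sm x (A j) B t z.
  pose D z := forall t, mul_sm x (A j) B t z.
  have D0 : D 0 by move=> t; apply: sm0.
  have DZ a u v : D u -> D v -> D (a *: u + v) by move=> Du Dv t; apply: smZD.
  by exists (Submod D0 DZ).
pose D j := projT1 (cid (D_proof j)).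
have DP j z : D j z <-> forall t, mul_sm x (A j) B t z by exact: (projT2 (cid (D_proof j))).
have Dmul j : exists n, forall t, (n <= t)%N -> sm_sub (mul_sm x (A j) B t) (D j).
  have [n nP] := artin_mul x BZ art (AZB j).1 (AZB j).2.
  exists n => t nt z /(dec_chain (fun t => @mul_sm_dec _ x (A j) B t))-/(_ n nt) zn.
  apply/DP => s; have /(_ z zn) := nP (maxn n s) (leq_maxl _ _).
  by apply: (dec_chain (fun t => @mul_sm_dec _ x (A j) B t)); apply: leq_maxr.
have Ddiv j t z : D j z -> exists2 d, D j d & B (z - x ^+ t *: d).
  have [n nP] := Dmul j; move=> /DP/(_ (n + t)%N)[a Aa Ba].
  exists (x ^+ n *: a); last by rewrite scalerA -exprD [(t + n)%N]addnC.
  by apply: (nP n) => //; exists a => //; rewrite subrr; apply: sm0.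
have DA j : sm_sub (D j) (A j).
  move=> z /DP/(_ 0%N)[a Aa]; rewrite /= scale1r => Ba; rewrite -[z](subrK a).
  by apply: smD => //; apply: (AZB j).1.
have BD j : sm_sub B (D j) by move=> z Bz; apply/DP => t; apply: mul_sm_B.
have Di j : sm_sub (D j) (D j.+1).
  by move=> z /DP Dz; apply/DP => t; apply: mul_sm_mono (Dz t); apply: Ai.
have [||n nP] := dT (fun j => cap_sm (kill_sm x Z B 1) (D j)).
- by move=> j z [Tz /Di].
- move=> j; split=> z; last by case.
  by move=> Bz; split; [split; [exact: BZ|exact: smZ]|exact: BD].
exists n => j nj.
have dD : ndim k.+1 (D j.+1) (D j).
  apply: IH.
  - exact: Di.
  - by move=> z /DA/(AZB _).2/xtors[t Bt]; exists t; apply: BD.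
  - apply: (artin_subq (rho := fun a a' => a = a') BZ _ art); split.
    + exact: linrel_eq.
    + by move=> a /DA/(AZB _).2 Za; exists a.
    + by move=> b _ Bb _ <-; apply: BD.
  - apply: (ndim_subq (rho := fun a a' => D j (a' - a)) _ _ (nP j nj)).
      by move=> z [Tz /Di].
    split; first exact: linrel_sub.
      move=> z [Dz]; rewrite expr1 => /(Ddiv j 1%N)[d Dd]; rewrite expr1 -scalerBr => Bzd.
      exists (z - d); last by rewrite opprB addrC subrK.
      have Dzd : D j.+1 (z - d) by apply: smB => //; apply: Di.
      split=> //; split; last by rewrite expr1.
      exact/(AZB j.+1).2/DA.
    by move=> b a' [_ Db] _ Dab; rewrite -[a'](subrK b); apply: smD.
apply: (@ndim_ext _ _ _ _ (add_sm (A j) (D j.+1))).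
- exact: add_sm_l.
- by apply: add_sm_lub; [exact: Ai|exact: DA].
- have [l lP] := Dmul j.+1.
  apply: (ndim_subq (rho := fun a a' => D j.+1 (a' - a)) _ _ (ndim_kill BZ l dT)).
    by move=> z Bz; split; [exact: BZ|exact: smZ].
  split; first exact: linrel_sub.
    move=> a Aa; have Da : D j.+1 (x ^+ l *: a).
      by apply: (lP l) => //; exists a => //; rewrite subrr; apply: sm0.
    have [d Dd Bd] := Ddiv j.+1 l _ Da; exists (a - d); last by rewrite opprB addrC subrK.
    by split; rewrite ?scalerBr //; apply/(AZB j.+1).2/smB => //; apply: DA.
  move=> b a' Bb _ Dab; apply: add_sm_r; rewrite -[a'](subrK b); apply: smD => //.
  exact: BD.
- apply: (ndim_subq (rho := fun a a' => A j (a' - a)) _ _ dD); first exact: Di.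
  split; first exact: linrel_sub.
    by move=> a' /add_smP[a Aa Da]; exists (a' - a) => //; rewrite opprB addrC subrK.
  by move=> b a' /DA Ab _ Aab; rewrite -[a'](subrK b); apply: smD.
Qed.
End Subquotients.

(** * Local cohomology over a Noetherian local ring *)

Section Dimension.
Variable R : comNzRingType.
Implicit Types (I J : {pred R}) (p q : submod R^o).

(* [R] and [R^o] carry different (convertible) ring structures; the type of [idpred p]
   makes the predicates on ideals use the one of [R]. *)
Definition idpred (p : submod R^o) : {pred R} := sm_bool p.

Lemma quo_dim_le_sub I J k : {subset I <= J} -> quo_dim_le I k -> quo_dim_le J k.
Proof.
move=> IJ dI c P [Pp Pi]; apply: dI (conj _ Pi) => i ic.
by have [pr JP] := Pp i ic; split=> // x /IJ/JP.
Qed.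

Lemma quo_dim_le_trans I (k l : int) : k <= l -> quo_dim_le I k -> quo_dim_le I l.
Proof. by move=> kl dI c P /dI ck; apply: le_trans kl. Qed.

Lemma sprime_prime p : sprime p -> prime_ideal (idpred p).
Proof.
move=> [p1 pM]; split.
  split; [by apply/asboolP/sm0|by apply/negP => /asboolP|].
  by move=> a u v /asboolP pu /asboolP pv; apply/asboolP; apply: (@smZD _ _ p a).
by move=> u v /asboolP/pM[?|?]; apply/orP; [left|right]; apply/asboolP.
Qed.

Lemma idealr_sm (P : {pred R}) : idealr_closed P ->
  exists p : submod R^o, ~ p 1 /\ forall x, p x <-> x \in P.
Proof.
move=> [P0 P1 PZD].
exists (@Submod _ R^o (fun x => x \in P) P0 (fun a u v Pu Pv => PZD a u v Pu Pv)).
by split=> //; apply/negP.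
Qed.

Lemma prime_sprime (P : {pred R}) : prime_ideal P ->
  exists2 p : submod R^o, sprime p & forall x, p x <-> x \in P.
Proof.
move=> [/idealr_sm[p [p1 pE]] PM]; exists p => //; split=> // a b /pE/PM/orP[] /pE; tauto.
Qed.

Lemma quo_dim_le_prime_ge0 p k : sprime p -> quo_dim_le (idpred p) k -> 0 <= k.
Proof.
move=> /sprime_prime pp /(_ 1%N (fun=> idpred p)); apply.
by split=> [i _|[]//]; split.
Qed.

(** A chain of primes over [I] can be prolonged downwards by [p], strictly because [s] lies in [I]
    but not in [p]. *)
Lemma quo_dim_le_step p I (s : R) (k : int) : sprime p -> ~ p s -> (forall x, p x -> x \in I) ->
  s \in I -> quo_dim_le (idpred p) k -> quo_dim_le I (k - 1).
Proof.
move=> pp nps pI Is dp [|c] P [Pp Pi].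
  (* The empty chain has length -1, so [k >= 0] is required; [p] alone is a chain that gives it. *)
  by have := quo_dim_le_prime_ge0 pp dp; lia.
suff : c.+2%:Z - 1 <= k by lia.
apply: (dp c.+2 (fun i => if i is j.+1 then P j else idpred p)); split=> [[|i] ic|[|i] ic].
- by split=> //; apply: sprime_prime.
- have [pr IP] := Pp i ic; split=> // x /asboolP/pI/IP //.
- have [_ IP] := Pp 0%N isT; split=> [x /asboolP/pI/IP //|PP].
  by apply: nps; apply/asboolP/PP/IP.
- exact: Pi.
Qed.

Lemma quo_dim_le_unit I (k : int) : 1 \in I -> -1 <= k -> quo_dim_le I k.
Proof.
move=> I1 k1 [|c] P [Pp _]; first by lia.
by have [[[_ /negP P1 _] _] IP] := Pp 0%N isT; case: P1; apply: IP.
Qed.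

Lemma ann_mem (N : lmodType R) r : r \in ann N <-> forall x : N, r *: x = 0.
Proof. by split=> [/asboolP|H]; last exact/asboolP. Qed.

Lemma ann_quot p r : r \in ann (quot p) <-> p r.
Proof.
rewrite ann_mem; split=> [/(_ (proj_quot p (1 : R^o)))|pr u].
  by rewrite -linZ => /proj_quot_eq0; rewrite /GRing.scale /= mulr1.
have [x <-] := proj_quot_surj u; rewrite -linZ; apply/proj_quot_eq0.
by rewrite /GRing.scale /= mulrC; apply: smZ.
Qed.

Lemma quo_dim_le_ann_quot p k : quo_dim_le (ann (quot p)) k <-> quo_dim_le (idpred p) k.
Proof.
by split; apply: quo_dim_le_sub => x; [move=> /ann_quot px; apply/asboolP|
  move=> /asboolP px; apply/ann_quot].
Qed.

Lemma ann_inj (A B : lmodType R) (f : {linear A -> B}) : injective f ->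
  {subset ann B <= ann A}.
Proof.
by move=> fi r /ann_mem rB; apply/ann_mem => x; apply: fi; rewrite linZ rB linear0.
Qed.
Lemma ann_surj (B C : lmodType R) (g : {linear B -> C}) : (forall c, exists b, g b = c) ->
  {subset ann B <= ann C}.
Proof.
by move=> gs r /ann_mem rB; apply/ann_mem => c; have [b <-] := gs c; rewrite -linZ rB linear0.
Qed.

Lemma prime_smul_exact p (x : R) : sprime p -> ~ p x ->
  short_exact (smul (quot p) x) (proj_quot (im_sm (smul (quot p) x))).
Proof.
move=> [_ pM] npx; apply: short_exact_coker.
suff H u : smul (quot p) x u = 0 -> u = 0.
  move=> u v /eqP; rewrite -subr_eq0 -linearB => /eqP/H/eqP.
  by rewrite subr_eq0 => /eqP.
have [r <-] := proj_quot_surj u; rewrite mklinE -linZ => /proj_quot_eq0/pM[//|pr].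
exact/proj_quot_eq0.
Qed.

Lemma ann_coker_mul (N : lmodType R) x :
  x \in ann (quot (im_sm (smul N x))).
Proof.
apply/ann_mem => u; have [n <-] := proj_quot_surj u; rewrite -linZ.
by apply/proj_quot_eq0; exists n.
Qed.
End Dimension.

(** Either the annihilator of [N/Rv] is still in [p], and a map from there is composed with the
    projection, or some [t] outside [p] carries [N] into [Rv]. In the second case [Ann v] lies in
    [p], so sending [n] to the class of [r] when [t n = r v] is well defined, and [v] goes to the
    nonzero class of [t]. *)
Lemma nonzero_map (R : comNzRingType) (p : submod R^o) (N : lmodType R) : sprime p -> fg N ->
  (forall x, x \in ann N -> p x) -> exists (g : {linear N -> quot p}) n, g n <> 0.
Proof.
move=> [p1 pM] [s]; move En: (size s) => k.
elim: k N s En => [|k IH] N [//|v s] // => [_|[Es]] sN annp.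
  case: p1; apply/annp/ann_mem => x; have /in_span_nil -> := sN x; exact: scaler0.
pose N1 := quot (im_sm (rmul v)).
have [H1|] := pselect (forall x, x \in ann N1 -> p x).
  have s1N u : in_span (map (proj_quot (im_sm (rmul v))) s) u.
    have [x <-] := proj_quot_surj u; apply/in_span_map.
    have /in_span_cons[a [y [ys ->]]] := sN x; exists y => //.
    apply/eqP; rewrite -subr_eq0 -linearB addrK; apply/eqP/proj_quot_eq0.
    by exists a.
  have [g [n gn]] := IH N1 _ (etrans (size_map _ _) Es) s1N H1.
  have [m mE] := proj_quot_surj n; exists (complin g (proj_quot _)), m.
  by rewrite /= mE.
move=> /existsNP[t /not_implyP[/ann_mem tN1 npt]].
have annv r : (r : R) *: v = 0 -> p r.
  move=> rv; suff /pM[//|/npt//] : p ((r : R) * t).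
  apply/annp/ann_mem => n; rewrite -scalerA.
  have /proj_quot_eq0[a ->] : proj_quot (im_sm (rmul v)) (t *: n) = 0 by rewrite linZ tN1.
  by rewrite mklinE scalerA mulrC -scalerA rv scaler0.
have tv n : exists r : R, t *: n = r *: v.
  have /proj_quot_eq0[a] : proj_quot (im_sm (rmul v)) (t *: n) = 0 by rewrite linZ tN1.
  by exists a.
pose g0 n : quot p := proj_quot p (projT1 (cid (tv n)) : R^o).
have g0E n (r : R) : t *: n = r *: v -> g0 n = proj_quot p (r : R^o).
  move=> rE; apply/eqP; rewrite -subr_eq0 -linearB; apply/eqP/proj_quot_eq0/annv.
  by rewrite scalerBl -(projT2 (cid (tv n))) rE subrr.
have g0L : linear g0.
  move=> a x y; have [b bE] := tv x; have [c cE] := tv y.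
  rewrite (g0E _ _ bE) (g0E _ _ cE) -linP; apply: g0E.
  by rewrite scalerDr scalerDl scalerA mulrC -scalerA bE cE scalerA.
exists (mklin g0L), v; rewrite mklinE (g0E v t) // => /proj_quot_eq0; exact: npt.
Qed.

Section Local.
Variables (R : comNzRingType) (m : {pred R}) (xs : seq R).
Hypotheses (nR : noetherian R) (lR : local_ring m).
Hypothesis mE : forall a : R, a \in m <-> in_span (xs : seq R^o) a.
Implicit Types (p : submod R^o) (N A B C : lmodType R).
Local Notation F := (cech xs).

Lemma proper_sub_m p : ~ p 1 -> forall x, p x -> x \in m.
Proof.
move: p; apply: (noeth_ind (noetherian_mod nR)) => p IH np1.
have [[Q [pQ sQ nQ1]] x px|Hmax] := pselect (exists Q : submod R^o,
    [/\ forall x, p x -> Q x, exists2 x, Q x & ~ p x & ~ Q 1]).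
  exact: (IH Q pQ sQ nQ1 x (pQ x px)).
have pmax : maximal_ideal (idpred p).
  split.
    split; [by apply/asboolP/sm0|by apply/negP => /asboolP|].
    by move=> a u v /asboolP pu /asboolP pv; apply/asboolP; apply: (@smZD _ _ p a).
  move=> J /idealr_sm[q [q1 qE]] pJ x /qE qx; apply/asboolP.
  apply: contrapT => npx; apply: Hmax; exists q; split=> //; last by exists x.
  by move=> y py; apply/qE/pJ/asboolP.
by move=> x px; rewrite -(lR.2 _ pmax); apply/asboolP.
Qed.

Lemma local_unit (a : R) : a \notin m -> exists b, b * a = 1.
Proof.
move=> am; have [[b ba]|H] := pselect (im_sm (rmul (a : R^o)) 1); first by exists b.
have := proper_sub_m H (x := a); rewrite (negPf am) => H'.
suff : false by []; apply: H'; exists 1; rewrite mklinE.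
by rewrite /GRing.scale /= mul1r.
Qed.

Lemma prime_sub_m p : sprime p -> forall x, p x -> x \in m.
Proof. by case=> p1 _; apply: proper_sub_m. Qed.

Lemma m_ideal : idealr_closed m. Proof. by have [[]] := lR. Qed.

Lemma m_prime : prime_ideal m.
Proof.
split; first exact: m_ideal.
move=> u v uv; apply/negPn/negP; rewrite negb_or => /andP[].
move=> /local_unit[a au] /local_unit[b bv]; have [m0 /negP m1 mZD] := m_ideal.
have := mZD (a * b) (u * v) 0 uv m0.
move=> H; apply: m1; move: H; have -> // : a * b * (u * v) + 0 = 1.
by rewrite addr0 [u * v]mulrC -mulrA [b * _]mulrA bv mul1r au.
Qed.

Lemma prime_dim0 p : sprime p -> quo_dim_le (idpred p) 0 -> forall x, p x <-> x \in m.
Proof.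
move=> pp dp x; split; first exact: prime_sub_m.
move=> mx; apply: contrapT => npx.
suff /dp : prime_chain (idpred p) 2 (fun i => if i is 0 then idpred p else m) by [].
split=> [[|[|i]]|[|i]] // _.
- by split=> //; apply: sprime_prime.
- by split; [exact: m_prime|move=> y /asboolP; exact: prime_sub_m].
- split; first by move=> y /asboolP; exact: prime_sub_m.
  by move=> /(_ x mx)/asboolP.
Qed.

Lemma mem_xs x : x \in xs -> x \in m.
Proof. by move=> xxs; apply/mE/(@mem_span R R^o xs). Qed.

Lemma xs_sub p : (forall x, x \in xs -> p x) -> forall x, x \in m -> p x.
Proof. by move=> xsp x /mE; apply: (@span_sub R R^o xs). Qed.

(** The dichotomy behind each devissage: either [R/p] is the residue field, which is torsion and has
    no higher cohomology, or multiplication by some generator [x] is injective on [R/p] while the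
    cohomology is [x]-power torsion. *)
Lemma prime_cases p : sprime p ->
  (forall x, p x <-> x \in m) \/ exists2 x, x \in xs & ~ p x.
Proof.
move=> pp; have [[x xxs npx]|H] := pselect (exists2 x, x \in xs & ~ p x).
  by right; exists x.
left=> x; split; first exact: prime_sub_m.
apply: xs_sub => y yxs; apply: contrapT => npy; apply: H; by exists y.
Qed.

Lemma residue_torsion p : (forall x, p x <-> x \in m) ->
  forall x, x \in xs -> forall n : quot p, exists k, x ^+ k *: n = 0.
Proof.
move=> pm x /mem_xs mx n; exists 1%N; rewrite expr1.
by have /ann_quot/ann_mem := (pm x).2 mx; apply.
Qed.

Lemma acyclic_zero N i : (forall n : N, n = 0) -> acyclic_at F N i.
Proof.
case: i => [|i] N0.
  by move=> z _; have [n <-] := caug_surj z; rewrite (N0 n) linear0; apply: sm0.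
by apply/flasque_acyclic/torsion_flasque => x _ n; exists 0%N; rewrite (N0 n) scaler0.
Qed.

Lemma acyclic_ext (A B C : lmodType R) (f : {linear A -> B}) (g : {linear B -> C}) i : short_exact f g ->
  acyclic_at F A i -> acyclic_at F C i -> acyclic_at F B i.
Proof.
move=> fg aA aC z zZ.
have [a aZ Hza] := les_mid fg zZ (aC _ (map_Hz g zZ)).
by rewrite -[z](subrK (cmap F f i a)); apply: smD => //; apply/map_Hb/aA.
Qed.

Lemma inj_torsion_acyclic N x i : x \in xs ->
  (forall z, Hz F N i z -> Hb F N i (x *: z) -> Hb F N i z) -> acyclic_at F N i.
Proof.
move=> xxs xinj z zZ; have [k] := cech_torsion zZ xxs; elim: k z zZ => [|k IH] z zZ.
  by rewrite scale1r.
rewrite exprSr -scalerA => /(IH _ (smZ _ zZ)); exact: xinj.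
Qed.

(* Grothendieck's vanishing theorem; the bound [j] is dim N + 1. *)
Lemma cech_vanish (j : nat) N i : fg N -> quo_dim_le (ann N) (j%:Z - 1) -> (j <= i)%N ->
  acyclic_at F N i.
Proof.
elim: j N i => [|j IHj] N i fN.
all: move: N fN; apply: (devissage nR) => [N N0 _ _|p pp|A B C f g fg IHA IHC dB ji];
  [exact: acyclic_zero| |have [fi gs _] := fg;
  by apply: (acyclic_ext fg); [apply: IHA ji|apply: IHC ji];
    apply: quo_dim_le_sub dB; [apply: ann_inj fi|apply: ann_surj gs]].
  by move=> /quo_dim_le_ann_quot/(quo_dim_le_prime_ge0 pp).
case: i => [//|i] /quo_dim_le_ann_quot dp ji.
have [pm|[x xxs npx]] := prime_cases pp.
  by apply/flasque_acyclic/torsion_flasque/residue_torsion.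
have ses := prime_smul_exact pp npx.
(* The kernel of [x] on [H^(i+1)(R/p)] comes from [H^i] of [R/(p + xR)], which vanishes as the
   dimension has dropped. *)
apply: (inj_torsion_acyclic xxs) => z zZ; rewrite -cech_smul => /(les_A ses zZ)[c cZ cz].
apply: (delta_Hb ses cz).
have aQ : acyclic_at F (quot (im_sm (smul (quot p) x))) i; last exact: aQ.
apply: IHj ji; first exact/fg_quot/fg_quot/fg_ring.
have -> : j%:Z - 1 = (j.+1%:Z - 1) - 1 by lia.
apply: (quo_dim_le_step pp npx) dp; last exact: ann_coker_mul.
by move=> y /ann_quot; apply: ann_surj; exact: proj_quot_surj.
Qed.

Lemma linrel_delta (A B C : lmodType R) (f : {linear A -> B}) (g : {linear B -> C}) i :
  linrel (fun (c : F C i) (a : F A i.+1) => delta f g c a).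
Proof.
split; first by exists 0; rewrite !linear0.
by move=> r c a c' a' ca ca'; apply: delta_ZD.
Qed.

Lemma linrel_map (A B : lmodType R) (f : {linear A -> B}) i (P : submod (F B i)) :
  linrel (fun (a : F A i) (b : F B i) => P (b - cmap F f i a)).
Proof.
split; first by rewrite linear0 subrr; apply: sm0.
move=> r a b a' b' ab ab'; rewrite linP opprD addrACA -scalerBr; exact: smZD.
Qed.

(* The [x]-torsion of [H^(i+1)(R/p)] is a quotient of [H^i(R/(p + xR))]. *)
Lemma kill_prime_subq p (x : R) i : sprime p -> ~ p x ->
  subquo (fun (c : F (quot (im_sm (smul (quot p) x))) i) (a : F (quot p) i.+1) =>
      delta (smul (quot p) x) (proj_quot (im_sm (smul (quot p) x))) c a)
    (Hz F (quot (im_sm (smul (quot p) x))) i) (Hb F _ i)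
    (kill_sm x (Hz F (quot p) i.+1) (Hb F (quot p) i.+1) 1) (Hb F (quot p) i.+1).
Proof.
move=> pp npx; have ses := prime_smul_exact pp npx.
split; first exact: linrel_delta.
  move=> a [aZ]; rewrite expr1 -cech_smul => /(les_A ses aZ)[c cZ ca].
  by exists c.
by move=> c a cB _ ca; apply: (delta_Hb ses ca cB).
Qed.

Lemma kill_prime0 p (x : R) t : sprime p -> ~ p x ->
  sm_sub (kill_sm x (Hz F (quot p) 0) (Hb F (quot p) 0) t) (Hb F (quot p) 0).
Proof.
move=> pp npx z [_]; elim: t => [|t IH]; first by rewrite scale1r.
have [inj _ _] := cmap_exact F 0 (prime_smul_exact pp npx).
rewrite exprS -scalerA -cech_smul => /Hb0 E; apply/IH/Hb0.
by apply: inj; rewrite E linear0.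
Qed.

Lemma residue_simple p (P : submod (F (quot p) 0)) z : (forall x, p x <-> x \in m) ->
  P z -> z <> 0 -> forall w, P w.
Proof.
move=> pm + + w; have [u <-] := caug_surj z; have [v <-] := caug_surj w.
have [r <-] := proj_quot_surj u; have [s <-] := proj_quot_surj v => Pr r0.
have [b br] : exists b : R, b * (r : R) = 1.
  apply: local_unit; apply/negP => /pm/proj_quot_eq0 E.
  by apply: r0; rewrite E linear0.
have -> : proj_quot p s = ((s : R) * b) *: proj_quot p r.
  by rewrite -linZ; congr (proj_quot p _); rewrite /GRing.scale /= -mulrA br mulr1.
by rewrite linZ; apply: smZ.
Qed.

Lemma residue_artin p : (forall x, p x <-> x \in m) ->
  artin (Hz F (quot p) 0) (Hb F (quot p) 0) /\ ndim 1 (Hz F (quot p) 0) (Hb F (quot p) 0).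
Proof.
move=> pm; split=> P Pc PAB.
  have [[n Pn]|H] := pselect (exists n, forall z, P n z -> z = 0).
    by exists n => k _ z /Pn ->; apply: sm0.
  exists 0%N => k _ z _; have [w Pw w0] : exists2 w, P k w & w <> 0.
    apply: contrapT => Hw; apply: H; exists k => w Pw; apply: contrapT => w0.
    by apply: Hw; exists w.
  exact: (residue_simple pm Pw w0).
have [[n [w Pw w0]]|H] := pselect (exists n, exists2 w, P n w & w <> 0).
  exists n => i ni z _; apply: (residue_simple pm _ w0).
  by move: ni => /subnK <-; elim: (i - n)%N => [//|k]; rewrite addSn; apply: Pc.
exists 0%N => i _ z Pz; suff -> : z = 0 by apply: sm0.
by apply: contrapT => z0; apply: H; exists i.+1, z.
Qed.

Lemma Hb_sub_Hz N i : sm_sub (Hb F N i) (Hz F N i).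
Proof. by move=> z; apply: Hb_Hz. Qed.

Lemma cech_artin_ext (A B C : lmodType R) (f : {linear A -> B}) (g : {linear B -> C}) i k : short_exact f g ->
  artin (Hz F A i) (Hb F A i) /\ ndim k (Hz F A i) (Hb F A i) ->
  artin (Hz F C i) (Hb F C i) /\ ndim k (Hz F C i) (Hb F C i) ->
  artin (Hz F B i) (Hb F B i) /\ ndim k (Hz F B i) (Hb F B i).
Proof.
move=> fg [aA dA] [aC dC].
have [Q QP] : exists Q : submod (F B i), forall z, Q z <-> Hz F B i z /\ Hb F C i (cmap F g i z).
  pose Q z := Hz F B i z /\ Hb F C i (cmap F g i z).
  have Q0 : Q 0 by split; rewrite ?linear0; apply: sm0.
  have QZ r u v : Q u -> Q v -> Q (r *: u + v).
    by move=> [? ?] [? ?]; split; rewrite ?linP; apply: smZD.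
  by exists (Submod Q0 QZ).
have BQ : sm_sub (Hb F B i) Q by move=> z zB; apply/QP; split; [exact: Hb_Hz|exact: map_Hb].
have QZ : sm_sub Q (Hz F B i) by move=> z /QP[].
have s1 : subquo (fun (c : F C i) (z : F B i) => c = cmap F g i z)
    (Hz F C i) (Hb F C i) (Hz F B i) Q.
  split.
  - by split=> [|r c z c' z' -> ->]; [rewrite linear0|rewrite linP].
  - by move=> z zZ; exists (cmap F g i z) => //; apply: map_Hz.
  - by move=> c z cB zZ cE; apply/QP; rewrite -cE.
have s2 : subquo (fun (a : F A i) (z : F B i) => Hb F B i (z - cmap F f i a))
    (Hz F A i) (Hb F A i) Q (Hb F B i).
  split; first exact: linrel_map.
    by move=> z /QP[zZ zC]; exact: (les_mid fg zZ zC).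
  move=> a z aB _ az; rewrite -[z](subrK (cmap F f i a)); apply: smD => //.
  exact: map_Hb.
split.
  by apply: (artin_ext BQ QZ); [apply: artin_subq s1 aC|apply: artin_subq s2 aA];
    apply: Hb_sub_Hz.
by apply: (ndim_ext BQ QZ); [apply: ndim_subq s1 dC|apply: ndim_subq s2 dA];
  apply: Hb_sub_Hz.
Qed.

(** For [p] other than [m], the finiteness of [H^i(R/(p + xR))] passes to its quotient [(0 : x)] in
    [H^(i+1)(R/p)], and from there to the whole module at the cost of one dimension. Since [ndim] is
    shifted, the bound reads: dual dimension at most [i]. *)
Lemma cech_artin N i : fg N ->
  artin (Hz F N i) (Hb F N i) /\ ndim i.+1 (Hz F N i) (Hb F N i).
Proof.
elim: i N => [|i IHi] N; move: N; apply: (devissage nR).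
1,4: by move=> N N0; split; [apply: artin_zero|apply: ndim_zero]; apply: acyclic_zero.
2,4: by move=> A B C f g; apply: cech_artin_ext.
all: move=> p pp; have [pm|[x xxs npx]] := prime_cases pp.
- exact: residue_artin.
- have art : artin (Hz F (quot p) 0) (Hb F (quot p) 0).
    apply: (artin_torsion (x := x)); [exact: Hb_sub_Hz|by move=> z /cech_torsion; apply|].
    exact/artin_zero/kill_prime0.
  split=> //; apply: (ndim_torsion (x := x)) => //; first exact: Hb_sub_Hz.
    by move=> z /cech_torsion; apply.
  exact: kill_prime0.
- have z : acyclic_at F (quot p) i.+1.
    by apply/flasque_acyclic/torsion_flasque/residue_torsion.
  by split; [exact: artin_zero|exact: ndim_zero].
have [aQ dQ] := IHi (quot (im_sm (smul (quot p) x))) (fg_quot _ (fg_quot _ (fg_ring R))).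
have sq := kill_prime_subq i pp npx.
have tors z : Hz F (quot p) i.+1 z -> exists k, Hb F (quot p) i.+1 (x ^+ k *: z).
  by move=> /cech_torsion; apply.
have art : artin (Hz F (quot p) i.+1) (Hb F (quot p) i.+1).
  apply: (artin_torsion (@Hb_sub_Hz _ _) tors).
  exact: (artin_subq (@Hb_sub_Hz _ _) sq).
split=> //; apply: (ndim_torsion (@Hb_sub_Hz _ _) tors) => //.
exact: (ndim_subq (@Hb_sub_Hz _ _) sq).
Qed.

(** The map is factored through its image: [H^d(N)] maps onto [H^d] of the image because [H^(d+1)]
    of the kernel vanishes, and this maps onto [H^d(N')] because [H^d] of the cokernel does. *)
Lemma cech_top_surj N (N' : lmodType R) (h : {linear N -> N'}) (d : nat) : fg N -> fg N' ->
  quo_dim_le (ann N) d%:Z -> quo_dim_le (ann (quot (im_sm h))) (d%:Z - 1) ->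
  forall z', Hz F N' d z' -> exists2 z, Hz F N d z & Hb F N' d (z' - cmap F h d z).
Proof.
move=> fN fN' dN dQ z' z'Z.
have hI x : im_sm h (h x) by exists x.
pose e0 x : subm (im_sm h) := projT1 (cid (inj_subm_ex (hI x))).
have e0E x : inj_subm (im_sm h) (e0 x) = h x.
  exact: (projT2 (cid (inj_subm_ex (hI x)))).
have e0L : linear e0.
  by move=> a u v; apply: (@inj_subm_inj _ _ (im_sm h)); rewrite linP /= !e0E linP.
pose e := mklin e0L.
have es : forall y, exists x, e x = y.
  move=> y; have [x xE] := inj_submP y; exists x.
  by apply: (@inj_subm_inj _ _ (im_sm h)); rewrite mklinE e0E xE.
have aQ := cech_vanish (fg_quot _ fN') dQ (leqnn d).
have [j jZ Hj] := les_mid (short_exact_sub (im_sm h)) z'Z (aQ _ (map_Hz _ z'Z)).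
have ses := short_exact_ker es.
have [a ja] := delta_ex ses jZ.
have aK : acyclic_at F (subm (ker_sm e)) d.+1.
  apply: (@cech_vanish d.+1) => //; first exact: fg_sub.
  apply: (quo_dim_le_trans (k := d%:Z)); first by lia.
  by apply: quo_dim_le_sub dN; apply: ann_inj (@inj_subm_inj _ _ _).
have [z zZ zE] := delta_ker ses ja (aK _ (delta_Hz ses ja)).
exists z => //; rewrite (@cmap_comp _ F _ _ _ e (inj_subm (im_sm h))) ?zE //.
by move=> x; rewrite mklinE e0E.
Qed.

(** By surjectivity [x^t] carries [(0 : x^(t+1)) / (0 : x^t)] onto [(0 : x)], so the chain of the
    [(0 : x^t)] has all its layers as large as [(0 : x)]. *)
Lemma ndim_surj k (H : lmodType R) (x : R) (Z B : submod H) :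
  sm_sub B Z ->
  (forall z, Z z -> exists2 z', Z z' & B (z - x *: z')) -> ndim k.+1 Z B ->
  ndim k (kill_sm x Z B 1) B.
Proof.
move=> BZ xs_surj dZ.
have [||t tP] := dZ (fun t => kill_sm x Z B t).
- by move=> t z [Zz Bz]; split=> //; rewrite exprS -scalerA; apply: smZ.
- by move=> t; split=> z; [move=> Bz; split; [exact: BZ|exact: smZ]|case].
apply: (ndim_subq (rho := fun a a' => B (a' - x ^+ t *: a)) _ _ (tP t (leqnn t))).
  by move=> z [Zz Bz]; split=> //; rewrite exprS -scalerA; apply: smZ.
have surjt s z : Z z -> exists2 z', Z z' & B (z - x ^+ s *: z').
  elim: s z => [|s IH] z Zz; first by exists z; rewrite // scale1r subrr; apply: sm0.
  have [z1 Zz1 Bz1] := IH z Zz; have [z2 Zz2 Bz2] := xs_surj z1 Zz1.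
  exists z2 => //; have := smD Bz1 (smZ (x ^+ s) Bz2).
  by rewrite scalerBr addrA subrK scalerA -exprSr.
split.
- split=> [|r u u' v v' Bu Bv]; first by rewrite scaler0 subr0; apply: sm0.
  by rewrite scalerDr opprD scalerA mulrC -scalerA addrACA -scalerBr; apply: smZD.
- move=> z [Zz Bz]; have [z' Zz' Bz'] := surjt t z Zz; exists z' => //.
  split=> //; rewrite exprS -scalerA -[x *: _](subrK (x *: z)) addrC; apply: smD => //.
  by rewrite -scalerBr -opprB scalerN; apply/smN/smZ.
- by move=> b a' [_ Bb] _ Bab; rewrite -[a'](subrK (x ^+ t *: b)); apply: smD.
Qed.

(* Nonvanishing of the top local cohomology, in a form that can be proved by induction:
   with D = R/p_0, y in p_1 \ p_0 and Q = D/yD, if H^d(D) had dimension < d then (0 : y) in H^d(D) would have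
   dimension < d - 1. As H^(d-1)(D) is Artinian, its quotient by y is a quotient of some (0 : y^t),
   again of dimension < d - 1. So would be H^(d-1)(Q) and its quotient H^(d-1)(R/p_1). *)
Lemma top_ndim (d : nat) (p : nat -> submod R^o) :
  (forall i, (i <= d)%N -> sprime (p i)) ->
  (forall i, (i < d)%N -> (forall x, p i x -> p i.+1 x) /\ exists2 y, p i.+1 y & ~ p i y) ->
  quo_dim_le (idpred (p 0%N)) d%:Z ->
  ~ ndim d (Hz F (quot (p 0%N)) d) (Hb F (quot (p 0%N)) d).
Proof.
elim: d p => [|e IH] p pp pi dp.
  have pm := prime_dim0 (pp 0%N isT) dp.
  move=> /(_ (caug F _ (proj_quot (p 0%N) (1 : R^o)))) H.
  have [] := pp 0%N isT; case; apply/proj_quot_eq0/(@caug_inj _ F)/Hb0/H.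
  by apply/cech_Hz0 => x xxs; apply: residue_torsion.
move=> dH.
have p0 := pp 0%N isT; have [p01 Hy] := pi 0%N isT.
have {Hy}[y p1y np0y] : exists2 y : R, p 1%N y & ~ p 0%N y := Hy.
pose D : lmodType R := quot (p 0%N); rewrite -[quot (p 0%N)]/(D : Type) in dH.
pose Q : lmodType R := quot (im_sm (smul D y)).
have fD : fg D by apply/fg_quot/fg_ring.
have fQ : fg Q by apply: fg_quot.
have dD : quo_dim_le (ann D) e.+1%:Z by apply/quo_dim_le_ann_quot.
have e1 : e%:Z = e.+1%:Z - 1 by lia.
have dQ : quo_dim_le (ann Q) e%:Z.
  rewrite e1; apply: (quo_dim_le_step p0 np0y) dp; last exact: ann_coker_mul.
  by move=> x /ann_quot; apply: ann_surj; exact: proj_quot_surj.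
have ses := prime_smul_exact p0 np0y.
(* The element [y] acts surjectively on the top cohomology of [D], because [Q] has smaller
   dimension. *)
have dT : ndim e (kill_sm y (Hz F D e.+1) (Hb F D e.+1) 1) (Hb F D e.+1).
  apply: ndim_surj dH; first exact: Hb_sub_Hz.
  have dQ' : quo_dim_le (ann (quot (im_sm (smul D y)))) (e.+1%:Z - 1) by rewrite -e1.
  move=> z zZ; have [z' z'Z] := cech_top_surj fD fD dD dQ' zZ.
  by rewrite cech_smul; exists z'.
pose g := proj_quot (im_sm (smul D y)).
(* The image of [H^e(D)] cuts [H^e(Q)] in two: the part above it embeds into [(0 : y)] in
   [H^(e+1)(D)], and the image itself is a quotient of [H^e(D) / y H^e(D)]. *)
pose K := img_sm (cmap F g e) (Hz F D e) (Hb F Q e).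
have BK : sm_sub (Hb F Q e) K.
  by move=> c cB; exists 0; [exact: sm0|rewrite (linear0 (cmap F g e)) subr0].
have KZ : sm_sub K (Hz F Q e).
  move=> c [z zZ cz]; rewrite -[c](subrK (cmap F g e z)).
  by apply: smD; [exact: Hb_Hz|exact: map_Hz].
have dQK : ndim e (Hz F Q e) K.
  apply: (ndim_subq (rho := fun (a : F D e.+1) (c : F Q e) =>
      delta (smul D y) (proj_quot (im_sm (smul D y))) c a)
    _ _ dT).
    by move=> z zB; split; [exact: Hb_Hz|exact: smZ].
  split.
  - split; first by exists 0; rewrite !linear0.
    by move=> r a c a' c' ca ca'; apply: delta_ZD.
  - move=> c cZ; have [a ca] := delta_ex ses cZ; exists a => //.
    split; first exact: delta_Hz ca.
    rewrite expr1 -cech_smul; case: ca => b _ ->; by exists b.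
  - move=> a c aB cZ ca; have [b bZ bE] := delta_ker ses ca aB.
    by exists b => //; rewrite bE subrr; apply: sm0.
have dTt t : ndim e (kill_sm y (Hz F D e) (Hb F D e) t) (Hb F D e).
  case: (e) => [|e']; first exact: kill_prime0.
  apply: ndim_kill; first exact: Hb_sub_Hz.
  apply: (ndim_subq _ (kill_prime_subq e' p0 np0y)); first exact: Hb_sub_Hz.
  exact: (cech_artin _ _).2.
have dKB : ndim e K (Hb F Q e).
  (* With [y^t H = y^(t+1) H] modulo coboundaries, [y^t z = y^(t+1) z'] for some [z']; then
     [z - y z'] lies in [(0 : y^t)] and has the same class as [z] modulo [y H]. *)
  have [t tP] := artin_mul y (@Hb_sub_Hz D e) (cech_artin e fD).1 (@Hb_sub_Hz D e)
    (fun z zZ => zZ).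
  apply: (ndim_subq (rho := fun z c => Hb F Q e (c - cmap F g e z))
    _ _ (dTt t)).
    by move=> z zB; split; [exact: Hb_Hz|exact: smZ].
  split; first exact: linrel_map.
  - move=> c [z zZ cz].
    have [z' z'Z Bz'] : mul_sm y (Hz F D e) (Hb F D e) t.+1 (y ^+ t *: z).
      by apply: (tP t.+1) => //; exists z => //; rewrite subrr; apply: sm0.
    exists (z - y *: z').
      split; first by apply: smB => //; apply: smZ.
      by rewrite scalerBr scalerA -exprSr.
    rewrite linearB -cech_smul.
    have -> : cmap F g e (cmap F (smul D y) e z') = 0.
      by have [_ _ ex] := cmap_exact F e ses; apply/ex; exists z'.
    by rewrite subr0.
  - move=> z c zB _ cz; rewrite -[c](subrK (cmap F g e z)).
    by apply: smD => //; apply: map_Hb.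
have dHQ := ndim_ext BK KZ dQK dKB.
have p1 := pp 1%N isT.
have liftP x : p 0%N x -> proj_quot (p 1%N) x = 0 by move=> /p01 ?; apply/proj_quot_eq0.
pose h0 : {linear D -> quot (p 1%N)} := quot_lift liftP.
have h0P u : im_sm (smul D y) u -> h0 u = 0.
  move=> [v ->]; have [x <-] := proj_quot_surj v; change (h0 (y *: proj_quot (p 0%N) x) = 0).
  rewrite -(linZ (proj_quot _)) quot_liftE; apply/proj_quot_eq0.
  by rewrite /GRing.scale /= mulrC; apply: smZ.
pose h : {linear Q -> quot (p 1%N)} := quot_lift h0P.
have hs u : exists v, h v = u.
  have [x <-] := proj_quot_surj u.
  by exists (proj_quot _ (proj_quot _ x)); rewrite !quot_liftE.
have fp1 : fg (quot (p 1%N)) by apply/fg_quot/fg_ring.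
have := @IH (fun i => p i.+1); apply.
- by move=> i ie; apply: pp.
- by move=> i ie; apply: pi.
- rewrite e1; apply: (quo_dim_le_step p0 np0y) dp; last exact/asboolP.
  by move=> x /p01 ?; apply/asboolP.
apply: (ndim_subq (rho := fun z c => Hb F (quot (p 1%N)) e (c - cmap F h e z)) _ _ dHQ).
  exact: Hb_sub_Hz.
split; first exact: linrel_map.
- move=> z zZ; apply: (cech_top_surj fQ fp1 dQ) => //.
  apply: quo_dim_le_unit; last by lia.
  apply/ann_mem => u; have [v <-] := proj_quot_surj u; rewrite scale1r.
  by apply/proj_quot_eq0; have [w <-] := hs v; exists w.
- move=> z c zB _ cz; rewrite -[c](subrK (cmap F h e z)).
  by apply: smD => //; apply: map_Hb.
Qed.

Lemma top_ann N (d : nat) (P : nat -> {pred R}) r : fg N -> quo_dim_le (ann N) d%:Z ->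
  prime_chain (ann N) d.+1 P -> kills F r N d -> r \in P 0%N.
Proof.
move=> fN dN [Pp Pi] rN.
have [p pE] : exists p : nat -> submod R^o, forall i, (i <= d)%N ->
    sprime (p i) /\ forall x, p i x <-> x \in P i.
  have ex i : exists q : submod R^o, (i <= d)%N -> sprime q /\ forall x, q x <-> x \in P i.
    have [id|//] := leqP i d; last by exists (full_sm R^o).
    by have [q] := prime_sprime (Pp i id).1; exists q.
  by exists (fun i => projT1 (cid (ex i))) => i; exact: (projT2 (cid (ex i))).
have [p0 p0E] := pE 0%N isT.
have annp x : x \in ann N -> p 0%N x by move=> /(Pp 0%N isT).2/p0E.
have dp : quo_dim_le (idpred (p 0%N)) d%:Z.
  by apply: quo_dim_le_sub dN => x /annp px; apply/asboolP.
apply/p0E; apply: contrapT => nr.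
have fD : fg (quot (p 0%N)) by apply/fg_quot/fg_ring.
have [g [n gn]] := nonzero_map p0 fN annp.
have dcoker : quo_dim_le (ann (quot (im_sm g))) (d%:Z - 1).
  (* The cokernel of [g] is killed by [p 0] and by a representative [s] of [g n], which is not in
     [p 0]; hence its dimension is below [d]. *)
  have [s sE] := proj_quot_surj (g n).
  apply: (@quo_dim_le_step R (p 0%N) _ s d%:Z p0 _ _ _ dp); first by move=> /proj_quot_eq0; rewrite sE.
    by move=> x /ann_quot; apply: ann_surj; exact: proj_quot_surj.
  apply/ann_mem => u; have [v <-] := proj_quot_surj u; have [t <-] := proj_quot_surj v.
  rewrite -!linZ; apply/proj_quot_eq0; exists ((t : R) *: n).
  rewrite (linZ g) -sE -(linZ (proj_quot (p 0%N))).
  by congr (proj_quot _ _); rewrite /GRing.scale /= mulrC.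
have dD : quo_dim_le (ann (quot (p 0%N))) d%:Z by apply/quo_dim_le_ann_quot.
have dcoker' : quo_dim_le (ann (quot (im_sm (smul (quot (p 0%N)) r)))) (d%:Z - 1).
  apply: (quo_dim_le_step p0 nr) dp; last exact: ann_coker_mul.
  by move=> x /ann_quot; apply: ann_surj; exact: proj_quot_surj.
have rD : kills F r (quot (p 0%N)) d.
  move=> z zZ; have [y yZ By] := cech_top_surj fN fD dN dcoker zZ.
  rewrite -[z](subrK (cmap F g d y)) scalerDr; apply: smD; first exact: smZ.
  by rewrite -linZ; apply/map_Hb/rN.
apply: (@top_ndim d p) => [i id|i id||]; first exact: (pE i id).1.
- have [_ pi] := pE i (ltnW id); have [_ pi1] := pE i.+1 id.
  have [Pii nPii] := Pi i id; split=> [x /pi/Pii/pi1 //|].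
  apply: contrapT => H; apply: nPii => x /pi1 px; apply/pi; apply: contrapT => npx.
  by apply: H; exists x.
- exact: dp.
- apply: ndim_zero => z zZ; have [y yZ] := cech_top_surj fD fD dD dcoker' zZ.
  rewrite cech_smul => By; rewrite -[z](subrK (r *: y)); apply: smD => //.
  exact: rD.
Qed.
End Local.

(** * The idealization *)

Section CMCriterion.
Variables (T : comNzRingType) (m : {pred T}).
Implicit Types N : lmodType T.

Lemma ann_lc_mul N i a b : a \in ann_lc m N i -> a * b \in ann_lc m N i.
Proof.
move=> /asboolP aI; apply/asboolP => E x xc; rewrite mulrC -scalerA.
move: (aI E x xc); case: (i) E x {xc} => [|j] E x /=; first by move=> ->; rewrite scaler0.
move=> [y /asboolP[t yt] ->]; exists (b *: y); last by rewrite linZ.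
by apply/asboolP; exists t => c /yt cy; rewrite scalerA mulrC -scalerA cy scaler0.
Qed.

Lemma prime_ideal_mul (P I J : {pred T}) : prime_ideal P ->
  {subset ideal_mul I J <= P} <-> {subset I <= P} \/ {subset J <= P}.
Proof.
move=> [[P0 P1 PZD] PM]; split=> [IJP|H].
  have [|nIP] := pselect {subset I <= P}; [by left|right=> b bJ].
  have [a aI /negP aP] : exists2 a, a \in I & ~ a \in P.
    by apply: contrapT => H; apply: nIP => a aI; apply: contrapT => aP; apply: H; exists a.
  have /PM : a * b \in P.
    by apply/IJP/asboolP; exists 1%N, (fun=> a), (fun=> b); rewrite big_ord1.
  by rewrite (negPf aP).
move=> x /asboolP[n [a [b [ab ->]]]].
have PD u v : u \in P -> v \in P -> u + v \in P.
  by move=> uP vP; rewrite -[u]mul1r; apply: PZD.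
have PZ u v : v \in P -> u * v \in P by move=> vP; rewrite -[_ * _]addr0; apply: PZD.
apply: (big_ind (fun x => x \in P)) => // i _; have [aI bJ] := ab i.
by case: H => [IP|JP]; [rewrite mulrC; apply/PZ/IP|apply/PZ/JP].
Qed.

Lemma prime_ann_lc_prod N n (P : {pred T}) : prime_ideal P ->
  {subset ann_lc_prod m N n <= P} <-> exists2 i, (i < n)%N & {subset ann_lc m N i <= P}.
Proof.
move=> pP; rewrite /ann_lc_prod.
have aux (s : seq 'I_n) : {subset \big[@ideal_mul T / (predT : {pred T})]_(i <- s) ann_lc m N i <= P}
    <-> exists2 i : 'I_n, i \in s & {subset ann_lc m N i <= P}.
  elim: s => [|j s IH].
    by rewrite big_nil; split=> [H|[]//]; have [[_ /negP P1 _] _] := pP; case: P1; apply: H.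
  rewrite big_cons (prime_ideal_mul _ _ pP) IH; split=> [[jP|[i is' iP]]|[i]].
  - by exists j; rewrite ?mem_head.
  - by exists i => //; rewrite inE is' orbT.
  - by rewrite inE => /predU1P[-> ?|is' iP]; [left|right; exists i].
rewrite aux; split=> [[i _ iP]|[i lin iP]]; first by exists i.
by exists (Ordinal lin); rewrite ?mem_index_enum.
Qed.

Lemma quo_dim_unique (I : {pred T}) d d' : quo_dim I d -> quo_dim I d' -> d = d'.
Proof.
move=> [ub [c [P [chP cd]]]] [ub' [c' [P' [chP' cd']]]].
by apply/eqP; rewrite eq_le -{1}cd -{2}cd' (ub' _ _ chP) (ub _ _ chP').
Qed.

(** The lowest prime of a chain contains the product only if it contains a factor, and the primes
    above it then do too. The bound [-1 <= k] is that of the empty chain. *)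
Lemma quo_dim_le_ann_lc_prod N n (k : int) : -1 <= k ->
  quo_dim_le (ann_lc_prod m N n) k <-> forall i, (i < n)%N -> quo_dim_le (ann_lc m N i) k.
Proof.
move=> k1; split=> [H i lin [|c] P|H [|c] P]; [by rewrite sub0r| |by rewrite sub0r|].
  move=> [Pp Pi]; apply: H (conj _ Pi) => j jc; have [pj IP] := Pp j jc; split=> //.
  by apply/(prime_ann_lc_prod _ _ pj); exists i.
move=> [Pp Pi]; have [p0 IP0] := Pp 0%N isT.
have [i lin iP0] := (prime_ann_lc_prod _ _ p0).1 IP0.
apply: (H i lin c.+1 P); split=> // j jc; split; first exact: (Pp j jc).1.
elim: j jc => [//|j IH] jc x /IH-/(_ (ltnW jc)).
by have [PP _] := Pi j jc; apply: PP.
Qed.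

Lemma CM_moduleP N (n : nat) (k : int) : -1 <= k -> mod_dim N n%:Z ->
  CM_module k m N <-> forall i, (i < n)%N -> quo_dim_le (ann_lc m N i) k.
Proof.
move=> k1 dN; rewrite -quo_dim_le_ann_lc_prod //.
have nE : absz (Num.max 0 n%:Z) = n by rewrite max_r.
split=> [[d dN' H]|H]; last by exists n%:Z; rewrite ?nE.
by have dE := quo_dim_unique dN' dN; move: H; rewrite dE nE.
Qed.

Lemma CM_ringP (k : int) : local_ring m -> CM_ring T k <-> CM_module k m T^o.
Proof.
move=> lT; split=> [[m' lT' CM]|CM]; last by exists m.
suff <- : m' = m by [].
apply: funext => x; have := lT.2 _ lT'.1 x; by rewrite !unfold_in.
Qed.
End CMCriterion.

Section Idealization.
Variables (R : comNzRingType) (M : lmodType R) (m : {pred R}).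
Hypotheses (nR : noetherian R) (lR : local_ring m) (fM : fg M).
Local Notation S := (idealization M).

Lemma idl_scaleE a (s : S) : a *: s = (a * s.1, a *: s.2) :> S.
Proof. by congr pair; rewrite /= scaler0 addr0. Qed.

Fact idl_snd_linear : linear (fun x : M => (0, x) : S).
Proof. by move=> a x y; rewrite idl_scaleE; congr pair; rewrite /= mulr0 addr0. Qed.
Fact idl_fst_linear : linear (fun s : S => s.1 : R^o).
Proof. by move=> a s t; rewrite idl_scaleE. Qed.
Fact idl_inl_linear : linear (fun a : R^o => (a, 0) : S).
Proof. by move=> a x y; rewrite idl_scaleE; congr pair; rewrite /= scaler0 addr0. Qed.
Fact idl_prr_linear : linear (fun s : S => s.2 : M).
Proof. by move=> a s t; rewrite idl_scaleE. Qed.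
Definition idl_snd : {linear M -> S} := mklin idl_snd_linear.
Definition idl_fst : {linear S -> R^o} := mklin idl_fst_linear.
Definition idl_inl : {linear R^o -> S} := mklin idl_inl_linear.
Definition idl_prr : {linear S -> M} := mklin idl_prr_linear.

Lemma idl_exact : short_exact idl_inl idl_prr.
Proof.
split=> [a b [->] //|c|[a x]]; first by exists (0, c).
by split=> /= [->|[b [_ ->]] //]; exists a.
Qed.

Lemma idl_noeth : noeth_mod (S : lmodType R).
Proof.
apply: (@noeth_ext _ _ _ _ idl_inl idl_prr); last exact: fg_noeth.
  by move=> b; case: idl_exact => _ _ /(_ b)[].
exact: noetherian_mod.
Qed.

Lemma idl_noetherian : noetherian S.
Proof.
apply: mod_noetherian => P.
have PZ (a : R) (u v : S) : P u -> P v -> P (a *: u + v).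
  by move=> Pu Pv; apply: (@smZD _ S^o P (idl_inj M a)).
have [s sP] := idl_noeth (@Submod R S (fun x => P x) (@sm0 _ _ P) PZ).
exists s => x; split=> [/sP[c ->]|]; first by exists (fun i => idl_inj M (c i)).
by apply: span_sub => y /(@mem_span R S s)/sP.
Qed.

Definition idl_max : {pred S} := [pred s | s.1 \in m].

Lemma idl_max_sub (J : {pred S}) : idealr_closed J -> {subset J <= idl_max}.
Proof.
move=> [J0 J1 JZD] [a x] aJ; apply/negPn/negP => /= am.
have [b ba] := local_unit nR lR (am : a \notin m).
(* With [b a = 1], the inverse of [(a, x)] is [(b, - b^2 x)]. *)
move/negP: J1; apply; have := JZD ((b, - (b * b) *: x) : S) _ _ aJ J0.
have -> // : ((b, - (b * b) *: x) : S) * (a, x) + 0 = 1.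
rewrite addr0; congr pair => //=.
rewrite scalerA; have -> : a * - (b * b) = - (b * a * b) by ring.
by rewrite ba mul1r scaleNr addrN.
Qed.

Lemma idl_local : local_ring idl_max.
Proof.
have mI : idealr_closed idl_max.
  have [m0 m1 mZD] := m_ideal lR; split=> // a u v um vm.
  exact: (mZD a.1 u.1 v.1 um vm).
split; first by split=> // J JI _; apply: idl_max_sub.
move=> m' [mI' mmax] x; apply/idP/idP; first exact: idl_max_sub.
by apply: mmax => //; apply: idl_max_sub.
Qed.

Variable xs : seq R.
Hypothesis mE : forall a : R, a \in m <-> in_span (xs : seq R^o) a.

(** The shape of the generators matters: those coming from [M] have square zero, so torsion for the
    maximal ideal of [S] is tested on those coming from [m]. *)
Lemma idl_gens : exists ss : seq S, (forall a : S, a \in idl_max <-> in_span (ss : seq S^o) a) /\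
  (forall s, s \in ss <-> (exists2 x, x \in xs & s = idl_inj M x) \/
    exists2 y : M, y \in projT1 (cid fM) & s = (0, y)).
Proof.
exists (map (idl_inj M) xs ++ map (fun y : M => (0, y) : S) (projT1 (cid fM))).
have sM := projT2 (cid fM).
split=> [[a x]|s]; last first.
  rewrite mem_cat; split=> [/orP[/mapP[x xxs ->]|/mapP[y ys ->]]|[[x xxs ->]|[y ys ->]]].
  - by left; exists x.
  - by right; exists y.
  - by apply/orP; left; apply: map_f.
  - by apply/orP; right; apply: (map_f (fun y : M => (0, y) : S)).
split=> [/= am|].
  have spanZ (t : seq S) (c : S) u : in_span (t : seq S^o) u -> in_span (t : seq S^o) (c * u : S).
    by move=> /span_smE tu; apply/span_smE; apply: (@smZ _ S^o _ c u tu).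
  apply/in_span_cat; exists ((a, 0) : S), ((0, x) : S); split.
  - have [c aE] := (mE a).1 am.
    apply/span_smE; have -> : (a, 0) = \sum_(i < size xs) (idl_inj M (c i) * idl_inj M (xs`_i)) :> S.
      have -> : (a, 0) = idl_inl a :> S by [].
      rewrite aE linear_sum; apply: eq_bigr => i _; rewrite idl_injM //.
    apply: (@sm_sum _ S^o) => i; apply/span_smE/spanZ/(@mem_span _ S^o)/map_f/mem_nth.
    by case: i.
  - have [c ->] := sM x; apply/span_smE.
    have -> : (0, \sum_(i < size (projT1 (cid fM))) c i *: (projT1 (cid fM))`_i)
        = \sum_(i < size (projT1 (cid fM))) (idl_inj M (c i) * (0, (projT1 (cid fM))`_i)) :> S.
      transitivity (idl_snd (\sum_(i < size (projT1 (cid fM))) c i *: (projT1 (cid fM))`_i)) => //.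
      by rewrite linear_sum; apply: eq_bigr => i _; rewrite linZ.
    apply: (@sm_sum _ S^o) => i; apply/span_smE/spanZ/(@mem_span _ S^o).
    by apply: (map_f (fun y : M => (0, y) : S)); apply: mem_nth; case: i.
  - by congr pair; rewrite /= ?addr0 ?add0r.
have [m0 m1 mZD] := m_ideal lR.
have iZD (a0 : S) (u v : S) : u \in idl_max -> v \in idl_max -> a0 * u + v \in idl_max.
  by move=> um vm; exact: (mZD a0.1 u.1 v.1 um vm).
move=> sp; apply: (@span_sub S S^o _ (@Submod S S^o (fun s => s \in idl_max) m0 iZD)) sp => s.
rewrite mem_cat => /orP[/mapP[y yxs ->]|/mapP[y _ ->]] //.
exact: (mem_xs mE yxs).
Qed.

Section Restriction.
Variable E : lmodType S.
(** A copy of the carrier, on which the [R]-module structure does not clash with that over [S]. *)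
Definition restr : Type := E.
HB.instance Definition _ := GRing.Zmodule.on restr.
Definition restr_scale (a : R) (e : restr) : restr := idl_inj M a *: (e : E).
Fact restr_scaleA a b e : restr_scale a (restr_scale b e) = restr_scale (a * b) e.
Proof. by rewrite /restr_scale scalerA idl_injM. Qed.
Fact restr_scale1 : left_id 1 restr_scale.
Proof. by move=> e; rewrite /restr_scale scale1r. Qed.
Fact restr_scaleDr : right_distributive restr_scale +%R.
Proof. by move=> a u v; rewrite /restr_scale scalerDr. Qed.
Fact restr_scaleDl e : {morph restr_scale^~ e : a b / a + b}.
Proof.
move=> a b; rewrite /restr_scale -scalerDl; congr (_ *: _).
by congr pair; rewrite /= addr0.
Qed.
HB.instance Definition _ := GRing.Zmodule_isLmodule.Build R restr
  restr_scaleA restr_scale1 restr_scaleDr restr_scaleDl.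
End Restriction.

Lemma idl_injX a k : idl_inj M (a ^+ k) = idl_inj M a ^+ k.
Proof. by elim: k => [//|k IH]; rewrite !exprS -IH idl_injM. Qed.

Lemma restr_torsion (E : lmodType S) (n : restr E) :
  sections (cech xs) n <-> (n : E) \in @torsion S idl_max E.
Proof.
have [ss [ssE ss_mem]] := idl_gens; rewrite (mem_torsion _ ssE) /sections cech_Hz0.
split=> [H s /ss_mem[[x /H[k kn] ->]|[y _ ->]]|H x xxs].
- by exists k; rewrite -idl_injX.
(* The generators [(0, y)] have square zero, which is where the exponent 2 comes from. *)
- exists 2%N; have -> : ((0, y) : S) ^+ 2 = 0 by congr pair; rewrite /= ?mulr0 ?scale0r ?addr0.
  by rewrite scale0r.
have [|k kn] := H (idl_inj M x); first by apply/ss_mem; left; exists x.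
by exists k; rewrite -idl_injX in kn.
Qed.

(* Injective modules over the idealization are flasque over R, so that an injective resolution
   over the idealization computes the Cech cohomology over R: no independence of base is needed. *)
Lemma idl_lc_kills (E : injective_resolution S^o) r i :
  (forall x : E i, lc_cocycle idl_max x -> lc_coboundary idl_max (idl_inj M r *: x)) <->
  kills (cech xs) r (S : lmodType R) i.
Proof.
pose C j : lmodType R := restr (E j).
have dL j : linear (fun x : C j => res_diff E j x : C j.+1).
  by move=> a u v; apply: (linP (res_diff E j) (idl_inj M a)).
have aL : linear (fun x : S => res_aug E x : C 0%N).
  by move=> a u v; apply: (linP (res_aug E) (idl_inj M a)).
have secE j (n : C j) : sections (cech xs) n <-> (n : E j) \in @torsion S idl_max (E j).
  exact: restr_torsion.
rewrite (@resolution_kills _ (cech xs) S C (mklin aL) (fun j => mklin (dL j)) r i).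
- case: i => [|i]; split=> H x.
  + by move=> /secE xT dx; apply: H.
  + by move=> [/secE xT dx]; apply: H.
  + by move=> /secE xT dx; have [|y /secE] := H x; [split|exists y].
  + by move=> [/secE xT dx]; have [y /secE] := H x xT dx; exists y.
- exact: (@res_aug_inj _ _ E).
- exact: (@res_exact0 _ _ E).
- exact: (@res_exactS _ _ E).
move=> k j; apply: flasque_acyclic.
refine (@injective_flasque S (E k) idl_noetherian (@res_inj _ _ E k) R (idl_inj M) xs [::]
  (C k) id _ _ _ _) => //; first exact: idl_injX.
by move=> e; split=> // _; exists e.
Qed.

(** From left to right an injective resolution must be exhibited, for otherwise the condition
    defining [ann_lc] would be vacuous. *)
Lemma ann_lcP (N : lmodType R) i r : r \in ann_lc m N i <-> kills (cech xs) r N i.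
Proof.
split=> [/asboolP H|H]; last by apply/asboolP => E; apply/(lc_kills r i nR mE E).
by have [E _] := injective_resolution_ex N; apply/(lc_kills r i nR mE E)/H.
Qed.

Lemma idl_ann_lcP i r :
  idl_inj M r \in ann_lc idl_max S^o i <-> r \in ann_lc m (S : lmodType R) i.
Proof.
rewrite ann_lcP; split=> [/asboolP H|H]; last by apply/asboolP => E; apply/idl_lc_kills.
by have [E _] := injective_resolution_ex (S^o : lmodType S); apply/(idl_lc_kills E)/H.
Qed.

Definition idl_lift (Q : {pred R}) : {pred S} := [pred s | s.1 \in Q].
Definition idl_restr (P : {pred S}) : {pred R} := [pred a | idl_inj M a \in P].

Lemma idl_lift_prime Q : prime_ideal Q -> prime_ideal (idl_lift Q).
Proof.
move=> [[Q0 Q1 QZD] QM]; split; last by move=> u v; apply: QM.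
by split=> // a u v uQ vQ; apply: (QZD a.1 u.1 v.1).
Qed.

Lemma idl_restr_prime P : prime_ideal P -> prime_ideal (idl_restr P).
Proof.
move=> [[P0 P1 PZD] PM]; split; last first.
  by move=> u v; rewrite inE -idl_injM => /PM.
split=> // a u v uP vP; rewrite inE.
have -> : idl_inj M (a * u + v) = idl_inj M a * idl_inj M u + idl_inj M v.
  by rewrite idl_injM; congr pair; rewrite /= addr0.
exact: PZD.
Qed.

(** Every prime of [S] contains the elements [(0, x)], since their squares vanish. *)
Lemma idl_liftK P : prime_ideal P -> forall s, (s \in P) = (s \in idl_lift (idl_restr P)).
Proof.
move=> [[P0 P1 PZD] PM] [a x]; rewrite !inE /=.
have xP : ((0, x) : S) \in P.
  have : ((0, x) : S) * (0, x) \in P.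
    by have -> // : ((0, x) : S) * (0, x) = 0; congr pair; rewrite /= ?mulr0 ?scale0r ?addr0.
  by move=> /PM/orP[].
have aE : (a, x) = idl_inj M a + (0, x) :> S by congr pair; rewrite /= ?addr0 ?add0r.
apply/idP/idP => H.
  have := PZD (-1) _ _ xP H; have -> // : -1 * ((0, x) : S) + (a, x) = idl_inj M a.
  by rewrite aE mulN1r addrCA addNr addr0.
by rewrite aE -[idl_inj M a]mul1r; apply: PZD.
Qed.

Lemma idl_quo_dim_le (I : {pred S}) (J : {pred R}) k :
  (forall Q, prime_ideal Q -> {subset J <= Q} <-> {subset I <= idl_lift Q}) ->
  quo_dim_le I k <-> quo_dim_le J k.
Proof.
move=> IJ; split=> H c P [Pp Pi].
  apply: (H c (fun i => idl_lift (P i))); split=> i ic.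
    have [pP JP] := Pp i ic; split; first exact: idl_lift_prime.
    exact/IJ.
  have [PP nPP] := Pi i ic; split=> [s /PP //|sPP].
  by apply: nPP => a; apply: (sPP (a, 0)).
apply: (H c (fun i => idl_restr (P i))); split=> i ic.
  have [pP IP] := Pp i ic; split; first exact: idl_restr_prime.
  apply/IJ; first exact: idl_restr_prime.
  by move=> s /IP; rewrite (idl_liftK pP).
have [PP nPP] := Pi i ic; split=> [s /PP //|sPP]; apply: nPP => s.
by rewrite (idl_liftK (Pp _ ic).1) (idl_liftK (Pp _ (ltnW ic)).1) => /sPP.
Qed.

Lemma idl_ann_lc_dim i k :
  quo_dim_le (ann_lc idl_max S^o i) k <-> quo_dim_le (ann_lc m (S : lmodType R) i) k.
Proof.
apply: idl_quo_dim_le => Q [_ QM]; split=> H.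
  (* Only the trace on [R] of the annihilator over [S] is known. The product
     [(a, x)(a, -x) = (a^2, 0)] lands in it, and a prime containing [a^2] contains [a]. *)
  move=> [a x] aI; suff : a * a \in Q by move=> /QM/orP[].
  apply/H/idl_ann_lcP.
  have -> : idl_inj M (a * a) = ((a, x) : S) * (a, - x).
    by congr pair; rewrite /= scalerN addNr.
  exact: ann_lc_mul.
by move=> a /idl_ann_lcP/H.
Qed.
End Idealization.

Lemma kills_split (R : comNzRingType) (F : cfunctor R) (A B C : lmodType R)
    (i1 : {linear A -> B}) (p2 : {linear B -> C}) (p1 : {linear B -> A}) (i2 : {linear C -> B})
    r i : short_exact i1 p2 -> (forall a, p1 (i1 a) = a) -> (forall c, p2 (i2 c) = c) ->
  kills F r B i <-> kills F r A i /\ kills F r C i.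
Proof.
move=> ses p1K p2K.
have c1K a : cmap F p1 i (cmap F i1 i a) = a.
  by rewrite -(@cmap_comp _ F _ _ _ _ _ (complin p1 i1)) //; apply: cmap_id.
have c2K c : cmap F p2 i (cmap F i2 i c) = c.
  by rewrite -(@cmap_comp _ F _ _ _ _ _ (complin p2 i2)) //; apply: cmap_id.
split=> [rB|[rA rC] z zZ].
  split=> z zZ; first by rewrite -[z]c1K -linZ; apply/map_Hb/rB/map_Hz.
  by rewrite -[z]c2K -linZ; apply/map_Hb/rB/map_Hz.
have wZ : Hz F B i (z - cmap F i2 i (cmap F p2 i z)).
  by apply: smB => //; do 2!apply: map_Hz.
have [|a aZ Ba] := les_mid ses wZ; first by rewrite linearB c2K subrr; apply: sm0.
rewrite -[z](subrK (cmap F i2 i (cmap F p2 i z))) scalerDr; apply: smD; last first.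
  by rewrite -linZ; apply/map_Hb/rC/map_Hz.
rewrite -[z - _](subrK (cmap F i1 i a)) scalerDr; apply: smD; first exact: smZ.
by rewrite -linZ; apply/map_Hb/rA.
Qed.

Lemma mod_dim_ex (R : comNzRingType) (N : lmodType R) (m : {pred R}) (n : nat) :
  noetherian R -> local_ring m -> ring_dim R n%:Z -> (exists x : N, x <> 0) ->
  exists2 d : nat, (d <= n)%N & mod_dim N d%:Z.
Proof.
move=> nR lR [dR _] [x x0].
have ub c P : prime_chain (ann N) c P -> (c <= n.+1)%N.
  move=> [Pp Pi]; suff /dR : prime_chain (pred1 0) c P by lia.
  split=> // i ic; have [pP _] := Pp i ic; split=> // y; rewrite inE => /eqP ->.
  by case: pP => -[].
have ex : exists c, `[< exists P, prime_chain (ann N) c P >].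
  by exists 0%N; apply/asboolP; exists (fun=> m).
have ub' c : `[< exists P, prime_chain (ann N) c P >] -> (c <= n.+1)%N.
  by move=> /asboolP[P]; apply: ub.
case: (ex_maxnP ex ub') => c /asboolP[P chP] cmax.
(* A nonzero element has a proper annihilator, so [m] alone is a chain over [ann N] and the
   dimension is a natural number. *)
have c0 : (0 < c)%N.
  apply: cmax; apply/asboolP; exists (fun=> m); split=> // i _; split; first exact: (m_prime nR lR).
  move=> a /ann_mem aN; apply: (@proper_sub_m _ m nR lR (ann_sm x)); last exact: aN.
  by rewrite /= scale1r.
exists c.-1; first by have := ub _ _ chP; lia.
split; last by exists c, P; split=> //; lia.
move=> c' P' chP'; have : (c' <= c)%N by apply: cmax; apply/asboolP; exists P'.
lia.
Qed.

Lemma quo_dimE (R : comNzRingType) (I : {pred R}) k :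
  quo_dim I k <-> quo_dim_le I k /\ ~ quo_dim_le I (k - 1).
Proof.
split=> [[dI [c [P [chP ck]]]]|[dI ndI]]; first by split=> // /(_ c P chP); lia.
split=> //; apply: contrapT => H; apply: ndI => c P chP.
have := dI c P chP; have : c%:Z - 1 <> k by move=> ck; apply: H; exists c, P.
lia.
Qed.

Lemma quo_dim_eq (R R' : comNzRingType) (I : {pred R}) (J : {pred R'}) k :
  (forall l, quo_dim_le I l <-> quo_dim_le J l) -> quo_dim I k -> quo_dim J k.
Proof. by move=> IJ; rewrite !quo_dimE !IJ. Qed.

(** * The criteria for the idealization *)

Section Main.
Variables (R : comNzRingType) (m : {pred R}) (n : nat) (M : lmodType R).
Hypotheses (nR : noetherian R) (lR : local_ring m) (dR : ring_dim R n%:Z).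
Hypotheses (fM : fg M) (M0 : exists x : M, x <> 0).
Local Notation S := (idealization M).

Lemma m_gens : exists xs : seq R, forall a : R, a \in m <-> in_span (xs : seq R^o) a.
Proof.
have [m0 m1 mZD] := m_ideal lR.
have [s sE] := nR (conj m0 mZD : ideal m); by exists s.
Qed.

(** The product of an element of [I] and one of [J] is in [L], so the lowest prime of a chain over
    [L] contains [I] or [J]. *)
Lemma quo_dim_cap (I J L : {pred R}) k : (forall a b, a \in I -> a * b \in I) ->
  (forall a b, a \in J -> a * b \in J) -> (forall a, a \in L <-> a \in I /\ a \in J) ->
  quo_dim_le L k <-> quo_dim_le I k /\ quo_dim_le J k.
Proof.
move=> aI aJ LE; split=> [dL|[dI dJ] [|c] P].
- by split; apply: quo_dim_le_sub dL => a /LE[].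
- by move=> _; apply: (dI 0%N P).
move=> [Pp Pi]; have [p0 LP0] := Pp 0%N isT.
have Pmon j x : (j < c.+1)%N -> x \in P 0%N -> x \in P j.
  elim: j => [//|j IH] jc x0; have [PP _] := Pi j jc; apply: PP; exact: IH (ltnW jc) x0.
have [IP|nIP] := pselect {subset I <= P 0%N}.
  apply: (dI c.+1 P); split=> // j jc; split; first exact: (Pp j jc).1.
  by move=> x /IP; apply: Pmon.
apply: (dJ c.+1 P); split=> // j jc; split; first exact: (Pp j jc).1.
move=> x xJ; apply: Pmon => //.
have [a aI' /negP aP] : exists2 a, a \in I & ~ a \in P 0%N.
  by apply: contrapT => H; apply: nIP => a aI'; apply: contrapT => aP; apply: H; exists a.
have /p0.2 : a * x \in P 0%N.
  by apply/LP0/LE; split; [exact: aI|rewrite mulrC; exact: aJ].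
by rewrite (negPf aP).
Qed.

Lemma ann_lc_idl i a : a \in ann_lc m (S : lmodType R) i <->
  a \in ann_lc m R^o i /\ a \in ann_lc m M i.
Proof.
have [xs mE] := m_gens; rewrite !(ann_lcP nR mE).
exact: (@kills_split R (cech xs) R^o S M (idl_inl M) (idl_prr M) (idl_fst M) (idl_snd M)
  a i (idl_exact M) (fun _ => erefl) (fun _ => erefl)).
Qed.

Lemma mod_dim_faithful (N : lmodType R) : (forall a, a \in ann N -> a = 0) -> mod_dim N n%:Z.
Proof.
move=> annN; apply: quo_dim_eq dR => k; split; apply: quo_dim_le_sub => a.
  by rewrite inE => /eqP ->; apply/ann_mem => x; rewrite scale0r.
by move=> /annN ->; rewrite inE.
Qed.

Lemma mod_dim_ring : mod_dim R^o n%:Z.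
Proof.
by apply: mod_dim_faithful => a /ann_mem/(_ 1); rewrite /GRing.scale /= mulr1.
Qed.

Lemma mod_dim_idl : mod_dim (S : lmodType R) n%:Z.
Proof.
apply: mod_dim_faithful => a /ann_mem/(_ 1)/(congr1 fst).
by rewrite idl_scaleE /= mulr1.
Qed.

Lemma mod_dim_idl_ring : mod_dim (S^o : lmodType S) n%:Z.
Proof.
apply: quo_dim_eq dR => k; apply: iff_sym; apply: idl_quo_dim_le => Q [[Q0 _ _] _].
split=> _ s; last by rewrite inE => /eqP ->.
by move=> /ann_mem/(_ 1); rewrite /GRing.scale /= mulr1 => ->; rewrite !inE.
Qed.

Lemma CM_idl_ring (k : int) : -1 <= k ->
  CM_ring S k <-> CM_module k m (S : lmodType R).
Proof.
move=> k1; have [xs mE] := m_gens.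
rewrite (CM_ringP _ (idl_local M nR lR)) (CM_moduleP _ k1 mod_dim_idl_ring).
rewrite (CM_moduleP _ k1 mod_dim_idl).
by split=> H i lin; apply/(idl_ann_lc_dim nR lR fM mE)/H.
Qed.

(** Since [S] and [R] have dimension [n], the condition left on [M] runs over all [i < n], even when
    [dim M < n]. *)
Lemma CM_idl_split (k : int) : -1 <= k -> CM_module k m (S : lmodType R) <->
  CM_ring R k /\ forall i, (i < n)%N -> quo_dim_le (ann_lc m M i) k.
Proof.
move=> k1; rewrite (CM_ringP _ lR) (CM_moduleP _ k1 mod_dim_idl) (CM_moduleP _ k1 mod_dim_ring).
have cap i := @quo_dim_cap _ _ _ k (fun a b => @ann_lc_mul R m R^o i a b)
  (fun a b => @ann_lc_mul R m M i a b) (ann_lc_idl i).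
split=> [H|[HR HM] i lin]; last by apply/cap; split; [exact: HR|exact: HM].
by split=> i lin; have /cap[] := H i lin.
Qed.

(** If [d = dim M < n], the index [i = d] is included; by [top_ann] a longest chain of primes over
    [Ann M] is also a chain over [Ann H^d(M)], so [d <= k]. Conversely [Ann M] annihilates every
    [H^i(M)]. *)
Lemma CM_top (k : int) : -1 <= k -> (forall i, (i < n)%N -> quo_dim_le (ann_lc m M i) k) <->
  mod_dim_le M k \/ CM_module k m M /\ mod_dim M n%:Z.
Proof.
move=> k1; have [xs mE] := m_gens; split=> [H|[dM|[CM dM]]]; last 2 first.
- move=> i _; apply: quo_dim_le_sub dM => a /ann_mem aM; apply/(ann_lcP nR mE) => z zZ.
  (* An element that annihilates [M] acts on the Cech complex through that of the zero module. *)
  rewrite -cech_smul (@cmap_comp _ _ _ _ _ (zeroC M (zero_mod R)) (zeroC (zero_mod R) M)).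
    apply: map_Hb; apply: acyclic_zero; last exact: map_Hz.
    by move=> u; apply: zero_modE.
  by move=> x; rewrite mklinE aM mklinE.
- exact/(CM_moduleP m k1 dM).
have [d dn dM] := mod_dim_ex nR lR dR M0.
have [dE|dltn] := eqVneq d n.
  right; rewrite -dE; split=> //; apply/(CM_moduleP m k1 dM) => i; rewrite dE; exact: H.
left; have {}dltn : (d < n)%N by rewrite ltn_neqAle dltn.
apply: quo_dim_le_trans dM.1; have [dMle [c [P [chP cd]]]] := dM.
have {}cd : c = d.+1 by lia.
rewrite {}cd in chP; have [Pp Pi] := chP.
have Pmon j x : (j < d.+1)%N -> x \in P 0%N -> x \in P j.
  elim: j => [//|j IH] jc x0; have [PP _] := Pi j jc; apply: PP; exact: IH (ltnW jc) x0.
have := H d dltn d.+1 P; rewrite (_ : d.+1%:Z - 1 = d%:Z); last by lia.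
apply; split=> // j jd; split; first exact: (Pp j jd).1.
move=> r /(ann_lcP nR mE) rM; apply: Pmon => //.
exact: (top_ann nR lR mE fM dMle chP rM).
Qed.
End Main.

Theorem corollary3p4 (R : comNzRingType) (m : {pred R}) (n : nat)
    (M : lmodType R) :
  noetherian R -> local_ring m -> ring_dim R n%:Z ->
  finitely_generated M -> (exists x : M, x <> 0) ->
  [/\ (CM_ring (idealization M) (-1) <-> CM_module (-1) m (idealization M)) /\
      (CM_module (-1) m (idealization M) <->
         (CM_ring R (-1) /\ ring_dim R n%:Z) /\
         (CM_module (-1) m M /\ mod_dim M n%:Z)),
      (CM_ring (idealization M) 0 <-> CM_module 0 m (idealization M)) /\
      (CM_module 0 m (idealization M) <->
         CM_ring R 0 /\
         (mod_dim_le M 0 \/ CM_module 0 m M /\ mod_dim M n%:Z)) &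
      (CM_ring (idealization M) 1 <-> CM_module 1 m (idealization M)) /\
      (CM_module 1 m (idealization M) <->
         CM_ring R 1 /\
         (mod_dim_le M 1 \/ CM_module 1 m M /\ mod_dim M n%:Z))].
Proof.
move=> nR lR dR fM M0.
have ringE k k1 := @CM_idl_ring R m n M nR lR dR fM k k1.
have modE (k : int) (k1 : -1 <= k) : CM_module k m (idealization M) <->
    CM_ring R k /\ (mod_dim_le M k \/ CM_module k m M /\ mod_dim M n%:Z).
  by rewrite (CM_idl_split M nR lR dR k1) (CM_top nR lR dR fM M0 k1).
split; [|by split; [exact: ringE|exact: modE]|by split; [exact: ringE|exact: modE]].
split; first exact: ringE.
rewrite modE //; split=> [[CR [dM|H]]|[[CR _] H]]; [|by []|by split; [|right]].
(* For [k = -1] the first alternative would give [dim M <= -1], impossible for nonzero [M]. *)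
have [d _ [_ [c [P [chP cd]]]]] := mod_dim_ex nR lR dR M0.
have := dM c P chP; lia.
Qed.
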